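(* Fix $(\omega_0,A_0)\in\mathcal{P}_1\cup\mathcal{P}_3$ and let $\phi_{(\omega_0,A_0)}$ be an even periodic solution, not changing sign, of $-\phi''+\omega_0\phi-\phi\log\phi^2+A_0=0$ as described in items (i)–(iv) below, with period $L_0$. Then there are an open neighborhood $\mathcal{O}$ of $(\omega_0,A_0)$ and a family $(\omega,A)\in\mathcal{O}\mapsto\psi_{(\omega,A)}\in H^2_{per,e}([0,L_0])$ of $L_0$-periodic solutions of $-\psi''+\omega\psi-\psi\log\psi^2+A=0$, depending smoothly on $(\omega,A)$, with $\psi_{(\omega_0,A_0)}=\phi_{(\omega_0,A_0)}$.
   Context: $\mathcal{P}_1=\{(\omega,A):|A|<2e^{\omega/2-1}\}$, $\mathcal{P}_3=\{(\omega,A):|A|>2e^{\omega/2-1}\}$. With $g(\omega,A,\phi)=\omega\phi-\phi\log\phi^2+A$: on $\mathcal{P}_1$, $g(\omega,A,\cdot)$ has three zeros $r_0<r_1<r_2$; on $\mathcal{P}_3$ a unique zero $r_2$. The sign-definite even periodic solutions considered are: (i) on $\mathcal{P}_1$, $A<0$: positive solutions turning around $(r_2,0)$, or negative solutions turning around $(r_0,0)$ close to it; (ii) on $\mathcal{P}_1$, $A>0$: negative solutions around $(r_0,0)$, or positive ones around $(r_2,0)$ close to it; (iii)–(iv) on $\mathcal{P}_3$: solutions around $(r_2,0)$ close to it (negative if $A<0$, positive if $A>0$). $H^2_{per,e}([0,L_0])$ denotes even functions in $H^2_{per}([0,L_0])$. *)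

(* Defs.v *)
From Stdlib Require Import Reals Lra.
Open Scope R_scope.

(* nonlinearity g(w,A,p) = w p - p log p^2 + A  (log p^2 via Stdlib ln; at p = 0
   ln 0 is Stdlib's default value, so p * ln (p^2) = 0 there, the continuous extension) *)
Definition g (w A p : R) : R := w * p - p * ln (p ^ 2) + A.

Definition P1 (w A : R) : Prop := Rabs A < 2 * exp (w / 2 - 1).
Definition P3 (w A : R) : Prop := Rabs A > 2 * exp (w / 2 - 1).

Definition is_solution (w A : R) (phi : R -> R) : Prop :=
  exists d1 d2 : R -> R,
    forall x, derivable_pt_lim phi x (d1 x) /\ derivable_pt_lim d1 x (d2 x) /\
              - d2 x + w * phi x - phi x * ln (phi x ^ 2) + A = 0.

Definition is_even (phi : R -> R) : Prop := forall x, phi (- x) = phi x.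

Definition is_periodic (L : R) (phi : R -> R) : Prop := forall x, phi (x + L) = phi x.

Definition has_min_period (L : R) (phi : R -> R) : Prop :=
  0 < L /\ is_periodic L phi /\
  forall T, 0 < T < L -> exists x, phi (x + T) <> phi x.

(* the (closed) phase-plane orbit of phi turns around the equilibrium (r,0):
   for a periodic solution the orbit is a closed curve symmetric in phi' crossing
   the axis at min phi and max phi, so it encircles (r,0) iff min phi < r < max phi *)
Definition turns_around (phi : R -> R) (r : R) : Prop :=
  exists x y, phi x < r < phi y.

Definition close_to (delta : R) (phi : R -> R) (r : R) : Prop :=
  forall x, Rabs (phi x - r) < delta.

(* the sign-definite even periodic solutions of items (i)-(iv);
   delta quantifies "close to" the equilibrium *)
Definition admissible (w0 A0 delta : R) (phi : R -> R) : Prop :=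
  (P1 w0 A0 /\
   exists r0 r1 r2, r0 < r1 < r2 /\ g w0 A0 r0 = 0 /\ g w0 A0 r1 = 0 /\ g w0 A0 r2 = 0 /\
     (forall r, g w0 A0 r = 0 -> r = r0 \/ r = r1 \/ r = r2) /\
     ((A0 < 0 /\ (((forall x, 0 < phi x) /\ turns_around phi r2) \/
                  ((forall x, phi x < 0) /\ turns_around phi r0 /\ close_to delta phi r0))) \/
      (0 < A0 /\ (((forall x, phi x < 0) /\ turns_around phi r0) \/
                  ((forall x, 0 < phi x) /\ turns_around phi r2 /\ close_to delta phi r2)))))
  \/
  (P3 w0 A0 /\
   exists r2, g w0 A0 r2 = 0 /\ (forall r, g w0 A0 r = 0 -> r = r2) /\
     turns_around phi r2 /\ close_to delta phi r2 /\
     ((A0 < 0 /\ forall x, phi x < 0) \/ (0 < A0 /\ forall x, 0 < phi x))).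

Definition open2 (O : R -> R -> Prop) : Prop :=
  forall w A, O w A -> exists r, 0 < r /\
    forall w' A', Rabs (w' - w) < r -> Rabs (A' - A) < r -> O w' A'.

Definition cont3 (U : R -> R -> R -> Prop) (f : R -> R -> R -> R) : Prop :=
  forall a b c, U a b c -> forall eps, 0 < eps -> exists del, 0 < del /\
    forall a' b' c', Rabs (a' - a) < del -> Rabs (b' - b) < del -> Rabs (c' - c) < del ->
      Rabs (f a' b' c' - f a b c) < eps.

(* C^n on U (U open): all partial derivatives up to order n exist and are continuous *)
Fixpoint C3 (n : nat) (U : R -> R -> R -> Prop) (f : R -> R -> R -> R) : Prop :=
  match n with
  | O => cont3 U f
  | S m => cont3 U f /\ exists f1 f2 f3 : R -> R -> R -> R,
      (forall a b c, U a b c ->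
         derivable_pt_lim (fun t => f t b c) a (f1 a b c) /\
         derivable_pt_lim (fun t => f a t c) b (f2 a b c) /\
         derivable_pt_lim (fun t => f a b t) c (f3 a b c)) /\
      C3 m U f1 /\ C3 m U f2 /\ C3 m U f3
  end.

Definition smooth3 (U : R -> R -> R -> Prop) (f : R -> R -> R -> R) : Prop :=
  forall n, C3 n U f.

(* Main.v *)
Require Import Defs.
From Stdlib Require Import Reals Lra Psatz Classical ClassicalEpsilon FunctionalExtensionality Ranalysis5.
From Coquelicot Require Import Coquelicot.
Open Scope R_scope.

(* By [phi |-> - phi, A |-> - A] the solution may be taken positive.  Dividing by the
   center [r] of its well turns the equation into [y'' = - force c y] with [c = A / r] and
   [y = 1] as center.  Let [pot] be the potential and [sigma] the smooth coordinate with
   [sigma^2 = 2 pot].  In the polar coordinates [sigma = rho cos th], [y' = - rho sin th] the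
   amplitude [rho] is constant and [dt / dth = h_s (rho cos th)], where [h] inverts [sigma];
   so the flow is a regular quadrature and its smoothness needs no theory of ODEs.  The period
   [int_0^2pi h_s (rho cos th) dth] is strictly monotone in [rho > 0], because
   [h_sss > 0] off the center: Chicone's expression, which is positive by Schaaf's criterion.
   The implicit function theorem then solves "period = L0" for the amplitude as a smooth
   function of [c]; the orbits of this amplitude form the family. *)

(** * Functions of class C^n of three variables *)

(** The nonlinearity is smooth only away from 0, so the nearby orbits must be kept positive. One
    fixed level [al] below the minimum of the given orbit, with [force c al < 0], achieves this:
    [force c] is convex, so this single sign makes 1 the only equilibrium to the right of [al], and
    it is an open condition on [c], as is the bound on the amplitude. The normalized equation
    contains only [c] and the scaling leaves [x] alone, so prescribing the period is one scalar
    equation in the amplitude with one parameter. Amplitudes are signed, because an even solution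
    may have either its maximum or its minimum at 0. Polar angles replace the usual quadrature
    between turning points, whose integrand is singular there. Over a full turn [cos] has mean zero,
    so the derivative of the period sees only the increment of [h_ss] from its value at the center;
    positivity of [h_sss] off the center is then enough. All smooth functions are encoded with three
    arguments, dummies included, so that one composition lemma and one implicit function theorem
    serve throughout. *)

Definition open3 (U : R -> R -> R -> Prop) : Prop :=
  forall a b c, U a b c -> exists r, 0 < r /\
    forall a' b' c', Rabs (a' - a) < r -> Rabs (b' - b) < r -> Rabs (c' - c) < r ->
      U a' b' c'.

Definition partials3 (U : R -> R -> R -> Prop) (f f1 f2 f3 : R -> R -> R -> R) : Prop :=
  forall a b c, U a b c ->
    derivable_pt_lim (fun t => f t b c) a (f1 a b c) /\
    derivable_pt_lim (fun t => f a t c) b (f2 a b c) /\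
    derivable_pt_lim (fun t => f a b t) c (f3 a b c).

Lemma Rabs_minus_diag (a r : R) : 0 < r -> Rabs (a - a) < r.
Proof. intros H. rewrite Rminus_diag, Rabs_R0. exact H. Qed.

(** Bridge to continuity on the product space, whose balls are the same boxes; sums and products
    inherit continuity through it. *)
Lemma cont3_iff (f : R -> R -> R -> R) (a b c : R) :
  (forall eps, 0 < eps -> exists del, 0 < del /\
    forall a' b' c', Rabs (a' - a) < del -> Rabs (b' - b) < del -> Rabs (c' - c) < del ->
      Rabs (f a' b' c' - f a b c) < eps) <->
  continuous (fun p : R * (R * R) => f (fst p) (fst (snd p)) (snd (snd p))) (a, (b, c)).
Proof.
  split.
  - intros H. apply filterlim_locally. intros eps.
    destruct (H eps (cond_pos eps)) as [d [Hd H']].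
    exists (mkposreal d Hd). intros [a' [b' c']] [Ha [Hb Hc]]. apply H'; assumption.
  - intros H eps He.
    destruct (proj1 (filterlim_locally _ _) H (mkposreal eps He)) as [d Hd].
    exists d. split; [apply cond_pos |].
    intros a' b' c' Ha Hb Hc. apply (Hd (a', (b', c'))). repeat split; assumption.
Qed.

Lemma cont3_continuous U f a b c : cont3 U f -> U a b c ->
  continuous (fun p : R * (R * R) => f (fst p) (fst (snd p)) (snd (snd p))) (a, (b, c)).
Proof. intros H HU. apply cont3_iff. exact (H a b c HU). Qed.

Lemma cont3_plus U f g : cont3 U f -> cont3 U g -> cont3 U (fun a b c => f a b c + g a b c).
Proof.
  intros Hf Hg a b c HU. apply (proj2 (cont3_iff (fun a b c => f a b c + g a b c) a b c)).
  apply @continuous_plus; [exact (cont3_continuous _ _ _ _ _ Hf HU)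
                         | exact (cont3_continuous _ _ _ _ _ Hg HU)].
Qed.

Lemma cont3_mult U f g : cont3 U f -> cont3 U g -> cont3 U (fun a b c => f a b c * g a b c).
Proof.
  intros Hf Hg a b c HU. apply (proj2 (cont3_iff (fun a b c => f a b c * g a b c) a b c)).
  apply @continuous_mult; [exact (cont3_continuous _ _ _ _ _ Hf HU)
                         | exact (cont3_continuous _ _ _ _ _ Hg HU)].
Qed.

Lemma cont3_comp U V f u1 u2 u3 :
  cont3 V f -> cont3 U u1 -> cont3 U u2 -> cont3 U u3 ->
  (forall a b c, U a b c -> V (u1 a b c) (u2 a b c) (u3 a b c)) ->
  cont3 U (fun a b c => f (u1 a b c) (u2 a b c) (u3 a b c)).
Proof.
  intros Hf H1 H2 H3 HV a b c HU eps He.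
  destruct (Hf _ _ _ (HV a b c HU) eps He) as [d [Hd Hf']].
  destruct (H1 a b c HU d Hd) as [d1 [Hd1 H1']].
  destruct (H2 a b c HU d Hd) as [d2 [Hd2 H2']].
  destruct (H3 a b c HU d Hd) as [d3 [Hd3 H3']].
  exists (Rmin d1 (Rmin d2 d3)). split; [repeat apply Rmin_pos; assumption |].
  intros a' b' c' Ha Hb Hc.
  pose proof (Rmin_l d1 (Rmin d2 d3)). pose proof (Rmin_r d1 (Rmin d2 d3)).
  pose proof (Rmin_l d2 d3). pose proof (Rmin_r d2 d3).
  apply Hf'; [apply H1' | apply H2' | apply H3']; lra.
Qed.

Lemma cont3_ext U f g : open3 U -> (forall a b c, U a b c -> f a b c = g a b c) ->
  cont3 U f -> cont3 U g.
Proof.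
  intros HO E H a b c HU eps He.
  destruct (HO a b c HU) as [r [Hr HrU]]. destruct (H a b c HU eps He) as [d [Hd H']].
  exists (Rmin d r). split; [apply Rmin_pos; assumption |].
  intros a' b' c' Ha Hb Hc. pose proof (Rmin_l d r). pose proof (Rmin_r d r).
  rewrite <- (E a b c HU), <- (E a' b' c'); [apply H' | apply HrU]; lra.
Qed.

Lemma cont3_pos U f a b c : cont3 U f -> U a b c -> 0 < f a b c ->
  exists r, 0 < r /\ forall a' b' c',
    Rabs (a' - a) < r -> Rabs (b' - b) < r -> Rabs (c' - c) < r -> 0 < f a' b' c'.
Proof.
  intros H HU Hp. destruct (H a b c HU _ Hp) as [d [Hd H']]. exists d. split; [exact Hd |].
  intros a' b' c' Ha Hb Hc. specialize (H' a' b' c' Ha Hb Hc).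
  apply Rabs_def2 in H'. lra.
Qed.

Lemma open3_and U V : open3 U -> open3 V -> open3 (fun a b c => U a b c /\ V a b c).
Proof.
  intros H1 H2 a b c [HU HV].
  destruct (H1 a b c HU) as [r [Hr HrU]]. destruct (H2 a b c HV) as [s [Hs HsV]].
  exists (Rmin r s). split; [apply Rmin_pos; assumption |].
  intros a' b' c' Ha Hb Hc. pose proof (Rmin_l r s). pose proof (Rmin_r r s).
  split; [apply HrU | apply HsV]; lra.
Qed.

Lemma open3_and_pos U f : open3 U -> cont3 U f -> open3 (fun a b c => U a b c /\ 0 < f a b c).
Proof.
  intros H1 H2 a b c [HU HV].
  destruct (H1 a b c HU) as [r [Hr HrU]].
  destruct (cont3_pos U f a b c H2 HU HV) as [s [Hs HsV]].
  exists (Rmin r s). split; [apply Rmin_pos; assumption |].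
  intros a' b' c' Ha Hb Hc. pose proof (Rmin_l r s). pose proof (Rmin_r r s).
  split; [apply HrU | apply HsV]; lra.
Qed.

Lemma open3_pos f : cont3 (fun _ _ _ => True) f -> open3 (fun a b c => 0 < f a b c).
Proof. intros H a b c Hp. exact (cont3_pos _ f a b c H I Hp). Qed.

Lemma open3_True : open3 (fun _ _ _ => True).
Proof. intros a b c _. exists 1. split; [lra | trivial]. Qed.

Lemma derivable_pt_lim_ext_near (f g : R -> R) (x l r : R) : 0 < r ->
  (forall t, Rabs (t - x) < r -> f t = g t) -> derivable_pt_lim f x l -> derivable_pt_lim g x l.
Proof.
  intros Hr E H. apply is_derive_Reals. apply is_derive_Reals in H.
  apply is_derive_ext_loc with (2 := H). exists (mkposreal r Hr). intros t Ht. apply E, Ht.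
Qed.

Lemma partials3_ext U f g f1 f2 f3 : open3 U -> (forall a b c, U a b c -> f a b c = g a b c) ->
  partials3 U f f1 f2 f3 -> partials3 U g f1 f2 f3.
Proof.
  intros HO E H a b c HU. destruct (HO a b c HU) as [r [Hr HrU]].
  destruct (H a b c HU) as [H1 [H2 H3]]. repeat split;
  (eapply derivable_pt_lim_ext_near; [exact Hr | | eassumption]); intros t Ht; apply E, HrU;
  first [exact Ht | apply Rabs_minus_diag, Hr].
Qed.

Lemma C3_cont n U f : C3 n U f -> cont3 U f.
Proof. destruct n; [trivial | intros [H _]; exact H]. Qed.

Lemma C3_ext n U f g : open3 U -> (forall a b c, U a b c -> f a b c = g a b c) ->
  C3 n U f -> C3 n U g.
Proof.
  intros HO E. destruct n as [|n].
  - apply cont3_ext; assumption.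
  - intros [Hc [f1 [f2 [f3 [Hp Hn]]]]]. split; [exact (cont3_ext U f g HO E Hc) |].
    exists f1, f2, f3. split; [exact (partials3_ext U f g _ _ _ HO E Hp) | exact Hn].
Qed.

Lemma C3_sub n (U U' : R -> R -> R -> Prop) : (forall a b c, U' a b c -> U a b c) ->
  forall f, C3 n U f -> C3 n U' f.
Proof.
  intros S. induction n as [|n IH]; intros f.
  - intros H a b c HU. apply H, S, HU.
  - intros [Hc [f1 [f2 [f3 [Hp [H1 [H2 H3]]]]]]]. split.
    + intros a b c HU. apply Hc, S, HU.
    + exists f1, f2, f3. split; [| auto]. intros a b c HU. apply Hp, S, HU.
Qed.

(** Needed by the product and chain rules: the undifferentiated factors reappear in the partial
    derivatives and must be of class C^n there. *)
Lemma C3_pred n U : forall f, C3 (S n) U f -> C3 n U f.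
Proof.
  induction n as [|n IH]; intros f.
  - intros [H _]. exact H.
  - intros [Hc [f1 [f2 [f3 [Hp [H1 [H2 H3]]]]]]]. split; [exact Hc |].
    exists f1, f2, f3. auto.
Qed.

Lemma C3_const n U : forall k, C3 n U (fun _ _ _ => k).
Proof.
  assert (Hc : forall k, cont3 U (fun _ _ _ => k)).
  { intros k a b c _ eps He. exists 1. split; [lra |]. intros. apply Rabs_minus_diag, He. }
  induction n as [|n IH]; intros k; [apply Hc |]. split; [apply Hc |].
  exists (fun _ _ _ => 0), (fun _ _ _ => 0), (fun _ _ _ => 0).
  split; [| auto]. intros a b c _. repeat split; apply derivable_pt_lim_const.
Qed.

Lemma smooth3_const U k : smooth3 U (fun _ _ _ => k).
Proof. intros n. apply C3_const. Qed.

Lemma smooth3_1 U : smooth3 U (fun a _ _ => a).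
Proof.
  assert (Hc : cont3 U (fun a _ _ => a)) by (intros a b c _ eps He; exists eps; auto).
  intros [|n]; [exact Hc |]. split; [exact Hc |].
  exists (fun _ _ _ => 1), (fun _ _ _ => 0), (fun _ _ _ => 0). repeat split; try apply C3_const.
  - apply derivable_pt_lim_id.
  - apply derivable_pt_lim_const.
  - apply derivable_pt_lim_const.
Qed.

Lemma smooth3_2 U : smooth3 U (fun _ b _ => b).
Proof.
  assert (Hc : cont3 U (fun _ b _ => b)) by (intros a b c _ eps He; exists eps; auto).
  intros [|n]; [exact Hc |]. split; [exact Hc |].
  exists (fun _ _ _ => 0), (fun _ _ _ => 1), (fun _ _ _ => 0). repeat split; try apply C3_const.
  - apply derivable_pt_lim_const.
  - apply derivable_pt_lim_id.
  - apply derivable_pt_lim_const.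
Qed.

Lemma smooth3_3 U : smooth3 U (fun _ _ c => c).
Proof.
  assert (Hc : cont3 U (fun _ _ c => c)) by (intros a b c _ eps He; exists eps; auto).
  intros [|n]; [exact Hc |]. split; [exact Hc |].
  exists (fun _ _ _ => 0), (fun _ _ _ => 0), (fun _ _ _ => 1). repeat split; try apply C3_const.
  - apply derivable_pt_lim_const.
  - apply derivable_pt_lim_const.
  - apply derivable_pt_lim_id.
Qed.

Lemma C3_plus n U : forall f g, C3 n U f -> C3 n U g -> C3 n U (fun a b c => f a b c + g a b c).
Proof.
  induction n as [|n IH]; intros f g Hf Hg.
  - exact (cont3_plus U f g Hf Hg).
  - split; [exact (cont3_plus U f g (C3_cont _ _ _ Hf) (C3_cont _ _ _ Hg)) |].
    destruct Hf as [_ [f1 [f2 [f3 [Hp [F1 [F2 F3]]]]]]].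
    destruct Hg as [_ [g1 [g2 [g3 [Hq [G1 [G2 G3]]]]]]].
    exists (fun a b c => f1 a b c + g1 a b c), (fun a b c => f2 a b c + g2 a b c),
           (fun a b c => f3 a b c + g3 a b c).
    split; [| auto]. intros a b c HU.
    destruct (Hp a b c HU) as [P1 [P2 P3]]. destruct (Hq a b c HU) as [Q1 [Q2 Q3]].
    repeat split; apply (derivable_pt_lim_plus _ _ _ _ _); assumption.
Qed.

Lemma C3_mult n U : forall f g, C3 n U f -> C3 n U g -> C3 n U (fun a b c => f a b c * g a b c).
Proof.
  induction n as [|n IH]; intros f g Hf Hg.
  - exact (cont3_mult U f g Hf Hg).
  - split; [exact (cont3_mult U f g (C3_cont _ _ _ Hf) (C3_cont _ _ _ Hg)) |].
    pose proof (C3_pred _ _ _ Hf) as Hf'. pose proof (C3_pred _ _ _ Hg) as Hg'.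
    destruct Hf as [_ [f1 [f2 [f3 [Hp [F1 [F2 F3]]]]]]].
    destruct Hg as [_ [g1 [g2 [g3 [Hq [G1 [G2 G3]]]]]]].
    exists (fun a b c => f1 a b c * g a b c + f a b c * g1 a b c),
           (fun a b c => f2 a b c * g a b c + f a b c * g2 a b c),
           (fun a b c => f3 a b c * g a b c + f a b c * g3 a b c).
    split; [| repeat split; apply (C3_plus n U); apply IH; assumption]. intros a b c HU.
    destruct (Hp a b c HU) as [P1 [P2 P3]]. destruct (Hq a b c HU) as [Q1 [Q2 Q3]].
    repeat split.
    + apply (derivable_pt_lim_mult (fun t => f t b c) (fun t => g t b c)); assumption.
    + apply (derivable_pt_lim_mult (fun t => f a t c) (fun t => g a t c)); assumption.
    + apply (derivable_pt_lim_mult (fun t => f a b t) (fun t => g a b t)); assumption.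
Qed.

Lemma smooth3_cont U f : smooth3 U f -> cont3 U f.
Proof. intros H. exact (H 0%nat). Qed.

Lemma smooth3_ext U f g : open3 U -> (forall a b c, U a b c -> f a b c = g a b c) ->
  smooth3 U f -> smooth3 U g.
Proof. intros HO E H n. apply (C3_ext n U f g HO E), H. Qed.

Lemma smooth3_sub (U U' : R -> R -> R -> Prop) f : (forall a b c, U' a b c -> U a b c) ->
  smooth3 U f -> smooth3 U' f.
Proof. intros S H n. apply (C3_sub n U U' S), H. Qed.

Lemma smooth3_plus U f g : smooth3 U f -> smooth3 U g -> smooth3 U (fun a b c => f a b c + g a b c).
Proof. intros Hf Hg n. apply C3_plus; auto. Qed.

Lemma smooth3_mult U f g : smooth3 U f -> smooth3 U g -> smooth3 U (fun a b c => f a b c * g a b c).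
Proof. intros Hf Hg n. apply C3_mult; auto. Qed.

Lemma C3_opp n U f : C3 n U f -> C3 n U (fun a b c => - f a b c).
Proof.
  intros H.
  assert (E : (fun a b c => - f a b c) = (fun a b c => (-1) * f a b c)).
  { do 3 (apply functional_extensionality; intro). ring. }
  rewrite E. apply (C3_mult n U (fun _ _ _ => -1)); [apply C3_const | exact H].
Qed.

Lemma smooth3_opp U f : smooth3 U f -> smooth3 U (fun a b c => - f a b c).
Proof. intros Hf n. apply C3_opp; auto. Qed.

Lemma smooth3_minus U f g : smooth3 U f -> smooth3 U g -> smooth3 U (fun a b c => f a b c - g a b c).
Proof. intros Hf Hg. apply (smooth3_plus U f (fun a b c => - g a b c)); [| apply smooth3_opp]; assumption. Qed.

Lemma partials3_unique U f f1 f2 f3 g1 g2 g3 :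
  partials3 U f f1 f2 f3 -> partials3 U f g1 g2 g3 ->
  forall a b c, U a b c -> g1 a b c = f1 a b c /\ g2 a b c = f2 a b c /\ g3 a b c = f3 a b c.
Proof.
  intros H H' a b c HU.
  destruct (H a b c HU) as [P1 [P2 P3]]. destruct (H' a b c HU) as [Q1 [Q2 Q3]].
  repeat split; eapply uniqueness_limite; eassumption.
Qed.

(** The partial derivatives supplied by [C3 n] may a priori change with [n]. Derivatives are unique,
    so those supplied at order 1 agree on [U] with all the others and are themselves smooth. *)
Lemma smooth3_partials U f : open3 U -> smooth3 U f ->
  exists f1 f2 f3, partials3 U f f1 f2 f3 /\ smooth3 U f1 /\ smooth3 U f2 /\ smooth3 U f3.
Proof.
  intros HO H. destruct (H 1%nat) as [_ [f1 [f2 [f3 [Hp _]]]]].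
  exists f1, f2, f3. split; [exact Hp |].
  assert (E : forall n, C3 n U f1 /\ C3 n U f2 /\ C3 n U f3).
  { intros n. destruct (H (S n)) as [_ [g1 [g2 [g3 [Hq [G1 [G2 G3]]]]]]].
    pose proof (partials3_unique U f _ _ _ _ _ _ Hp Hq) as E.
    split; [| split].
    - apply (C3_ext n U g1 f1 HO); [intros a b c HU; apply (E a b c HU) | exact G1].
    - apply (C3_ext n U g2 f2 HO); [intros a b c HU; apply (E a b c HU) | exact G2].
    - apply (C3_ext n U g3 f3 HO); [intros a b c HU; apply (E a b c HU) | exact G3]. }
  repeat split; intros n; apply (E n).
Qed.

(** * Differentiability from continuous partial derivatives, and the chain rule *)

Lemma MVT_between (f f' : R -> R) (a b : R) :
  (forall x, Rmin a b <= x <= Rmax a b -> derivable_pt_lim f x (f' x)) ->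
  exists x, Rmin a b <= x <= Rmax a b /\ f b - f a = f' x * (b - a).
Proof.
  intros H. destruct (Rtotal_order a b) as [Hab | [-> | Hab]].
  - rewrite Rmin_left, Rmax_right in * by lra.
    destruct (MVT_cor2 f f' a b Hab H) as [x [E Hx]]. exists x. split; lra.
  - exists b. rewrite Rmin_left, Rmax_left by lra. split; lra.
  - rewrite Rmin_right, Rmax_left in * by lra.
    destruct (MVT_cor2 f f' b a Hab H) as [x [E Hx]]. exists x. split; [lra |].
    replace (f b - f a) with (- (f a - f b)) by ring. rewrite E. ring.
Qed.

Lemma between_near (a b x y r : R) : Rmin a b <= y <= Rmax a b ->
  Rabs (a - x) < r -> Rabs (b - x) < r -> Rabs (y - x) < r.
Proof.
  intros H Ha Hb. apply Rabs_def2 in Ha. apply Rabs_def2 in Hb. apply Rabs_def1;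
  unfold Rmin, Rmax in H; destruct (Rle_dec a b); lra.
Qed.

Lemma MVT_near (f f' : R -> R) (x l eps del a b : R) :
  (forall t, Rabs (t - x) < del -> derivable_pt_lim f t (f' t) /\ Rabs (f' t - l) < eps) ->
  Rabs (a - x) < del -> Rabs (b - x) < del ->
  Rabs (f b - f a - l * (b - a)) <= eps * Rabs (b - a).
Proof.
  intros H Ha Hb. destruct (MVT_between f f' a b) as [t [Ht E]].
  { intros t Ht. apply H. eapply between_near; eassumption. }
  rewrite E. replace (f' t * (b - a) - l * (b - a)) with ((f' t - l) * (b - a)) by ring.
  rewrite Rabs_mult. apply Rmult_le_compat_r; [apply Rabs_pos |].
  left. apply H. eapply between_near; eassumption.
Qed.

(** The increment is split into three moves parallel to the axes. The mean value theorem compares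
    each move with its partial derivative at the base point, by continuity of the partials. *)
Lemma strict_diff3 U f f1 f2 f3 a b c : open3 U -> partials3 U f f1 f2 f3 ->
  cont3 U f1 -> cont3 U f2 -> cont3 U f3 -> U a b c ->
  forall eps, 0 < eps -> exists del, 0 < del /\ forall a' b' c',
    Rabs (a' - a) < del -> Rabs (b' - b) < del -> Rabs (c' - c) < del ->
    Rabs (f a' b' c' - f a b c
          - (f1 a b c * (a' - a) + f2 a b c * (b' - b) + f3 a b c * (c' - c)))
      <= eps * (Rabs (a' - a) + Rabs (b' - b) + Rabs (c' - c)).
Proof.
  intros HO Hp C1 C2 C3 HU eps He.
  destruct (HO a b c HU) as [r [Hr HrU]].
  destruct (C1 a b c HU eps He) as [d1 [Hd1 D1]].
  destruct (C2 a b c HU eps He) as [d2 [Hd2 D2]].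
  destruct (C3 a b c HU eps He) as [d3 [Hd3 D3]].
  set (d := Rmin r (Rmin d1 (Rmin d2 d3))).
  assert (Hd : 0 < d) by (repeat apply Rmin_pos; assumption).
  assert (Ld : d <= r /\ d <= d1 /\ d <= d2 /\ d <= d3).
  { unfold d. pose proof (Rmin_l r (Rmin d1 (Rmin d2 d3))). pose proof (Rmin_r r (Rmin d1 (Rmin d2 d3))).
    pose proof (Rmin_l d1 (Rmin d2 d3)). pose proof (Rmin_r d1 (Rmin d2 d3)).
    pose proof (Rmin_l d2 d3). pose proof (Rmin_r d2 d3). lra. }
  exists d. split; [exact Hd |]. intros a' b' c' Ha Hb Hc.
  pose proof (Rabs_minus_diag a d Hd) as Ha0. pose proof (Rabs_minus_diag b d Hd) as Hb0.
  pose proof (Rabs_minus_diag c d Hd) as Hc0.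
  assert (E1 : Rabs (f a' b' c' - f a b' c' - f1 a b c * (a' - a)) <= eps * Rabs (a' - a)).
  { apply (MVT_near (fun t => f t b' c') (fun t => f1 t b' c') a _ _ d); try assumption.
    intros t Ht. split; [apply Hp, HrU | apply D1]; lra. }
  assert (E2 : Rabs (f a b' c' - f a b c' - f2 a b c * (b' - b)) <= eps * Rabs (b' - b)).
  { apply (MVT_near (fun t => f a t c') (fun t => f2 a t c') b _ _ d); try assumption.
    intros t Ht. split; [apply Hp, HrU | apply D2]; lra. }
  assert (E3 : Rabs (f a b c' - f a b c - f3 a b c * (c' - c)) <= eps * Rabs (c' - c)).
  { apply (MVT_near (fun t => f a b t) (fun t => f3 a b t) c _ _ d); try assumption.
    intros t Ht. split; [apply Hp, HrU | apply D3]; lra. }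
  rewrite 2!Rmult_plus_distr_l.
  eapply Rle_trans; [| apply Rplus_le_compat; [apply Rplus_le_compat; [exact E1 | exact E2] | exact E3]].
  eapply Rle_trans; [| apply Rplus_le_compat_r, Rabs_triang].
  eapply Rle_trans; [| apply Rabs_triang]. right. f_equal. ring.
Qed.

(** The division-free form of the derivative: it includes [h = 0], and such bounds can be added. *)
Lemma derivable_pt_lim_linear_bound u t d : derivable_pt_lim u t d ->
  forall eps, 0 < eps -> exists del, 0 < del /\ forall h, Rabs h < del ->
    Rabs (u (t + h) - u t - d * h) <= eps * Rabs h.
Proof.
  intros H eps He. destruct (H eps He) as [del Hdel]. exists del. split; [apply cond_pos |].
  intros h Hh. destruct (Req_dec h 0) as [-> | Hn].
  - rewrite Rplus_0_r, Rmult_0_r, Rabs_R0, Rminus_diag, Rminus_0_r, Rabs_R0. lra.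
  - replace (u (t + h) - u t - d * h) with (((u (t + h) - u t) / h - d) * h) by (field; exact Hn).
    rewrite Rabs_mult. apply Rmult_le_compat_r; [apply Rabs_pos |]. left. apply Hdel; assumption.
Qed.

Lemma linear_bound_derivable_pt_lim u t d :
  (forall eps, 0 < eps -> exists del, 0 < del /\ forall h, Rabs h < del ->
    Rabs (u (t + h) - u t - d * h) <= eps * Rabs h) -> derivable_pt_lim u t d.
Proof.
  intros H eps He. destruct (H (eps / 2) ltac:(lra)) as [del [Hd Hdel]].
  exists (mkposreal del Hd). intros h Hn Hh. simpl in Hh. specialize (Hdel h Hh).
  replace ((u (t + h) - u t) / h - d) with ((u (t + h) - u t - d * h) / h) by (field; exact Hn).
  unfold Rdiv. rewrite Rabs_mult, Rabs_inv. pose proof (Rabs_pos_lt h Hn).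
  apply Rle_lt_trans with (eps / 2); [| lra].
  apply (Rmult_le_reg_r (Rabs h)); [assumption |].
  rewrite Rmult_assoc, Rinv_l, Rmult_1_r by lra. exact Hdel.
Qed.

Lemma chain3 U f f1 f2 f3 (u1 u2 u3 : R -> R) t d1 d2 d3 : open3 U -> partials3 U f f1 f2 f3 ->
  cont3 U f1 -> cont3 U f2 -> cont3 U f3 -> U (u1 t) (u2 t) (u3 t) ->
  derivable_pt_lim u1 t d1 -> derivable_pt_lim u2 t d2 -> derivable_pt_lim u3 t d3 ->
  derivable_pt_lim (fun t => f (u1 t) (u2 t) (u3 t)) t
    (f1 (u1 t) (u2 t) (u3 t) * d1 + f2 (u1 t) (u2 t) (u3 t) * d2 + f3 (u1 t) (u2 t) (u3 t) * d3).
Proof.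
  intros HO Hp C1 C2 C3 HU D1 D2 D3. apply linear_bound_derivable_pt_lim. intros eps He.
  set (p1 := f1 (u1 t) (u2 t) (u3 t)). set (p2 := f2 (u1 t) (u2 t) (u3 t)).
  set (p3 := f3 (u1 t) (u2 t) (u3 t)).
  (* [K * Rabs h] bounds the sum of the three inner increments, and [M] bounds the weights of the
     three inner errors. The error of [f] and the inner errors then get half of [eps] each. *)
  set (K := Rabs d1 + Rabs d2 + Rabs d3 + 3). set (M := Rabs p1 + Rabs p2 + Rabs p3 + 1).
  pose proof (Rabs_pos d1). pose proof (Rabs_pos d2). pose proof (Rabs_pos d3).
  pose proof (Rabs_pos p1). pose proof (Rabs_pos p2). pose proof (Rabs_pos p3).
  assert (HK : 0 < K) by (unfold K; lra). assert (HM : 0 < M) by (unfold M; lra).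
  destruct (strict_diff3 U f f1 f2 f3 _ _ _ HO Hp C1 C2 C3 HU (eps / (2 * K))) as [d [Hd SD]].
  { apply Rdiv_lt_0_compat; lra. }
  set (e := Rmin 1 (eps / (2 * M))).
  assert (Hee : 0 < e) by (apply Rmin_pos; [lra | apply Rdiv_lt_0_compat; lra]).
  destruct (derivable_pt_lim_linear_bound _ _ _ D1 e Hee) as [r1 [Hr1 B1]].
  destruct (derivable_pt_lim_linear_bound _ _ _ D2 e Hee) as [r2 [Hr2 B2]].
  destruct (derivable_pt_lim_linear_bound _ _ _ D3 e Hee) as [r3 [Hr3 B3]].
  assert (HdK : 0 < d / K) by (apply Rdiv_lt_0_compat; assumption).
  exists (Rmin (d / K) (Rmin r1 (Rmin r2 r3))). split; [repeat apply Rmin_pos; assumption |].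
  intros h Hh.
  assert (Lh : Rabs h < d / K /\ Rabs h < r1 /\ Rabs h < r2 /\ Rabs h < r3).
  { pose proof (Rmin_l (d / K) (Rmin r1 (Rmin r2 r3))). pose proof (Rmin_r (d / K) (Rmin r1 (Rmin r2 r3))).
    pose proof (Rmin_l r1 (Rmin r2 r3)). pose proof (Rmin_r r1 (Rmin r2 r3)).
    pose proof (Rmin_l r2 r3). pose proof (Rmin_r r2 r3). lra. }
  destruct Lh as [L0 [L1 [L2 L3]]].
  specialize (B1 h L1). specialize (B2 h L2). specialize (B3 h L3).
  pose proof (Rabs_pos h) as Ph.
  assert (He1 : e <= 1) by apply Rmin_l. assert (He2 : e * M <= eps / 2).
  { apply Rle_trans with (eps / (2 * M) * M); [apply Rmult_le_compat_r; [lra | apply Rmin_r] |].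
    right. field. lra. }
  assert (G : forall u di, Rabs (u (t + h) - u t - di * h) <= e * Rabs h ->
              Rabs (u (t + h) - u t) <= (Rabs di + 1) * Rabs h).
  { intros u di B. replace (u (t + h) - u t) with (u (t + h) - u t - di * h + di * h) by ring.
    eapply Rle_trans; [apply Rabs_triang |]. rewrite (Rabs_mult di h). nra. }
  pose proof (G u1 d1 B1) as G1. pose proof (G u2 d2 B2) as G2. pose proof (G u3 d3 B3) as G3.
  assert (Hsmall : K * Rabs h < d).
  { apply (Rmult_lt_compat_l K) in L0; [| assumption].
    replace (K * (d / K)) with d in L0 by (field; lra). exact L0. }
  specialize (SD (u1 (t + h)) (u2 (t + h)) (u3 (t + h))).
  assert (S1 : Rabs (u1 (t + h) - u1 t) < d) by (unfold K in Hsmall; nra).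
  assert (S2 : Rabs (u2 (t + h) - u2 t) < d) by (unfold K in Hsmall; nra).
  assert (S3 : Rabs (u3 (t + h) - u3 t) < d) by (unfold K in Hsmall; nra).
  specialize (SD S1 S2 S3). fold p1 p2 p3 in SD.
  match goal with |- Rabs ?X <= _ =>
  replace X with ((f (u1 (t + h)) (u2 (t + h)) (u3 (t + h)) - f (u1 t) (u2 t) (u3 t)
     - (p1 * (u1 (t + h) - u1 t) + p2 * (u2 (t + h) - u2 t) + p3 * (u3 (t + h) - u3 t)))
     + (p1 * (u1 (t + h) - u1 t - d1 * h) + p2 * (u2 (t + h) - u2 t - d2 * h)
        + p3 * (u3 (t + h) - u3 t - d3 * h))) by ring end.
  eapply Rle_trans; [apply Rabs_triang |].
  replace (eps * Rabs h) with (eps / (2 * K) * (K * Rabs h) + eps / 2 * Rabs h) by (field; lra).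
  apply Rplus_le_compat.
  - eapply Rle_trans; [exact SD |]. apply Rmult_le_compat_l.
    + left. apply Rdiv_lt_0_compat; lra.
    + unfold K. lra.
  - eapply Rle_trans; [apply Rabs_triang |].
    eapply Rle_trans; [apply Rplus_le_compat_r, Rabs_triang |].
    rewrite !Rabs_mult. apply Rle_trans with (e * M * Rabs h); [| nra]. unfold M. nra.
Qed.

(** The outer function is smooth and only the inner ones are C^n: the outer partials are again
    smooth, so the induction hypothesis applies to them with the same inner functions. The asymmetry
    also allows an implicit function to gain derivatives one at a time. *)
Lemma C3_comp n : forall V f U u1 u2 u3, open3 V -> smooth3 V f ->
  C3 n U u1 -> C3 n U u2 -> C3 n U u3 ->
  (forall a b c, U a b c -> V (u1 a b c) (u2 a b c) (u3 a b c)) ->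
  C3 n U (fun a b c => f (u1 a b c) (u2 a b c) (u3 a b c)).
Proof.
  induction n as [|n IH]; intros V f U u v w HV Hf Hu Hv Hw HUV.
  - exact (cont3_comp U V f u v w (smooth3_cont V f Hf) Hu Hv Hw HUV).
  - split; [exact (cont3_comp U V f u v w (smooth3_cont V f Hf) (C3_cont _ _ _ Hu)
                     (C3_cont _ _ _ Hv) (C3_cont _ _ _ Hw) HUV) |].
    pose proof (C3_pred _ _ _ Hu) as Hu'. pose proof (C3_pred _ _ _ Hv) as Hv'.
    pose proof (C3_pred _ _ _ Hw) as Hw'.
    destruct (smooth3_partials V f HV Hf) as [f1 [f2 [f3 [Hp [S1 [S2 S3]]]]]].
    destruct Hu as [_ [u1 [u2 [u3 [Pu [U1 [U2 U3]]]]]]].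
    destruct Hv as [_ [v1 [v2 [v3 [Pv [V1 [V2 V3]]]]]]].
    destruct Hw as [_ [w1 [w2 [w3 [Pw [W1 [W2 W3]]]]]]].
    set (k1 := fun a b c => f1 (u a b c) (v a b c) (w a b c)).
    set (k2 := fun a b c => f2 (u a b c) (v a b c) (w a b c)).
    set (k3 := fun a b c => f3 (u a b c) (v a b c) (w a b c)).
    assert (K1 : C3 n U k1) by (apply (IH V f1); assumption).
    assert (K2 : C3 n U k2) by (apply (IH V f2); assumption).
    assert (K3 : C3 n U k3) by (apply (IH V f3); assumption).
    exists (fun a b c => k1 a b c * u1 a b c + k2 a b c * v1 a b c + k3 a b c * w1 a b c),
           (fun a b c => k1 a b c * u2 a b c + k2 a b c * v2 a b c + k3 a b c * w2 a b c),
           (fun a b c => k1 a b c * u3 a b c + k2 a b c * v3 a b c + k3 a b c * w3 a b c).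
    split.
    + intros a b c HU. destruct (Pu a b c HU) as [? [? ?]]. destruct (Pv a b c HU) as [? [? ?]].
      destruct (Pw a b c HU) as [? [? ?]]. unfold k1, k2, k3. repeat split.
      * apply (chain3 V f f1 f2 f3 (fun t => u t b c) (fun t => v t b c) (fun t => w t b c));
        try assumption; try (apply smooth3_cont; assumption); apply HUV, HU.
      * apply (chain3 V f f1 f2 f3 (fun t => u a t c) (fun t => v a t c) (fun t => w a t c));
        try assumption; try (apply smooth3_cont; assumption); apply HUV, HU.
      * apply (chain3 V f f1 f2 f3 (fun t => u a b t) (fun t => v a b t) (fun t => w a b t));
        try assumption; try (apply smooth3_cont; assumption); apply HUV, HU.
    + repeat split; apply (C3_plus n U); try apply (C3_plus n U); apply (C3_mult n U); assumption.
Qed.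

Lemma smooth3_comp V f U u1 u2 u3 : open3 V -> smooth3 V f ->
  smooth3 U u1 -> smooth3 U u2 -> smooth3 U u3 ->
  (forall a b c, U a b c -> V (u1 a b c) (u2 a b c) (u3 a b c)) ->
  smooth3 U (fun a b c => f (u1 a b c) (u2 a b c) (u3 a b c)).
Proof. intros HV Hf H1 H2 H3 HUV n. apply (C3_comp n V); auto. Qed.

(** * Elementary functions *)

Lemma cont3_of_derivable (D : R -> Prop) (f f' : R -> R) :
  (forall a, D a -> derivable_pt_lim f a (f' a)) -> cont3 (fun a _ _ => D a) (fun a _ _ => f a).
Proof.
  intros H a b c HD eps He.
  assert (Hc : continuous f a).
  { apply (@ex_derive_continuous R_AbsRing R_NormedModule). exists (f' a). apply is_derive_Reals, H, HD. }
  destruct (proj1 (filterlim_locally _ _) Hc (mkposreal eps He)) as [d Hd].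
  exists d. split; [apply cond_pos |]. intros a' _ _ Ha _ _. exact (Hd a' Ha).
Qed.

Lemma C3_of_derivable n (D : R -> Prop) (f f' : R -> R) :
  (forall a, D a -> derivable_pt_lim f a (f' a)) ->
  C3 n (fun a _ _ => D a) (fun a _ _ => f' a) -> C3 (S n) (fun a _ _ => D a) (fun a _ _ => f a).
Proof.
  intros H Hn. split; [exact (cont3_of_derivable D f f' H) |].
  exists (fun a _ _ => f' a), (fun _ _ _ => 0), (fun _ _ _ => 0).
  split; [| auto using C3_const]. intros a b c HD.
  repeat split; [exact (H a HD) | apply derivable_pt_lim_const | apply derivable_pt_lim_const].
Qed.

(** The derivative is a polynomial in the function itself, so the induction on the order closes. *)
Lemma smooth3_Rinv : smooth3 (fun a _ _ => 0 < a) (fun a _ _ => / a).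
Proof.
  assert (H : forall a, 0 < a -> derivable_pt_lim Rinv a (- (/ a * / a))).
  { intros a Ha. apply is_derive_Reals. auto_derive; [lra | field; lra]. }
  intros n. induction n as [|n IH].
  - exact (cont3_of_derivable _ _ _ H).
  - apply (C3_of_derivable n _ _ _ H). apply C3_opp, (C3_mult n _ _ _ IH IH).
Qed.

Lemma smooth3_ln : smooth3 (fun a _ _ => 0 < a) (fun a _ _ => ln a).
Proof.
  intros [|n].
  - exact (cont3_of_derivable _ ln Rinv (fun a Ha => derivable_pt_lim_ln a Ha)).
  - apply (C3_of_derivable n _ ln Rinv derivable_pt_lim_ln). apply smooth3_Rinv.
Qed.

Lemma smooth3_exp : smooth3 (fun _ _ _ => True) (fun a _ _ => exp a).
Proof.
  intros n. induction n as [|n IH].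
  - exact (cont3_of_derivable (fun _ => True) exp exp (fun a _ => derivable_pt_lim_exp a)).
  - apply (C3_of_derivable n (fun _ => True) exp exp (fun a _ => derivable_pt_lim_exp a) IH).
Qed.

Lemma smooth3_cos : smooth3 (fun _ _ _ => True) (fun a _ _ => cos a).
Proof.
  set (T := fun _ : R => True).
  assert (Hs : forall a, T a -> derivable_pt_lim sin a (cos a)) by (intros; apply derivable_pt_lim_sin).
  assert (Hc : forall a, T a -> derivable_pt_lim cos a (- sin a)) by (intros; apply derivable_pt_lim_cos).
  intros n.
  assert (E : C3 n (fun a _ _ => T a) (fun a _ _ => cos a) /\ C3 n (fun a _ _ => T a) (fun a _ _ => sin a)).
  { induction n as [|n [IHc IHs]].
    - split; [exact (cont3_of_derivable _ _ _ Hc) | exact (cont3_of_derivable _ _ _ Hs)].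
    - split; [apply (C3_of_derivable n T _ _ Hc), C3_opp, IHs | apply (C3_of_derivable n T _ _ Hs), IHc]. }
  exact (proj1 E).
Qed.

Lemma open3_gt0 : open3 (fun a _ _ => 0 < a).
Proof. apply (open3_pos (fun a _ _ => a)), smooth3_cont, smooth3_1. Qed.

Lemma smooth3_comp_inv U u : smooth3 U u -> (forall a b c, U a b c -> 0 < u a b c) ->
  smooth3 U (fun a b c => / u a b c).
Proof.
  intros Hu HU. apply (smooth3_comp _ _ U u (fun _ _ _ => 0) (fun _ _ _ => 0) open3_gt0 smooth3_Rinv);
  auto using smooth3_const.
Qed.

Lemma smooth3_comp_ln U u : smooth3 U u -> (forall a b c, U a b c -> 0 < u a b c) ->
  smooth3 U (fun a b c => ln (u a b c)).
Proof.
  intros Hu HU. apply (smooth3_comp _ _ U u (fun _ _ _ => 0) (fun _ _ _ => 0) open3_gt0 smooth3_ln);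
  auto using smooth3_const.
Qed.

Lemma smooth3_comp_exp U u : smooth3 U u -> smooth3 U (fun a b c => exp (u a b c)).
Proof.
  intros Hu. apply (smooth3_comp _ _ U u (fun _ _ _ => 0) (fun _ _ _ => 0) open3_True smooth3_exp);
  auto using smooth3_const.
Qed.

Lemma smooth3_comp_cos U u : smooth3 U u -> smooth3 U (fun a b c => cos (u a b c)).
Proof.
  intros Hu. apply (smooth3_comp _ _ U u (fun _ _ _ => 0) (fun _ _ _ => 0) open3_True smooth3_cos);
  auto using smooth3_const.
Qed.

(** On positive values the square root is [exp (/ 2 * ln u)]. *)
Lemma smooth3_comp_sqrt U u : open3 U -> smooth3 U u -> (forall a b c, U a b c -> 0 < u a b c) ->
  smooth3 U (fun a b c => sqrt (u a b c)).
Proof.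
  intros HO Hu HU. apply (smooth3_ext U (fun a b c => exp (/ 2 * ln (u a b c))) _ HO).
  - intros a b c H. exact (Rpower_sqrt _ (HU a b c H)).
  - apply smooth3_comp_exp, (smooth3_mult U (fun _ _ _ => / 2)); [apply smooth3_const |].
    apply smooth3_comp_ln; assumption.
Qed.

(** * Integrals depending on parameters *)

Lemma tube (P : R -> R -> R -> Prop) (a b p q : R) :
  (forall s, a <= s <= b -> exists r, 0 < r /\ forall s' p' q',
     Rabs (s' - s) < r -> Rabs (p' - p) < r -> Rabs (q' - q) < r -> P s' p' q') ->
  exists r, 0 < r /\ forall s p' q', a <= s <= b -> Rabs (p' - p) < r -> Rabs (q' - q) < r ->
    P s p' q'.
Proof.
  intros H.
  set (D := fun (s : R) (d : posreal) => a <= s <= b -> forall s' p' q',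
     Rabs (s' - s) < d -> Rabs (p' - p) < d -> Rabs (q' - q) < d -> P s' p' q').
  assert (HD : forall s, exists d, D s d).
  { intros s. destruct (classic (a <= s <= b)) as [Hs | Hs].
    - destruct (H s Hs) as [r [Hr Hr']]. exists (mkposreal r Hr). intros _. exact Hr'.
    - exists (mkposreal 1 Rlt_0_1). intros Hs'. contradiction. }
  (* The compactness lemma wants a radius at every real number; outside the interval the property
     [D] is vacuous. Its conclusion is doubly negated, whence the classical step below. *)
  set (delta := fun s => epsilon (inhabits (mkposreal 1 Rlt_0_1)) (D s)).
  assert (Hdelta : forall s, D s (delta s)).
  { intros s. apply (epsilon_spec (inhabits (mkposreal 1 Rlt_0_1)) (D s)), HD. }
  destruct (compactness_value_1d a b delta) as [d Hd].
  exists d. split; [apply cond_pos |]. intros s p' q' Hs Hp Hq.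
  apply NNPP. intros HN. apply (Hd s Hs). intros [t [Ht [Hst Hdt]]]. apply HN.
  apply (Hdelta t Ht); lra.
Qed.

(** Star-shaped about 0 in the first variable: the primitive from 0 to [t] then evaluates the kernel
    only inside [U]. *)
Definition star1 (U : R -> R -> R -> Prop) : Prop :=
  forall t p q s, U t p q -> Rmin 0 t <= s <= Rmax 0 t -> U s p q.

Lemma cont3_continuous_1 U K t p q : cont3 U K -> U t p q -> continuous (fun s => K s p q) t.
Proof.
  intros H HU. apply filterlim_locally. intros eps.
  destruct (H t p q HU eps (cond_pos eps)) as [d [Hd H']]. exists (mkposreal d Hd). intros s Hs.
  apply H'; [exact Hs | apply Rabs_minus_diag, Hd | apply Rabs_minus_diag, Hd].
Qed.

Lemma ex_RInt_slice U K p q x y : cont3 U K ->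
  (forall s, Rmin x y <= s <= Rmax x y -> U s p q) -> ex_RInt (fun s => K s p q) x y.
Proof.
  intros H HU. apply (@ex_RInt_continuous R_CompleteNormedModule).
  intros s Hs. apply (cont3_continuous_1 U K _ _ _ H), HU, Hs.
Qed.

Lemma RInt_slice_deriv U K t p q : open3 U -> star1 U -> cont3 U K -> U t p q ->
  derivable_pt_lim (fun t => RInt (fun s => K s p q) 0 t) t (K t p q).
Proof.
  intros HO HS H HU. apply is_derive_Reals. destruct (HO t p q HU) as [r [Hr HrU]].
  apply (is_derive_RInt (fun s => K s p q) (fun t => RInt (fun s => K s p q) 0 t) 0 t).
  - exists (mkposreal r Hr). intros t' Ht'. apply (@RInt_correct R_CompleteNormedModule).
    apply (ex_RInt_slice U K); [exact H |]. intros s Hs. apply (HS t'); [| exact Hs].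
    apply HrU; [exact Ht' | apply Rabs_minus_diag, Hr | apply Rabs_minus_diag, Hr].
  - apply (cont3_continuous_1 U K _ _ _ H HU).
Qed.

(** The parameters are moved first, with the kernel controlled uniformly by the tube lemma, and the
    endpoint afterwards, where the primitive is differentiable. *)
Lemma cont3_RInt U K : open3 U -> star1 U -> cont3 U K ->
  cont3 U (fun t p q => RInt (fun s => K s p q) 0 t).
Proof.
  intros HO HS H t p q HU eps He.
  destruct (HO t p q HU) as [r0 [Hr0 HrU]]. set (r := Rmin r0 1 / 2).
  assert (Hr : 0 < r) by (unfold r; pose proof (Rmin_pos r0 1 Hr0 Rlt_0_1); lra).
  assert (Lr : r < r0 /\ r < 1).
  { unfold r. pose proof (Rmin_l r0 1). pose proof (Rmin_r r0 1).
    pose proof (Rmin_pos r0 1 Hr0 Rlt_0_1). lra. }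
  (* The interval from [lo] to [hi] contains 0 and every endpoint within [r] of [t], whatever the
     sign of [t]. *)
  set (lo := Rmin 0 (t - r)). set (hi := Rmax 0 (t + r)).
  assert (Hslice : forall s, lo <= s <= hi -> U s p q).
  { intros s Hs. destruct (Rle_dec t 0) as [Ht | Ht].
    - destruct (Rle_dec s (t + r)) as [Hsr | Hsr].
      + destruct (Rle_dec (t - r) s) as [Hsl | Hsl].
        * apply HrU; [apply Rabs_def1; lra | apply Rabs_minus_diag, Hr0 | apply Rabs_minus_diag, Hr0].
        * exfalso. unfold lo in Hs. rewrite Rmin_right in Hs by lra. lra.
      + apply (HS t); [exact HU |]. rewrite Rmin_right, Rmax_left by lra.
        unfold hi, Rmax in Hs. destruct (Rle_dec 0 (t + r)); lra.
    - destruct (Rle_dec (t - r) s) as [Hsl | Hsl].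
      + destruct (Rle_dec s (t + r)) as [Hsr | Hsr].
        * apply HrU; [apply Rabs_def1; lra | apply Rabs_minus_diag, Hr0 | apply Rabs_minus_diag, Hr0].
        * exfalso. unfold hi in Hs. rewrite Rmax_right in Hs by lra. lra.
      + apply (HS t); [exact HU |]. rewrite Rmin_left, Rmax_right by lra.
        unfold lo, Rmin in Hs. destruct (Rle_dec 0 (t - r)); lra. }
  assert (Hlo : lo <= 0 <= hi) by (split; [apply Rmin_l | apply Rmax_l]).
  assert (Hbt : forall t' s, Rabs (t' - t) < r -> Rmin 0 t' <= s <= Rmax 0 t' -> lo <= s <= hi).
  { intros t' s Ht' Hs. apply Rabs_def2 in Ht'.
    assert (lo <= t' <= hi).
    { split; [apply Rle_trans with (t - r); [apply Rmin_r | lra]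
             | apply Rle_trans with (t + r); [lra | apply Rmax_r]]. }
    unfold Rmin, Rmax in Hs. destruct (Rle_dec 0 t'); lra. }
  set (M := Rabs t + 1). pose proof (Rabs_pos t).
  assert (HM : 0 < M) by (unfold M; lra).
  set (e := eps / (4 * M)). assert (Hee : 0 < e) by (apply Rdiv_lt_0_compat; lra).
  destruct (tube (fun s p' q' => U s p' q' /\ Rabs (K s p' q' - K s p q) < e) lo hi p q) as [d [Hd HdP]].
  { intros s Hs. destruct (HO s p q (Hslice s Hs)) as [r1 [Hr1 HU1]].
    destruct (H s p q (Hslice s Hs) (e / 2)) as [r2 [Hr2 HK]]; [lra |].
    exists (Rmin r1 r2). split; [apply Rmin_pos; assumption |].
    intros s' p' q' Hs' Hp' Hq'. pose proof (Rmin_l r1 r2). pose proof (Rmin_r r1 r2).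
    split; [apply HU1; lra |].
    assert (A1 : Rabs (K s' p' q' - K s p q) < e / 2) by (apply HK; lra).
    assert (A2 : Rabs (K s' p q - K s p q) < e / 2).
    { apply HK; [lra | apply Rabs_minus_diag, Hr2 | apply Rabs_minus_diag, Hr2]. }
    apply Rabs_def2 in A1. apply Rabs_def2 in A2. apply Rabs_def1; lra. }
  assert (Hct : continuous (fun t => RInt (fun s => K s p q) 0 t) t).
  { apply (@ex_derive_continuous R_AbsRing R_NormedModule). exists (K t p q). apply is_derive_Reals.
    apply (RInt_slice_deriv U K); assumption. }
  destruct (proj1 (filterlim_locally _ _) Hct (mkposreal (eps / 2) ltac:(lra))) as [d2 Hd2].
  exists (Rmin d2 (Rmin d r)). split; [repeat apply Rmin_pos; try assumption; apply cond_pos |].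
  intros t' p' q' Ht' Hp' Hq'.
  pose proof (Rmin_l d2 (Rmin d r)). pose proof (Rmin_r d2 (Rmin d r)).
  pose proof (Rmin_l d r). pose proof (Rmin_r d r).
  assert (B2 : Rabs (RInt (fun s => K s p q) 0 t' - RInt (fun s => K s p q) 0 t) < eps / 2).
  { apply (Hd2 t'). apply Rlt_le_trans with (1 := Ht'). assumption. }
  assert (I1 : ex_RInt (fun s => K s p' q') 0 t').
  { apply (ex_RInt_slice U K); [exact H |]. intros s Hs. apply HdP; try lra.
    apply (Hbt t'); [lra | exact Hs]. }
  assert (I2 : ex_RInt (fun s => K s p q) 0 t').
  { apply (ex_RInt_slice U K); [exact H |]. intros s Hs. apply Hslice.
    apply (Hbt t'); [lra | exact Hs]. }
  assert (B1 : Rabs (RInt (fun s => K s p' q') 0 t' - RInt (fun s => K s p q) 0 t') <= e * M).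
  { rewrite <- (RInt_minus (V := R_CompleteNormedModule)) by assumption.
    (* The mean value theorem for the primitive of the difference gives the bound [e * Rabs t'] for
       both signs of [t']. *)
    destruct (MVT_between (fun x => RInt (fun s => minus (K s p' q') (K s p q)) 0 x)
                (fun s => K s p' q' - K s p q) 0 t') as [x [Hx E]].
    { intros x Hx. apply is_derive_Reals.
      apply (is_derive_RInt (fun s => minus (K s p' q') (K s p q))
               (fun x => RInt (fun s => minus (K s p' q') (K s p q)) 0 x) 0 x).
      - assert (Hx' := Hbt t' x ltac:(lra) Hx).
        assert (Ux := proj1 (HdP x p' q' Hx' ltac:(lra) ltac:(lra))).
        destruct (HO _ _ _ Ux) as [r1 [Hr1 W1]]. destruct (HO _ _ _ (Hslice x Hx')) as [r2 [Hr2 W2]].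
        exists (mkposreal (Rmin r1 r2) (Rmin_pos _ _ Hr1 Hr2)). intros y Hy.
        assert (Hy' : Rabs (y - x) < Rmin r1 r2) by exact Hy.
        pose proof (Rmin_l r1 r2). pose proof (Rmin_r r1 r2).
        apply (@RInt_correct R_CompleteNormedModule), (@ex_RInt_minus R_NormedModule).
        + apply (ex_RInt_slice U K); [exact H |]. intros s Hs. apply (HS y); [| exact Hs].
          apply W1; [lra | apply Rabs_minus_diag, Hr1 | apply Rabs_minus_diag, Hr1].
        + apply (ex_RInt_slice U K); [exact H |]. intros s Hs. apply (HS y); [| exact Hs].
          apply W2; [lra | apply Rabs_minus_diag, Hr2 | apply Rabs_minus_diag, Hr2].
      - assert (Hx' := Hbt t' x ltac:(lra) Hx).
        apply (@continuous_minus); [apply (cont3_continuous_1 U K _ _ _ H) | apply (cont3_continuous_1 U K _ _ _ H)].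
        + apply HdP; try lra.
        + apply Hslice, Hx'. }
    assert (Z0 : RInt (fun s => minus (K s p' q') (K s p q)) 0 0 = 0) by apply @RInt_point.
    cbv beta in E. rewrite Z0, 2!Rminus_0_r in E.
    eapply Rle_trans; [right; apply (f_equal Rabs); exact E |]. rewrite Rabs_mult.
    assert (Hx' := Hbt t' x ltac:(lra) Hx).
    assert (Hk := proj2 (HdP x p' q' Hx' ltac:(lra) ltac:(lra))).
    apply Rmult_le_compat; [apply Rabs_pos | apply Rabs_pos | lra |].
    unfold M. replace t' with (t + (t' - t)) by ring. eapply Rle_trans; [apply Rabs_triang |]. lra. }
  assert (EM : e * M = eps / 4) by (unfold e; field; lra).
  replace (RInt (fun s => K s p' q') 0 t' - RInt (fun s => K s p q) 0 t)
    with ((RInt (fun s => K s p' q') 0 t' - RInt (fun s => K s p q) 0 t')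
          + (RInt (fun s => K s p q) 0 t' - RInt (fun s => K s p q) 0 t)) by ring.
  eapply Rle_lt_trans; [apply Rabs_triang |]. lra.
Qed.

(** Differentiation under the integral sign. The domain [V], with the parameter as first argument,
    is left abstract so that the lemma serves both parameters of a kernel and the amplitude in the
    period. *)
Lemma RInt_param_deriv (F F' : R -> R -> R) (t p : R) (V : R -> R -> Prop) :
  (forall u s, Rmin 0 t <= s <= Rmax 0 t -> u = p -> exists r, 0 < r /\ forall u' s',
      Rabs (u' - u) < r -> Rabs (s' - s) < r -> V u' s') ->
  (forall u s, V u s -> derivable_pt_lim (fun v => F v s) u (F' u s)) ->
  (forall u s, V u s -> continuous (F u) s) ->
  (forall u s, V u s -> forall eps, 0 < eps -> exists d, 0 < d /\ forall u' s',
      Rabs (u' - u) < d -> Rabs (s' - s) < d -> Rabs (F' u' s' - F' u s) < eps) ->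
  derivable_pt_lim (fun u => RInt (F u) 0 t) p (RInt (F' p) 0 t).
Proof.
  intros HO HD HC HC'. apply is_derive_Reals.
  destruct (tube (fun s u _ => V u s) (Rmin 0 t) (Rmax 0 t) p 0) as [d [Hd HV]].
  { intros s Hs. destruct (HO p s Hs eq_refl) as [r [Hr H]]. exists r. split; [exact Hr |]. auto. }
  assert (HV' : forall u s, Rmin 0 t <= s <= Rmax 0 t -> Rabs (u - p) < d -> V u s).
  { intros u s Hs Hu. apply (HV s u 0); try assumption. apply Rabs_minus_diag, Hd. }
  assert (HDer : forall u s, V u s -> Derive (fun z => F z s) u = F' u s).
  { intros u s H. apply is_derive_unique, is_derive_Reals, HD, H. }
  rewrite (RInt_ext (F' p) (fun s => Derive (fun z => F z s) p)).
  2:{ intros s Hs. symmetry. apply HDer, HV'; [lra | apply Rabs_minus_diag, Hd]. }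
  apply (is_derive_RInt_param F).
  - exists (mkposreal d Hd). intros u Hu s Hs. exists (F' u s). apply is_derive_Reals, HD, HV'; assumption.
  - intros s Hs. destruct (HO p s Hs eq_refl) as [r [Hr H]].
    apply (continuity_2d_pt_ext_loc F').
    + exists (mkposreal r Hr). intros u v Hu Hv. symmetry. apply HDer, H; assumption.
    + intros eps. destruct (HC' p s (H p s (Rabs_minus_diag _ _ Hr) (Rabs_minus_diag _ _ Hr)) eps (cond_pos eps))
        as [d' [Hd' E]]. exists (mkposreal d' Hd'). exact E.
  - exists (mkposreal d Hd). intros u Hu. apply (@ex_RInt_continuous R_CompleteNormedModule).
    intros s Hs. apply HC, HV'; assumption.
Qed.

(** The derivative in [t] is the kernel; those in [p] and [q] are integrals of smooth kernels over
    the same domain. Hence an induction on the order with the kernel generalized. *)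
Lemma smooth3_RInt U K : open3 U -> star1 U -> smooth3 U K ->
  smooth3 U (fun t p q => RInt (fun s => K s p q) 0 t).
Proof.
  intros HO HS H n. revert K H. induction n as [|n IH]; intros K H.
  - exact (cont3_RInt U K HO HS (smooth3_cont U K H)).
  - split; [exact (cont3_RInt U K HO HS (smooth3_cont U K H)) |].
    destruct (smooth3_partials U K HO H) as [K1 [K2 [K3 [Hp [H1 [H2 H3]]]]]].
    exists K, (fun t p q => RInt (fun s => K2 s p q) 0 t), (fun t p q => RInt (fun s => K3 s p q) 0 t).
    split; [| auto]. intros t p q HU. repeat split.
    + apply (RInt_slice_deriv U); auto using smooth3_cont.
    + apply (RInt_param_deriv (fun p s => K s p q) (fun p s => K2 s p q) t p (fun p s => U s p q)).
      * intros u s Hs ->. destruct (HO s p q (HS t p q s HU Hs)) as [r [Hr Hr']].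
        exists r. split; [exact Hr |]. intros u' s' Hu' Hs'. apply Hr'; auto using Rabs_minus_diag.
      * intros u s Hu. apply Hp, Hu.
      * intros u s Hu. apply (cont3_continuous_1 U K); auto using smooth3_cont.
      * intros u s Hu eps He. destruct (smooth3_cont U K2 H2 s u q Hu eps He) as [d [Hd E]].
        exists d. split; [exact Hd |]. intros u' s' Hu' Hs'. apply E; auto using Rabs_minus_diag.
    + apply (RInt_param_deriv (fun q s => K s p q) (fun q s => K3 s p q) t q (fun q s => U s p q)).
      * intros u s Hs ->. destruct (HO s p q (HS t p q s HU Hs)) as [r [Hr Hr']].
        exists r. split; [exact Hr |]. intros u' s' Hu' Hs'. apply Hr'; auto using Rabs_minus_diag.
      * intros u s Hu. apply Hp, Hu.
      * intros u s Hu. apply (cont3_continuous_1 U K); auto using smooth3_cont.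
      * intros u s Hu eps He. destruct (smooth3_cont U K3 H3 s p u Hu eps He) as [d [Hd E]].
        exists d. split; [exact Hd |]. intros u' s' Hu' Hs'. apply E; auto using Rabs_minus_diag.
Qed.

(** * Strict monotonicity and implicit functions *)

Lemma deriv_pos_incr (f f' : R -> R) (a b : R) : a < b ->
  (forall x, a <= x <= b -> derivable_pt_lim f x (f' x)) ->
  (forall x, a < x < b -> 0 < f' x) -> f a < f b.
Proof.
  intros Hab Hd Hp. destruct (MVT_cor2 f f' a b Hab Hd) as [x [E Hx]].
  specialize (Hp x Hx). nra.
Qed.

(** The sign is required of every derivative [l] because the partials extracted from smoothness have
    no formula; each application computes [l] in its own way by uniqueness of the derivative. *)
Lemma slice_incr (V : R -> R -> R -> Prop) Phi a b x y : open3 V ->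
  (forall a b x y z, V a b x -> V a b y -> x <= z <= y -> V a b z) ->
  smooth3 V Phi ->
  (forall a b z l, V a b z -> derivable_pt_lim (fun t => Phi a b t) z l -> 0 < l) ->
  V a b x -> V a b y -> x < y -> Phi a b x < Phi a b y.
Proof.
  intros HO HI HS Hpos Hx Hy Hxy.
  destruct (smooth3_partials V Phi HO HS) as [P1 [P2 [P3 [Hp _]]]].
  apply (deriv_pos_incr (fun t => Phi a b t) (fun t => P3 a b t) x y Hxy).
  - intros t Ht. apply Hp, (HI a b x y t Hx Hy Ht).
  - intros t Ht. assert (Vt : V a b t) by (apply (HI a b x y t Hx Hy); lra).
    apply (Hpos a b t); [exact Vt | apply Hp, Vt].
Qed.

(** Strict growth gives opposite signs on both sides of the zero. They persist for nearby
    parameters, and the intermediate value theorem restores a zero. *)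
Lemma implicit_open (V : R -> R -> R -> Prop) Phi :
  open3 V ->
  (forall a b x y z, V a b x -> V a b y -> x <= z <= y -> V a b z) ->
  smooth3 V Phi ->
  (forall a b z l, V a b z -> derivable_pt_lim (fun t => Phi a b t) z l -> 0 < l) ->
  open2 (fun a b => exists z, V a b z /\ Phi a b z = 0).
Proof.
  intros HO HI HS Hpos a b [z [HV HZ]].
  destruct (smooth3_partials V Phi HO HS) as [P1 [P2 [P3 [Hp _]]]].
  assert (Hmono : forall x y, V a b x -> V a b y -> x < y -> Phi a b x < Phi a b y).
  { intros x y. apply slice_incr; assumption. }
  destruct (HO _ _ _ HV) as [r [Hr HrV]]. set (e := r / 2).
  assert (Vp : V a b (z + e)).
  { apply HrV; try (apply Rabs_minus_diag, Hr). unfold e. apply Rabs_def1; lra. }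
  assert (Vm : V a b (z - e)).
  { apply HrV; try (apply Rabs_minus_diag, Hr). unfold e. apply Rabs_def1; lra. }
  assert (He : 0 < e) by (unfold e; lra).
  assert (Pp : 0 < Phi a b (z + e)) by (rewrite <- HZ; apply Hmono; auto; lra).
  assert (Pm : Phi a b (z - e) < 0) by (rewrite <- HZ; apply Hmono; auto; lra).
  destruct (smooth3_cont V Phi HS _ _ _ Vp _ Pp) as [d1 [Hd1 D1]].
  destruct (smooth3_cont V Phi HS _ _ _ Vm (- Phi a b (z - e))) as [d2 [Hd2 D2]]; [lra |].
  exists (Rmin r (Rmin d1 d2)). split; [repeat apply Rmin_pos; assumption |].
  intros a' b' Ha Hb. pose proof (Rmin_l r (Rmin d1 d2)). pose proof (Rmin_r r (Rmin d1 d2)).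
  pose proof (Rmin_l d1 d2). pose proof (Rmin_r d1 d2).
  assert (Q1 : 0 < Phi a' b' (z + e)).
  { specialize (D1 a' b' (z + e)). apply Rabs_def2 in D1; try lra. apply Rabs_minus_diag, Hd1. }
  assert (Q2 : Phi a' b' (z - e) < 0).
  { specialize (D2 a' b' (z - e)). apply Rabs_def2 in D2; try lra. apply Rabs_minus_diag, Hd2. }
  assert (HVs : forall t, z - e <= t <= z + e -> V a' b' t).
  { intros t Ht. apply HrV; try lra. unfold e in Ht. apply Rabs_def1; lra. }
  destruct (IVT_interv (fun t => Phi a' b' t) (z - e) (z + e)) as [t [Ht E]]; try lra.
  - intros t Ht. apply derivable_continuous_pt, ex_derive_Reals_0. exists (P3 a' b' t).
    apply is_derive_Reals, Hp, HVs, Ht.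
  - exists t. split; [apply HVs, Ht | exact E].
Qed.

(** The function [gam] may be any selection of zeros, for instance one made by [epsilon]: since the
    slices of [V] are intervals on which [Phi] increases, the zero is unique and the selection is
    automatically continuous. *)
Lemma smooth3_implicit (W : R -> R -> Prop) (V : R -> R -> R -> Prop) Phi gam :
  open2 W -> open3 V ->
  (forall a b x y z, V a b x -> V a b y -> x <= z <= y -> V a b z) ->
  smooth3 V Phi ->
  (forall a b z l, V a b z -> derivable_pt_lim (fun t => Phi a b t) z l -> 0 < l) ->
  (forall a b, W a b -> V a b (gam a b) /\ Phi a b (gam a b) = 0) ->
  smooth3 (fun a b _ => W a b) (fun a b _ => gam a b).
Proof.
  intros HW HO HI HS Hpos HG.
  destruct (smooth3_partials V Phi HO HS) as [P1 [P2 [P3 [Hp [H1 [H2 H3]]]]]].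
  assert (Hpos3 : forall a b z, V a b z -> 0 < P3 a b z).
  { intros a b z HV. apply (Hpos a b z); [exact HV | apply Hp, HV]. }
  assert (Hmono : forall a b x y, V a b x -> V a b y -> x < y -> Phi a b x < Phi a b y).
  { intros a b x y. apply slice_incr; assumption. }
  assert (Hcont : cont3 (fun a b _ => W a b) (fun a b _ => gam a b)).
  { intros a b c HWab eps He. destruct (HG a b HWab) as [HV HZ].
    destruct (HO _ _ _ HV) as [r [Hr HrV]]. destruct (HW a b HWab) as [rw [Hrw HrW]].
    (* The signs of [Phi] at [z - e] and [z + e] survive a small change of the parameters and trap
       the new zero between them. *)
    set (z := gam a b) in *. set (e := Rmin r eps / 2).
    assert (Hmin : 0 < Rmin r eps) by (apply Rmin_pos; assumption).
    pose proof (Rmin_l r eps). pose proof (Rmin_r r eps).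
    assert (He' : 0 < e) by (unfold e; lra). assert (Her : e < r) by (unfold e; lra).
    assert (Hee : e < eps) by (unfold e; lra).
    assert (Vp : V a b (z + e)).
    { apply HrV; try (apply Rabs_minus_diag, Hr). apply Rabs_def1; lra. }
    assert (Vm : V a b (z - e)).
    { apply HrV; try (apply Rabs_minus_diag, Hr). apply Rabs_def1; lra. }
    assert (Pp : 0 < Phi a b (z + e)) by (rewrite <- HZ; apply Hmono; auto; lra).
    assert (Pm : Phi a b (z - e) < 0) by (rewrite <- HZ; apply Hmono; auto; lra).
    destruct (smooth3_cont V Phi HS _ _ _ Vp _ Pp) as [d1 [Hd1 D1]].
    destruct (smooth3_cont V Phi HS _ _ _ Vm (- Phi a b (z - e))) as [d2 [Hd2 D2]]; [lra |].
    exists (Rmin (Rmin r rw) (Rmin d1 d2)). split; [repeat apply Rmin_pos; assumption |].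
    intros a' b' _ Ha Hb _.
    pose proof (Rmin_l (Rmin r rw) (Rmin d1 d2)). pose proof (Rmin_r (Rmin r rw) (Rmin d1 d2)).
    pose proof (Rmin_l r rw). pose proof (Rmin_r r rw).
    pose proof (Rmin_l d1 d2). pose proof (Rmin_r d1 d2).
    destruct (HG a' b') as [HV' HZ']; [apply HrW; lra |].
    assert (Q1 : 0 < Phi a' b' (z + e)).
    { specialize (D1 a' b' (z + e)). apply Rabs_def2 in D1; try lra.
      apply Rabs_minus_diag, Hd1. }
    assert (Q2 : Phi a' b' (z - e) < 0).
    { specialize (D2 a' b' (z - e)). apply Rabs_def2 in D2; try lra.
      apply Rabs_minus_diag, Hd2. }
    assert (Vp' : V a' b' (z + e)) by (apply HrV; try lra; apply Rabs_def1; lra).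
    assert (Vm' : V a' b' (z - e)) by (apply HrV; try lra; apply Rabs_def1; lra).
    assert (gam a' b' < z + e).
    { apply Rnot_le_lt. intros [Hl | Hl].
      - pose proof (Hmono a' b' _ _ Vp' HV' Hl). lra.
      - rewrite Hl in Q1. lra. }
    assert (z - e < gam a' b').
    { apply Rnot_le_lt. intros [Hl | Hl].
      - pose proof (Hmono a' b' _ _ HV' Vm' Hl). lra.
      - rewrite <- Hl in Q2. lra. }
    apply Rabs_def1; lra. }
  (* 0 = Phi' (h, D) + o(h, D) for the increment D of gam forces D = O(h), hence the formula. *)
  assert (Hder : forall a b k1 k2, W a b -> Rabs k1 <= 1 -> Rabs k2 <= 1 ->
      forall eps, 0 < eps -> exists del, 0 < del /\ forall h, Rabs h < del ->
        Rabs (gam (a + k1 * h) (b + k2 * h) - gam a b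
              - (- (P1 a b (gam a b) * k1 + P2 a b (gam a b) * k2) * / P3 a b (gam a b)) * h)
          <= eps * Rabs h).
  { intros a b k1 k2 HWab Hk1 Hk2 eps He. destruct (HG a b HWab) as [HV HZ].
    set (z := gam a b) in *. set (q := P1 a b z * k1 + P2 a b z * k2).
    pose proof (Hpos3 a b z HV) as Hp3. set (p3 := P3 a b z) in *.
    (* The bound [e <= p3 / 2] lets half of [p3 * Rabs D] absorb the error term in [D], which gives
       [Rabs D <= C * Rabs h]; the second bound on [e] turns the remaining error into
       [eps * Rabs h]. *)
    set (C := 2 * (Rabs q + p3) / p3). pose proof (Rabs_pos q) as Hq.
    assert (HC : 0 < C) by (apply Rdiv_lt_0_compat; lra).
    set (e := Rmin (p3 / 2) (p3 * eps / (2 + C))).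
    assert (Hee : 0 < e).
    { apply Rmin_pos; [lra | apply Rdiv_lt_0_compat; [apply Rmult_lt_0_compat; lra | lra]]. }
    assert (He1 : e <= p3 / 2) by apply Rmin_l.
    assert (He2 : e * (2 + C) <= p3 * eps).
    { apply Rle_trans with (p3 * eps / (2 + C) * (2 + C)).
      - apply Rmult_le_compat_r; [lra | apply Rmin_r].
      - right. field. lra. }
    destruct (strict_diff3 V Phi P1 P2 P3 a b z HO Hp (smooth3_cont _ _ H1) (smooth3_cont _ _ H2)
                (smooth3_cont _ _ H3) HV e Hee) as [d [Hd SD]].
    destruct (Hcont a b 0 HWab d Hd) as [d' [Hd' DC]].
    destruct (HW a b HWab) as [rw [Hrw HrW]].
    exists (Rmin rw (Rmin d d')). split; [repeat apply Rmin_pos; assumption |].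
    intros h Hh. pose proof (Rmin_l rw (Rmin d d')). pose proof (Rmin_r rw (Rmin d d')).
    pose proof (Rmin_l d d'). pose proof (Rmin_r d d'). pose proof (Rabs_pos h) as Ph.
    assert (E1 : Rabs (a + k1 * h - a) <= Rabs h).
    { replace (a + k1 * h - a) with (k1 * h) by ring. rewrite Rabs_mult. nra. }
    assert (E2 : Rabs (b + k2 * h - b) <= Rabs h).
    { replace (b + k2 * h - b) with (k2 * h) by ring. rewrite Rabs_mult. nra. }
    assert (HW' : W (a + k1 * h) (b + k2 * h)) by (apply HrW; lra).
    destruct (HG _ _ HW') as [_ HZ'].
    assert (E3 : Rabs (gam (a + k1 * h) (b + k2 * h) - z) < d).
    { apply (DC _ _ 0); try lra. apply Rabs_minus_diag, Hd'. }
    specialize (SD (a + k1 * h) (b + k2 * h) (gam (a + k1 * h) (b + k2 * h)) ltac:(lra) ltac:(lra) E3).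
    set (D := gam (a + k1 * h) (b + k2 * h) - z) in *. fold p3 in SD.
    rewrite HZ', HZ in SD.
    replace (0 - 0 - (P1 a b z * (a + k1 * h - a) + P2 a b z * (b + k2 * h - b) + p3 * D))
      with (- (q * h + p3 * D)) in SD by (unfold q; ring).
    rewrite Rabs_Ropp in SD.
    assert (SD' : Rabs (q * h + p3 * D) <= e * (2 * Rabs h + Rabs D)).
    { eapply Rle_trans; [exact SD |]. apply Rmult_le_compat_l; lra. }
    assert (HD : Rabs D <= C * Rabs h).
    { assert (T : p3 * Rabs D <= Rabs (q * h + p3 * D) + Rabs q * Rabs h).
      { rewrite <- (Rabs_pos_eq p3) at 1 by lra. rewrite <- !Rabs_mult, <- (Rabs_Ropp (q * h)).
        eapply Rle_trans; [| apply Rabs_triang]. right. f_equal. ring. }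
      pose proof (Rabs_pos D).
      apply (Rmult_le_reg_l (p3 / 2)); [lra |].
      replace (p3 / 2 * (C * Rabs h)) with ((Rabs q + p3) * Rabs h) by (unfold C; field; lra).
      nra. }
    replace (D - - q * / p3 * h) with ((q * h + p3 * D) * / p3) by (field; lra).
    rewrite Rabs_mult, Rabs_inv, (Rabs_pos_eq p3) by lra.
    apply (Rmult_le_reg_r p3); [lra |]. rewrite Rmult_assoc, Rinv_l, Rmult_1_r by lra.
    eapply Rle_trans; [exact SD' |]. apply Rle_trans with (e * (2 + C) * Rabs h).
    - rewrite Rmult_assoc. apply Rmult_le_compat_l; lra.
    - replace (eps * Rabs h * p3) with (p3 * eps * Rabs h) by ring.
      apply Rmult_le_compat_r; assumption. }
  assert (Hinv : smooth3 V (fun a b c => / P3 a b c)) by (apply smooth3_comp_inv; assumption).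
  assert (HQ1 : smooth3 V (fun a b c => - P1 a b c * / P3 a b c)).
  { apply (smooth3_mult V (fun a b c => - P1 a b c)); [apply smooth3_opp |]; assumption. }
  assert (HQ2 : smooth3 V (fun a b c => - P2 a b c * / P3 a b c)).
  { apply (smooth3_mult V (fun a b c => - P2 a b c)); [apply smooth3_opp |]; assumption. }
  (* Bootstrap: the partials of [gam] are smooth functions composed with [gam], so they are C^n as
     soon as [gam] is. *)
  intros n. induction n as [|n IH]; [exact Hcont |]. split; [exact Hcont |].
  exists (fun a b _ => - P1 a b (gam a b) * / P3 a b (gam a b)),
         (fun a b _ => - P2 a b (gam a b) * / P3 a b (gam a b)), (fun _ _ _ => 0).
  split; [| repeat split].
  - intros a b c HWab. repeat split; [| | apply derivable_pt_lim_const].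
    + apply linear_bound_derivable_pt_lim. intros eps He.
      destruct (Hder a b 1 0 HWab) with (eps := eps) as [d [Hd Hd']]; try assumption;
        try (rewrite ?Rabs_R0, ?Rabs_R1; lra).
      exists d. split; [exact Hd |]. intros h Hh. specialize (Hd' h Hh).
      rewrite Rmult_1_l, Rmult_0_l, Rplus_0_r, Rmult_1_r, Rmult_0_r, Rplus_0_r in Hd'. exact Hd'.
    + apply linear_bound_derivable_pt_lim. intros eps He.
      destruct (Hder a b 0 1 HWab) with (eps := eps) as [d [Hd Hd']]; try assumption;
        try (rewrite ?Rabs_R0, ?Rabs_R1; lra).
      exists d. split; [exact Hd |]. intros h Hh. specialize (Hd' h Hh).
      rewrite Rmult_1_l, Rmult_0_l, Rplus_0_r, Rmult_1_r, Rmult_0_r, Rplus_0_l in Hd'. exact Hd'.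
  - apply (C3_comp n V _ (fun a b _ => W a b) (fun a _ _ => a) (fun _ b _ => b) (fun a b _ => gam a b) HO HQ1);
    [apply smooth3_1 | apply smooth3_2 | exact IH | intros a b c HWab; apply HG, HWab].
  - apply (C3_comp n V _ (fun a b _ => W a b) (fun a _ _ => a) (fun _ b _ => b) (fun a b _ => gam a b) HO HQ2);
    [apply smooth3_1 | apply smooth3_2 | exact IH | intros a b c HWab; apply HG, HWab].
  - apply C3_const.
Qed.

(** * Monotonicity criterion for the normalized potential *)

(** At a zero [r > 0] of [g] one has [A / r = 2 * ln r - w]; substituting [r * y] for the unknown
    therefore eliminates [w], and only [c = A / r] remains. *)
Definition force (c y : R) : R := 2 * y * ln y + c * (y - 1).
Definition slope (c y : R) : R := 2 * ln y + 2 + c.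
Definition pot (c y : R) : R := y ^ 2 * ln y - (y ^ 2 - 1) / 2 + c * (y - 1) ^ 2 / 2.

Lemma pot_deriv c y : 0 < y -> derivable_pt_lim (pot c) y (force c y).
Proof.
  intros Hy. apply is_derive_Reals. unfold pot, force. auto_derive; [exact Hy | field; lra].
Qed.

Lemma force_deriv c y : 0 < y -> derivable_pt_lim (force c) y (slope c y).
Proof.
  intros Hy. apply is_derive_Reals. unfold slope, force. auto_derive; [exact Hy | field; lra].
Qed.

Lemma slope_incr c x y : 0 < x < y -> slope c x < slope c y.
Proof. intros H. unfold slope. pose proof (ln_increasing x y ltac:(lra) ltac:(lra)). lra. Qed.

Lemma force_1 c : force c 1 = 0.
Proof. unfold force. rewrite ln_1. ring. Qed.

Lemma pot_1 c : pot c 1 = 0.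
Proof. unfold pot. rewrite ln_1. field. Qed.

Lemma slope_1 c : slope c 1 = 2 + c.
Proof. unfold slope. rewrite ln_1. ring. Qed.

(** [force c] is convex and vanishes at 1. Between [al] and 1 it lies below its chord over this
    interval, beyond 1 above the extended chord; multiplying by [y - 1] makes both cases one
    inequality. *)
Lemma force_chord c al y : 0 < al < 1 -> force c al < 0 -> al <= y ->
  force c al / (al - 1) * (y - 1) ^ 2 <= (y - 1) * force c y.
Proof.
  intros Hal Hf Hy. set (m := force c al / (al - 1)).
  set (d := fun t => force c t - m * (t - 1)).
  assert (Hd : forall t, 0 < t -> derivable_pt_lim d t (slope c t - m)).
  { intros t Ht. apply is_derive_Reals. unfold d, force, slope. auto_derive; [exact Ht | field; lra]. }
  assert (d1 : d 1 = 0) by (unfold d; rewrite force_1; ring).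
  assert (dal : d al = 0) by (unfold d, m; field; lra).
  destruct (Rtotal_order y 1) as [H | [-> | H]]; [| rewrite force_1; lra |].
  - cut (d y <= 0); [unfold d; intros; nra |].
    destruct (Req_dec al y) as [<- | Hn]; [lra |]. apply Rnot_lt_le. intros Hp.
    destruct (MVT_cor2 d (fun t => slope c t - m) al y) as [x1 [E1 X1]];
      [lra | intros; apply Hd; lra |].
    destruct (MVT_cor2 d (fun t => slope c t - m) y 1) as [x2 [E2 X2]];
      [lra | intros; apply Hd; lra |].
    cbv beta in E1, E2. pose proof (slope_incr c x1 x2 ltac:(lra)).
    assert (0 < slope c x1 - m) by nra. assert (slope c x2 - m < 0) by nra. lra.
  - destruct (MVT_cor2 d (fun t => slope c t - m) al 1) as [x1 [E1 X1]];
      [lra | intros; apply Hd; lra |].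
    destruct (MVT_cor2 d (fun t => slope c t - m) 1 y) as [x2 [E2 X2]];
      [lra | intros; apply Hd; lra |].
    pose proof (slope_incr c x1 x2 ltac:(lra)).
    cbv beta in E1, E2.
    assert (slope c x1 - m = 0) by (apply (Rmult_eq_reg_r (1 - al)); lra). assert (0 < d y) by nra. unfold d in *. nra.
Qed.

Lemma chord_pos c al : 0 < al < 1 -> force c al < 0 -> 0 < force c al / (al - 1).
Proof.
  intros Hal Hf. replace (force c al / (al - 1)) with (- force c al / (1 - al)) by (field; lra).
  apply Rdiv_lt_0_compat; lra.
Qed.

Lemma force_sign c al y : 0 < al < 1 -> force c al < 0 -> al <= y -> y <> 1 ->
  0 < (y - 1) * force c y.
Proof.
  intros Hal Hf Hy Hn. pose proof (force_chord c al y Hal Hf Hy). pose proof (chord_pos c al Hal Hf).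
  assert (0 < (y - 1) ^ 2) by (apply pow2_gt_0; lra). nra.
Qed.

(** [force c] rises from a negative value at [al] to 0 at 1, so its slope is positive somewhere in
    between and, being increasing, also at 1. *)
Lemma well_c c al : 0 < al < 1 -> force c al < 0 -> 0 < 2 + c.
Proof.
  intros Hal Hf. destruct (MVT_cor2 (force c) (slope c) al 1) as [x [E X]];
    [lra | intros; apply force_deriv; lra |].
  rewrite force_1 in E. pose proof (slope_incr c x 1 ltac:(lra)). rewrite slope_1 in *. nra.
Qed.

(** The chord inequality integrated from 1. It keeps the well nondegenerate at the center and makes
    it unbounded at infinity. *)
Lemma pot_lower c al y : 0 < al < 1 -> force c al < 0 -> al <= y ->
  force c al / (al - 1) * (y - 1) ^ 2 / 2 <= pot c y.
Proof.
  intros Hal Hf Hy. set (m := force c al / (al - 1)).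
  set (d := fun t => pot c t - m * (t - 1) ^ 2 / 2).
  assert (Hd : forall t, 0 < t -> derivable_pt_lim d t (force c t - m * (t - 1))).
  { intros t Ht. apply is_derive_Reals. unfold d, force, pot. auto_derive; [exact Ht | field; lra]. }
  assert (d1 : d 1 = 0) by (unfold d; rewrite pot_1; field).
  cut (0 <= d y); [unfold d; intros; lra |].
  destruct (Rtotal_order y 1) as [H | [-> | H]]; [| lra |].
  - destruct (MVT_cor2 d (fun t => force c t - m * (t - 1)) y 1) as [x [E X]];
      [lra | intros; apply Hd; lra |].
    pose proof (force_chord c al x Hal Hf ltac:(lra)) as Hc. fold m in Hc.
    assert (force c x - m * (x - 1) <= 0) by nra. nra.
  - destruct (MVT_cor2 d (fun t => force c t - m * (t - 1)) 1 y) as [x [E X]];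
      [lra | intros; apply Hd; lra |].
    pose proof (force_chord c al x Hal Hf ltac:(lra)) as Hc. fold m in Hc.
    assert (0 <= force c x - m * (x - 1)) by nra. nra.
Qed.

Lemma pot_pos c al y : 0 < al < 1 -> force c al < 0 -> al <= y -> y <> 1 -> 0 < pot c y.
Proof.
  intros Hal Hf Hy Hn. pose proof (pot_lower c al y Hal Hf Hy). pose proof (chord_pos c al Hal Hf).
  assert (0 < (y - 1) ^ 2) by (apply pow2_gt_0; lra). nra.
Qed.

(** The coefficient of [pot] in Chicone's expression; [2 / y] is the third derivative of the
    potential. *)
Definition disc (c y : R) : R := 6 * slope c y ^ 2 - 2 * force c y * (2 / y).

(** With [t = ln y], [i = / y], [k = 2 + c] the claim reads 8 (t - 1 + i) + 4 k (1 - i) < 6 (2 t +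
    k)^2. The bounds e^t >= 1 + t and e^(-t) >= 1 - t give t - 1 + i <= t^2 and 1 - i <= t, and the
    square dominates. *)
Lemma disc_pos c y : 0 < 2 + c -> 1 <= y -> 0 < disc c y.
Proof.
  intros Hc Hy. unfold disc.
  assert (E : 2 * force c y * (2 / y) = 8 * ln y + 4 * c * (1 - / y)) by (unfold force; field; lra).
  rewrite E. unfold slope. set (k := 2 + c) in *. replace c with (k - 2) by (unfold k; ring).
  set (t := ln y).
  assert (Ht : 0 <= t) by (unfold t; rewrite <- ln_1; apply ln_le; lra).
  set (i := / y).
  assert (Hi0 : 0 < i) by (apply Rinv_0_lt_compat; lra).
  assert (Hi1 : 1 - t <= i).
  { replace i with (exp (- t)).
    - pose proof (exp_ineq1_le (- t)). lra.
    - unfold t, i. rewrite exp_Ropp, exp_ln; lra. }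
  assert (Hi2 : i * (1 + t) <= 1).
  { pose proof (exp_ineq1_le t) as He. unfold t in He at 2. rewrite exp_ln in He by lra.
    replace 1 with (i * y) at 2 by (unfold i; field; lra). apply Rmult_le_compat_l; lra. }
  assert (Hi3 : i <= 1) by nra.
  assert (Hi4 : t - 1 + i <= t ^ 2) by nra.
  nra.
Qed.

(* With S := 3 slope force^2 / disc the difference pot - S has derivative
   2 force^3 (5 force''^2 - 3 slope force''') / disc^2, the quantity in Schaaf's criterion. *)
Lemma schaaf_deriv c y : 0 < y -> 0 < disc c y ->
  derivable_pt_lim (fun t => pot c t - 3 * slope c t * force c t ^ 2 / disc c t) y
    (2 * force c y ^ 3 * (20 + 6 * slope c y) / (y ^ 2 * disc c y ^ 2)).
Proof.
  intros Hy HD. apply is_derive_Reals. unfold pot, disc, slope, force in *. auto_derive.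
  - repeat split; try lra.
    all: try (intros E; apply (Rlt_irrefl 0); rewrite <- E at 2; eapply Rlt_le_trans; [exact HD | right; field; lra]).
  - field. repeat split; try lra.
    intros E. assert (0 < y * (6 * (2 * ln y + 2 + c) ^ 2 - 2 * (2 * y * ln y + c * (y - 1)) * (2 / y)))
      by (apply Rmult_lt_0_compat; lra).
    apply (Rlt_irrefl 0). rewrite <- E at 2. eapply Rlt_le_trans; [eassumption |]. right. field. lra.
Qed.

(** For V = [pot c] this is 6 V V''^2 - 3 V'^2 V'' - 2 V V' V'''. *)
Definition chicone (c y : R) : R :=
  6 * pot c y * slope c y ^ 2 - 3 * slope c y * force c y ^ 2 - 2 * pot c y * force c y * (2 / y).

(** Left of 1 with [slope <= 0], no term is negative and the last is positive. Otherwise [slope] and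
    [disc] are positive between 1 and [y], and the expression is [disc * G] with [G 1 = 0]. The
    derivative of [G] has the sign of [force c t ^ 3], so [G] decreases towards 1 from the left and
    increases to the right of it. *)
Lemma chicone_pos c y : 0 < 2 + c -> 0 < y -> y <> 1 -> 0 < (y - 1) * force c y -> 0 < pot c y ->
  0 < chicone c y.
Proof.
  intros Hc Hy Hn Hf HF. unfold chicone.
  assert (Hi : 0 < 2 / y) by (apply Rdiv_lt_0_compat; lra).
  set (G := fun t => pot c t - 3 * slope c t * force c t ^ 2 / disc c t).
  assert (G1 : G 1 = 0).
  { unfold G. rewrite pot_1, force_1. unfold Rdiv. ring. }
  assert (HN : 0 < disc c y -> 0 < G y -> 0 < 6 * pot c y * slope c y ^ 2 -
    3 * slope c y * force c y ^ 2 - 2 * pot c y * force c y * (2 / y)).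
  { intros HD HG. replace (6 * pot c y * slope c y ^ 2 -
    3 * slope c y * force c y ^ 2 - 2 * pot c y * force c y * (2 / y)) with (disc c y * G y).
    - apply Rmult_lt_0_compat; assumption.
    - assert (E : disc c y * (3 * slope c y * force c y ^ 2 / disc c y) = 3 * slope c y * force c y ^ 2)
        by (field; lra).
      unfold G. rewrite Rmult_minus_distr_l, E. unfold disc. ring. }
  destruct (Rtotal_order y 1) as [Hlt | [-> | Hgt]]; [| lra |].
  - assert (Hfn : force c y < 0) by nra.
    destruct (Rle_dec (slope c y) 0) as [Hs | Hs].
    + assert (0 < - (pot c y * force c y * (2 / y))).
      { replace (- (pot c y * force c y * (2 / y))) with (pot c y * (- force c y) * (2 / y)) by ring.
        repeat apply Rmult_lt_0_compat; lra. }
      assert (0 <= pot c y * slope c y ^ 2) by (apply Rmult_le_pos; [lra | apply pow2_ge_0]).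
      assert (0 <= - slope c y * force c y ^ 2) by (apply Rmult_le_pos; [lra | apply pow2_ge_0]).
      lra.
    + assert (HS : forall t, y <= t <= 1 -> 0 < slope c t).
      { intros t Ht. destruct (Req_dec y t) as [<- | Hne]; [lra |].
        pose proof (slope_incr c y t ltac:(lra)). lra. }
      assert (HFn : forall t, y <= t < 1 -> force c t < 0).
      { intros t Ht. rewrite <- (force_1 c).
        apply (deriv_pos_incr (force c) (slope c) t 1); [lra | |].
        - intros x Hx. apply force_deriv. lra.
        - intros x Hx. apply HS. lra. }
      assert (HD : forall t, y <= t <= 1 -> 0 < disc c t).
      { intros t Ht. pose proof (HS t Ht). unfold disc.
        assert (0 < slope c t ^ 2) by (apply pow_lt; assumption).
        assert (0 < 2 / t) by (apply Rdiv_lt_0_compat; lra).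
        assert (force c t <= 0).
        { destruct (Req_dec t 1) as [-> | Hne]; [rewrite force_1; lra |]. left. apply HFn. lra. }
        nra. }
      apply HN; [apply HD; lra |].
      cut (- G y < - G 1); [intros; lra |].
      apply (deriv_pos_incr (fun t => - G t)
               (fun t => - (2 * force c t ^ 3 * (20 + 6 * slope c t) / (t ^ 2 * disc c t ^ 2))) y 1); [lra | |].
      * intros t Ht. apply (derivable_pt_lim_opp G). apply schaaf_deriv; [lra | apply HD; lra].
      * intros t Ht. pose proof (HFn t ltac:(lra)). pose proof (HD t ltac:(lra)).
        pose proof (HS t ltac:(lra)).
        replace (- (2 * force c t ^ 3 * (20 + 6 * slope c t) / (t ^ 2 * disc c t ^ 2)))
          with ((2 * (- force c t) ^ 3 * (20 + 6 * slope c t)) / (t ^ 2 * disc c t ^ 2)).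
        2:{ field. split; [lra | apply Rgt_not_eq; lra]. }
        assert (0 < (- force c t) ^ 3) by (apply pow_lt; lra).
        apply Rdiv_lt_0_compat; apply Rmult_lt_0_compat; try apply pow_lt; lra.
  - assert (HS : forall t, 1 <= t -> 0 < slope c t).
    { intros t Ht. destruct (Req_dec 1 t) as [<- | Hne]; [rewrite slope_1; lra |].
      pose proof (slope_incr c 1 t ltac:(lra)). rewrite slope_1 in *. lra. }
    assert (HFp : forall t, 1 < t -> 0 < force c t).
    { intros t Ht. rewrite <- (force_1 c).
      apply (deriv_pos_incr (force c) (slope c) 1 t); [lra | |].
      - intros x Hx. apply force_deriv. lra.
      - intros x Hx. apply HS. lra. }
    apply HN; [apply disc_pos; lra |]. rewrite <- G1.
    apply (deriv_pos_incr G (fun t => 2 * force c t ^ 3 * (20 + 6 * slope c t) / (t ^ 2 * disc c t ^ 2)) 1 y); [lra | |].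
    + intros t Ht. apply schaaf_deriv; [lra | apply disc_pos; lra].
    + intros t Ht. pose proof (HFp t ltac:(lra)). pose proof (disc_pos c t Hc ltac:(lra)).
      pose proof (HS t ltac:(lra)). assert (0 < force c t ^ 3) by (apply pow_lt; lra).
      apply Rdiv_lt_0_compat; apply Rmult_lt_0_compat; try apply pow_lt; lra.
Qed.

(** The differentiated quotient is the second derivative of the inverse of [sigma c], expressed in
    the variable [y]. *)
Lemma chicone_deriv c y : 0 < y -> force c y <> 0 ->
  derivable_pt_lim (fun t => (force c t ^ 2 - 2 * pot c t * slope c t) / force c t ^ 3) y
    (chicone c y / force c y ^ 4).
Proof.
  intros Hy Hf. apply is_derive_Reals.
  assert (H1 := proj2 (is_derive_Reals _ _ _) (force_deriv c y Hy)).
  assert (H2 := proj2 (is_derive_Reals _ _ _) (pot_deriv c y Hy)).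
  assert (H3 : is_derive (slope c) y (2 / y)).
  { unfold slope. auto_derive; [exact Hy | field; lra]. }
  auto_derive.
  - repeat split; try (eexists; eassumption). apply Rmult_integral_contrapositive_currified; [exact Hf |].
    apply Rmult_integral_contrapositive_currified; [exact Hf |]. lra.
  - change (fun x => force c x) with (force c). change (fun x => pot c x) with (pot c).
    change (fun x => slope c x) with (slope c).
    rewrite (is_derive_unique _ _ _ H1), (is_derive_unique _ _ _ H2), (is_derive_unique _ _ _ H3).
    unfold chicone. field. split; [lra | exact Hf].
Qed.

(** * The coordinate sigma and its inverse *)

(* Taylor's integral remainder divides [2 pot 0 y] by its double zero at [y = 1]. *)
Definition rem2 (y : R) : R :=
  RInt (fun t => 2 * (1 - t) * (2 * ln (1 + t * (y - 1)) + 2)) 0 1.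

Lemma segment_pos (t y : R) : 0 < y -> 0 <= t <= 1 -> 0 < 1 + t * (y - 1).
Proof.
  intros Hy Ht. replace (1 + t * (y - 1)) with ((1 - t) + t * y) by ring.
  destruct (Req_dec t 0) as [-> | Hn]; [lra |].
  assert (0 < t * y) by (apply Rmult_lt_0_compat; lra). lra.
Qed.

Definition rem2_dom (t y q : R) : Prop := 0 < 1 + t * (y - 1).

Lemma rem2_dom_open : open3 rem2_dom.
Proof.
  apply (open3_pos (fun t y q => 1 + t * (y - 1))), smooth3_cont.
  apply (smooth3_plus _ (fun _ _ _ => 1)); [apply smooth3_const |].
  apply (smooth3_mult _ (fun t _ _ => t)); [apply smooth3_1 |].
  apply (smooth3_minus _ (fun _ y _ => y)); [apply smooth3_2 | apply smooth3_const].
Qed.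

Lemma rem2_smooth_integrand :
  smooth3 rem2_dom (fun t y q => 2 * (1 - t) * (2 * ln (1 + t * (y - 1)) + 2)).
Proof.
  apply (smooth3_mult _ (fun t _ _ => 2 * (1 - t))).
  - apply (smooth3_mult _ (fun _ _ _ => 2)); [apply smooth3_const |].
    apply (smooth3_minus _ (fun _ _ _ => 1)); [apply smooth3_const | apply smooth3_1].
  - apply (smooth3_plus _ (fun t y _ => 2 * ln (1 + t * (y - 1)))); [| apply smooth3_const].
    apply (smooth3_mult _ (fun _ _ _ => 2)); [apply smooth3_const |].
    apply smooth3_comp_ln; [| trivial].
    apply (smooth3_plus _ (fun _ _ _ => 1)); [apply smooth3_const |].
    apply (smooth3_mult _ (fun t _ _ => t)); [apply smooth3_1 |].
    apply (smooth3_minus _ (fun _ y _ => y)); [apply smooth3_2 | apply smooth3_const].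
Qed.

Lemma rem2_smooth : smooth3 (fun y _ _ => 0 < y) (fun y _ _ => rem2 y).
Proof.
  apply (smooth3_comp rem2_dom (fun t y q => RInt (fun s => 2 * (1 - s) * (2 * ln (1 + s * (y - 1)) + 2)) 0 t)
           _ (fun _ _ _ => 1) (fun y _ _ => y) (fun _ _ _ => 0)).
  - exact rem2_dom_open.
  - apply smooth3_RInt; [exact rem2_dom_open | | exact rem2_smooth_integrand].
    intros t y q s H Hs. unfold rem2_dom in *. unfold Rmin, Rmax in Hs.
    destruct (Rle_dec 0 t); destruct (Rle_dec 1 y); nra.
  - apply smooth3_const.
  - apply smooth3_1.
  - apply smooth3_const.
  - intros y _ _ Hy. unfold rem2_dom. lra.
Qed.

Lemma rem2_pot y : 0 < y -> (y - 1) ^ 2 * rem2 y = 2 * pot 0 y.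
Proof.
  intros Hy. unfold rem2. rewrite <- (RInt_scal (V := R_CompleteNormedModule)).
  2:{ apply (ex_RInt_slice rem2_dom (fun t y q => 2 * (1 - t) * (2 * ln (1 + t * (y - 1)) + 2)) y 0 0 1).
      - apply smooth3_cont, rem2_smooth_integrand.
      - intros s Hs. rewrite Rmin_left, Rmax_right in Hs by lra. apply segment_pos; lra. }
  apply is_RInt_unique.
  (* The primitive found by integrating by parts; at [t = 0] it vanishes because [force] and [pot]
     do at 1. *)
  set (P := fun t => 2 * (1 - t) * (y - 1) * force 0 (1 + t * (y - 1)) + 2 * pot 0 (1 + t * (y - 1))).
  replace (2 * pot 0 y) with (minus (P 1) (P 0)).
  2:{ unfold P, minus, plus, opp; simpl. replace (1 + 1 * (y - 1)) with y by ring.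
      replace (1 + 0 * (y - 1)) with 1 by ring. rewrite force_1, pot_1. ring. }
  apply (is_RInt_derive (V := R_CompleteNormedModule)).
  - intros t Ht. rewrite Rmin_left, Rmax_right in Ht by lra.
    pose proof (segment_pos t y Hy Ht) as Hp.
    unfold P, force, pot, scal; simpl. unfold mult; simpl. auto_derive; [repeat split; exact Hp |].
    field. lra.
  - intros t Ht. rewrite Rmin_left, Rmax_right in Ht by lra.
    apply @continuous_scal; [apply continuous_const |].
    apply (cont3_continuous_1 rem2_dom (fun t y q => 2 * (1 - t) * (2 * ln (1 + t * (y - 1)) + 2)) t y 0).
    + apply smooth3_cont, rem2_smooth_integrand.
    + apply segment_pos; assumption.
Qed.

Lemma rem2_1 : rem2 1 = 2.
Proof.
  unfold rem2. apply is_RInt_unique.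
  apply (is_RInt_ext (fun t => 4 * (1 - t))).
  { intros t _. assert (E : 4 * (1 - t) = 2 * (1 - t) * (2 * ln (1 + t * (1 - 1)) + 2)).
    { replace (1 + t * (1 - 1)) with 1 by ring. rewrite ln_1. ring. }
    exact E. }
  replace 2 with (minus ((fun t => 4 * t - 2 * t ^ 2) 1) ((fun t => 4 * t - 2 * t ^ 2) 0))
    by (unfold minus, plus, opp; simpl; ring).
  apply (is_RInt_derive (V := R_CompleteNormedModule) (fun t => 4 * t - 2 * t ^ 2)).
  - intros t _. auto_derive; [trivial | ring].
  - intros t _. apply (@ex_derive_continuous R_AbsRing R_NormedModule). auto_derive. trivial.
Qed.

(** A signed square root of [2 * pot c y]. With the double zero divided out, it is smooth through
    [y = 1]; since [c] enters [pot] only through [c * (y - 1) ^ 2 / 2], the quotient is [rem2 y + c]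
    with [rem2] independent of [c]. *)
Definition sigma (c y : R) : R := (y - 1) * sqrt (rem2 y + c).

(** At 1 this is the curvature [2 + c] of the well, elsewhere it is [2 * pot c y / (y - 1) ^ 2]. *)
Lemma rem2_c_pos c al y : 0 < al < 1 -> force c al < 0 -> al <= y -> 0 < rem2 y + c.
Proof.
  intros Hal Hf Hy. destruct (Req_dec y 1) as [-> | Hn].
  - rewrite rem2_1. exact (well_c c al Hal Hf).
  - pose proof (pot_pos c al y Hal Hf Hy Hn) as Hp. pose proof (rem2_pot y ltac:(lra)) as E.
    assert (Hsq : 0 < (y - 1) ^ 2) by (apply pow2_gt_0; lra).
    apply (Rmult_lt_reg_l ((y - 1) ^ 2)); [exact Hsq |].
    rewrite Rmult_0_r, Rmult_plus_distr_l, E.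
    replace (2 * pot 0 y + (y - 1) ^ 2 * c) with (2 * pot c y) by (unfold pot; field). lra.
Qed.

Lemma sigma_sqr c y : 0 < y -> 0 <= rem2 y + c -> sigma c y ^ 2 = 2 * pot c y.
Proof.
  intros Hy H. unfold sigma. rewrite Rpow_mult_distr, pow2_sqrt by exact H.
  rewrite Rmult_plus_distr_l, (rem2_pot y Hy). unfold pot. field.
Qed.

Lemma sigma_dom_open al : open3 (fun y c q => al < y /\ force c al < 0).
Proof.
  apply open3_and.
  - intros y c q H. exists (y - al). split; [lra |]. intros y' _ _ Hy _ _.
    apply Rabs_def2 in Hy. lra.
  - intros y c q H.
    destruct (open3_pos (fun _ c _ => - force c al)) with (a := y) (b := c) (c := q) as [r [Hr H']]; [| lra |].
    + apply smooth3_cont. apply smooth3_opp. unfold force.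
      apply (smooth3_plus _ (fun _ _ _ => 2 * al * ln al)); [apply smooth3_const |].
      apply (smooth3_mult _ (fun _ c _ => c)); [apply smooth3_2 | apply smooth3_const].
    + exists r. split; [exact Hr |]. intros a' b' c' Ha Hb Hc. specialize (H' a' b' c' Ha Hb Hc). lra.
Qed.

Lemma sqrt_rem2_smooth al : 0 < al < 1 ->
  smooth3 (fun y c q => al < y /\ force c al < 0) (fun y c _ => sqrt (rem2 y + c)).
Proof.
  intros Hal. apply smooth3_comp_sqrt.
  - apply sigma_dom_open.
  - apply (smooth3_plus _ (fun y _ _ => rem2 y)); [| apply smooth3_2].
    apply smooth3_sub with (2 := rem2_smooth). intros y c q [Hy _]. lra.
  - intros y c q [Hy Hf]. apply (rem2_c_pos c al); lra.
Qed.

Lemma sigma_smooth al : 0 < al < 1 ->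
  smooth3 (fun y c q => al < y /\ force c al < 0) (fun y c _ => sigma c y).
Proof.
  intros Hal. unfold sigma.
  apply (smooth3_mult _ (fun y _ _ => y - 1)).
  - apply (smooth3_minus _ (fun y _ _ => y)); [apply smooth3_1 | apply smooth3_const].
  - apply sqrt_rem2_smooth, Hal.
Qed.

Lemma sigma_sign c al y : 0 < al < 1 -> force c al < 0 -> al <= y -> y <> 1 -> 0 < (y - 1) * sigma c y.
Proof.
  intros Hal Hf Hy Hn. unfold sigma. rewrite <- Rmult_assoc.
  apply Rmult_lt_0_compat; [apply Rsqr_pos_lt; lra |].
  apply sqrt_lt_R0, (rem2_c_pos c al); assumption.
Qed.

(** Off the center, differentiating [sigma ^ 2 = 2 * pot] gives [l * sigma = force], and both
    factors have the sign of [y - 1]. At the center this degenerates, and the product form of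
    [sigma] gives [l = sqrt (rem2 1 + c)]. *)
Lemma sigma_deriv_pos c al y l : 0 < al < 1 -> force c al < 0 -> al < y ->
  derivable_pt_lim (sigma c) y l -> 0 < l.
Proof.
  intros Hal Hf Hy Hl. destruct (Req_dec y 1) as [-> | Hn].
  - pose proof (rem2_c_pos c al 1 Hal Hf ltac:(lra)) as Hp.
    destruct (smooth3_partials _ _ (sigma_dom_open al) (sqrt_rem2_smooth al Hal)) as [s1 [s2 [s3 [Hs _]]]].
    destruct (Hs 1 c 0 (conj Hy Hf)) as [Hs1 _].
    assert (Hl' : derivable_pt_lim (sigma c) 1 (1 * sqrt (rem2 1 + c) + (1 - 1) * s1 1 c 0)).
    { apply (derivable_pt_lim_mult (fun y => y - 1) (fun y => sqrt (rem2 y + c))); [| exact Hs1].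
      apply is_derive_Reals. auto_derive; [trivial | ring]. }
    rewrite (uniqueness_limite _ _ _ _ Hl Hl'). pose proof (sqrt_lt_R0 _ Hp). lra.
  - pose proof (sigma_sign c al y Hal Hf ltac:(lra) Hn) as Hs.
    pose proof (force_sign c al y Hal Hf ltac:(lra) Hn) as Hfs.
    assert (E : l * sigma c y + sigma c y * l = 2 * force c y).
    { apply (uniqueness_limite (fun t => sigma c t * sigma c t) y).
      - apply (derivable_pt_lim_mult (sigma c) (sigma c)); assumption.
      - apply (derivable_pt_lim_ext_near (fun t => 2 * pot c t) _ y _ (y - al)); [lra | |].
        + intros t Ht. apply Rabs_def2 in Ht. rewrite <- (sigma_sqr c t); [ring | lra |].
          left. apply (rem2_c_pos c al); lra.
        + apply (derivable_pt_lim_scal (pot c) 2). apply pot_deriv. lra. }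
    assert (0 < (y - 1) ^ 2) by (apply pow2_gt_0; lra).
    assert (E2 : ((y - 1) * sigma c y) * l = (y - 1) * force c y) by nra.
    apply Rnot_le_lt. intros Hle. nra.
Qed.

(* The amplitudes [s] of the orbits staying to the right of [al]; [q] is a dummy variable. *)
Definition amp_dom (al s c q : R) : Prop := force c al < 0 /\ s ^ 2 < 2 * pot c al.

(** The choice is meaningful on [amp_dom], where a preimage exists; it is unique because [sigma c]
    increases to the right of [al]. *)
Definition sigma_inv (al s c : R) : R := epsilon (inhabits 0) (fun y => al < y /\ sigma c y = s).

Lemma sigma_al c al : 0 < al < 1 -> force c al < 0 -> sigma c al < 0.
Proof. intros Hal Hf. pose proof (sigma_sign c al al Hal Hf ltac:(lra) ltac:(lra)). nra. Qed.

Lemma rem2_derivable y : 0 < y -> exists l, derivable_pt_lim rem2 y l.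
Proof.
  intros Hy. destruct (smooth3_partials _ _ open3_gt0 rem2_smooth) as [r1 [r2 [r3 [H _]]]].
  exists (r1 y 0 0). apply (H y 0 0 Hy).
Qed.

Lemma sigma_continuous c al y : 0 < al < 1 -> force c al < 0 -> al <= y -> continuity_pt (sigma c) y.
Proof.
  intros Hal Hf Hy.
  assert (H : ex_derive (sigma c) y).
  { destruct (rem2_derivable y ltac:(lra)) as [l Hl].
    pose proof (rem2_c_pos c al y Hal Hf Hy).
    unfold sigma. auto_derive. repeat split; [exists l; apply is_derive_Reals, Hl | lra]. }
  apply derivable_continuous_pt, ex_derive_Reals_0, H.
Qed.

Lemma sigma_inv_spec al s c q : 0 < al < 1 -> amp_dom al s c q -> al < sigma_inv al s c /\ sigma c (sigma_inv al s c) = s.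
Proof.
  intros Hal [Hf Hs]. apply (epsilon_spec (inhabits 0) (fun y => al < y /\ sigma c y = s)).
  pose proof (sigma_al c al Hal Hf) as Hneg. pose proof (chord_pos c al Hal Hf) as Hm.
  set (m := force c al / (al - 1)) in *.
  assert (Hlo : sigma c al < s).
  { rewrite <- (sigma_sqr c al) in Hs; [nra | lra | left; apply (rem2_c_pos c al); lra]. }
  set (M := 2 + Rabs s / sqrt m + Rabs s).
  pose proof (Rabs_pos s). pose proof (sqrt_lt_R0 m Hm) as Hsm.
  assert (Hq : 0 <= Rabs s / sqrt m) by (apply Rdiv_le_0_compat; assumption).
  assert (HM : 2 <= M) by (unfold M; lra).
  assert (Hhi : s < sigma c M).
  { assert (P : 0 < (M - 1) * sigma c M) by (apply (sigma_sign c al); lra).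
    assert (P' : 0 < sigma c M) by nra.
    apply Rle_lt_trans with (Rabs s); [apply Rle_abs |].
    apply Rsqr_incrst_0; [| lra | lra].
    rewrite !Rsqr_pow2. rewrite (sigma_sqr c M); [| lra | left; apply (rem2_c_pos c al); lra].
    pose proof (pot_lower c al M Hal Hf ltac:(lra)) as L. fold m in L.
    assert (E : Rabs s ^ 2 = m * (Rabs s / sqrt m) ^ 2).
    { unfold Rdiv. rewrite Rpow_mult_distr, pow_inv, pow2_sqrt by lra. field. lra. }
    rewrite E.
    assert ((Rabs s / sqrt m) ^ 2 < (M - 1) ^ 2) by (unfold M; nra). nra. }
  destruct (IVT_interv (fun y => sigma c y - s) al M) as [y [Hy E]].
  - intros y Hy. apply (continuity_pt_minus (sigma c) (fun _ => s)).
    + apply (sigma_continuous c al); [assumption | assumption | apply Hy].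
    + apply continuity_pt_const. intros ? ?. reflexivity.
  - lra.
  - lra.
  - lra.
  - exists y. split; [| lra]. destruct (Req_dec al y) as [<- | Hn]; lra.
Qed.

Lemma amp_dom_open al : open3 (amp_dom al).
Proof.
  assert (Hf : cont3 (fun _ _ _ => True) (fun _ c _ => - force c al)).
  { apply smooth3_cont. apply smooth3_opp. unfold force.
    apply (smooth3_plus _ (fun _ _ _ => 2 * al * ln al)); [apply smooth3_const |].
    apply (smooth3_mult _ (fun _ c _ => c)); [apply smooth3_2 | apply smooth3_const]. }
  assert (Hp : cont3 (fun _ _ _ => True) (fun s c _ => 2 * pot c al - s * s)).
  { apply smooth3_cont. apply (smooth3_minus _ (fun _ c _ => 2 * pot c al)).
    - unfold pot. apply (smooth3_mult _ (fun _ _ _ => 2)); [apply smooth3_const |].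
      apply (smooth3_plus _ (fun _ _ _ => al ^ 2 * ln al - (al ^ 2 - 1) / 2)); [apply smooth3_const |].
      apply (smooth3_mult _ (fun _ c _ => c * (al - 1) ^ 2)); [| apply smooth3_const].
      apply (smooth3_mult _ (fun _ c _ => c)); [apply smooth3_2 | apply smooth3_const].
    - apply (smooth3_mult _ (fun s _ _ => s)); apply smooth3_1. }
  intros s c q HW.
  destruct (open3_and _ _ (open3_pos _ Hf) (open3_pos _ Hp) s c q) as [r [Hr H]].
  { destruct HW. split; lra. }
  exists r. split; [exact Hr |]. intros s' c' q' Hs Hc Hq.
  destruct (H s' c' q' Hs Hc Hq). split; lra.
Qed.

Lemma amp_dom_open_rho_c al : open3 (fun _ rho c => amp_dom al rho c 0).
Proof.
  intros th rho c HW. destruct (amp_dom_open al rho c 0 HW) as [r [Hr H]].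
  exists r. split; [exact Hr |]. intros th' rho' c' _ H1 H2. apply H; auto using Rabs_minus_diag.
Qed.

Lemma sigma_inv_smooth al : 0 < al < 1 -> smooth3 (amp_dom al) (fun s c _ => sigma_inv al s c).
Proof.
  intros Hal.
  (* The body of [amp_dom] ignores its last argument, so this domain is convertible to the stated
     one. *)
  assert (H : smooth3 (fun s c _ => amp_dom al s c 0) (fun s c _ => sigma_inv al s c)).
  { apply (smooth3_implicit (fun s c => amp_dom al s c 0) (fun s c y => al < y /\ force c al < 0)
             (fun s c y => sigma c y - s)).
    - intros s c HW. destruct (amp_dom_open al s c 0 HW) as [r [Hr H]]. exists r. split; [exact Hr |].
      intros s' c' Hs Hc. apply (H s' c' 0); try assumption. apply Rabs_minus_diag, Hr.
    - intros s c y HV. destruct (sigma_dom_open al y c s HV) as [r [Hr H]]. exists r. split; [exact Hr |].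
      intros s' c' y' Hs Hc Hy. exact (H y' c' s' Hy Hc Hs).
    - intros s c x y z [Hx Hf] [Hy _] Hz. split; [lra | exact Hf].
    - apply (smooth3_minus _ (fun _ c y => sigma c y)); [| apply smooth3_1].
      apply (smooth3_comp _ _ _ (fun _ _ y => y) (fun _ c _ => c) (fun _ _ _ => 0)
               (sigma_dom_open al) (sigma_smooth al Hal)); auto using smooth3_2, smooth3_3, smooth3_const.
    - intros s c y l [Hy Hf] Hl. apply (sigma_deriv_pos c al y l Hal Hf Hy).
      replace l with (l + 0) by ring.
      apply (derivable_pt_lim_ext_near (fun t => (sigma c t - s) + s) _ _ _ 1); [lra | intros; ring |].
      apply (derivable_pt_lim_plus (fun t => sigma c t - s) (fun _ => s)); [exact Hl |].
      apply derivable_pt_lim_const.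
    - intros s c HW. destruct (sigma_inv_spec al s c 0 Hal HW) as [Hy E]. split; [split; [exact Hy | apply HW] |].
      rewrite E. ring. }
  exact H.
Qed.

Lemma sigma_inv_pot al s c q : 0 < al < 1 -> amp_dom al s c q -> pot c (sigma_inv al s c) = s ^ 2 / 2.
Proof.
  intros Hal HW. destruct (sigma_inv_spec al s c q Hal HW) as [Hy E].
  pose proof (sigma_sqr c (sigma_inv al s c) ltac:(lra)) as H. rewrite E in H.
  rewrite H; [field |]. left. apply (rem2_c_pos c al); [assumption | apply HW | lra].
Qed.

Lemma sigma_inv_unique al s c q y : 0 < al < 1 -> amp_dom al s c q -> al < y -> sigma c y = s -> sigma_inv al s c = y.
Proof.
  intros Hal HW Hy E. destruct (sigma_inv_spec al s c q Hal HW) as [Hy' E'].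
  destruct (smooth3_partials _ _ (sigma_dom_open al) (sigma_smooth al Hal)) as [s1 [s2 [s3 [Hs _]]]].
  assert (Hm : forall a b, al < a -> a < b -> sigma c a < sigma c b).
  { intros a b Ha Hab. apply (deriv_pos_incr (sigma c) (fun y => s1 y c 0) a b Hab).
    - intros x Hx. apply (Hs x c 0). split; [lra | apply HW].
    - intros x Hx. apply (sigma_deriv_pos c al x); [assumption | apply HW | lra |].
      apply (Hs x c 0). split; [lra | apply HW]. }
  destruct (Rtotal_order (sigma_inv al s c) y) as [H | [H | H]]; [| exact H |].
  - pose proof (Hm _ _ Hy' H). lra.
  - pose proof (Hm _ _ Hy H). lra.
Qed.

Lemma amp_dom_scale al s c q k : amp_dom al s c q -> Rabs k <= 1 -> amp_dom al (k * s) c q.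
Proof.
  intros [Hf Hs] Hk. split; [exact Hf |]. rewrite Rpow_mult_distr, <- (pow2_abs k).
  pose proof (Rabs_pos k). assert (0 <= s ^ 2) by apply pow2_ge_0.
  assert (Rabs k ^ 2 <= 1) by nra. nra.
Qed.

(** Everything comes from differentiating [pot c (h s) = s ^ 2 / 2]: once gives h_s force = s, twice
    gives h_ss force + slope h_s^2 = 1, and a third time Chicone's expression over force^4, times
    h_s. The last two need [force <> 0], that is [s <> 0], so the conclusion records the increment
    of h_ss from the center instead of a sign of h_sss. *)
Lemma sigma_inv_derivs al : 0 < al < 1 -> exists hs hss : R -> R -> R -> R,
  smooth3 (amp_dom al) hs /\ smooth3 (amp_dom al) hss /\
  forall s c q, amp_dom al s c q ->
    derivable_pt_lim (fun t => sigma_inv al t c) s (hs s c q) /\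
    derivable_pt_lim (fun t => hs t c q) s (hss s c q) /\
    0 < hs s c q /\ hs s c q * force c (sigma_inv al s c) = s /\
    (s <> 0 -> 0 < (hss s c q - hss 0 c q) * s).
Proof.
  intros Hal.
  destruct (smooth3_partials _ _ (amp_dom_open al) (sigma_inv_smooth al Hal)) as [hs [hs2 [hs3 [Hp [Ss _]]]]].
  destruct (smooth3_partials _ _ (amp_dom_open al) Ss) as [hss [hss2 [hss3 [Hp2 [Sss _]]]]].
  destruct (smooth3_partials _ _ (amp_dom_open al) Sss) as [h3 [h32 [h33 [Hp3 _]]]].
  exists hs, hss. split; [exact Ss |]. split; [exact Sss |].
  assert (D1 : forall s c q, amp_dom al s c q -> derivable_pt_lim (fun t => sigma_inv al t c) s (hs s c q))
    by (intros s c q HW; apply (Hp s c q HW)).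
  assert (near : forall s c q, amp_dom al s c q -> exists r, 0 < r /\ forall t, Rabs (t - s) < r -> amp_dom al t c q).
  { intros s c q HW. destruct (amp_dom_open al s c q HW) as [r [Hr H]]. exists r. split; [exact Hr |].
    intros t Ht. apply H; auto using Rabs_minus_diag. }
  assert (Pos : forall s c q, amp_dom al s c q -> 0 < hs s c q).
  { intros s c q HW. destruct (sigma_inv_spec al s c q Hal HW) as [Hy _].
    destruct (smooth3_partials _ _ (sigma_dom_open al) (sigma_smooth al Hal)) as [s1 [s2 [s3 [Hs _]]]].
    destruct (Hs (sigma_inv al s c) c 0) as [Hs1 _]; [split; [exact Hy | apply HW] |].
    pose proof (sigma_deriv_pos c al _ _ Hal (proj1 HW) Hy Hs1) as Hpos.
    assert (E : s1 (sigma_inv al s c) c 0 * hs s c q = 1).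
    { apply (uniqueness_limite (fun t => sigma c (sigma_inv al t c)) s).
      - apply (derivable_pt_lim_comp (fun t => sigma_inv al t c) (sigma c)); [apply D1, HW | exact Hs1].
      - destruct (near s c q HW) as [r [Hr H]].
        apply (derivable_pt_lim_ext_near (fun t => t) _ s 1 r Hr).
        + intros t Ht. symmetry. apply (sigma_inv_spec al t c q Hal (H t Ht)).
        + apply derivable_pt_lim_id. }
    apply Rnot_le_lt. intros Hle. nra. }
  assert (En : forall s c q, amp_dom al s c q -> hs s c q * force c (sigma_inv al s c) = s).
  { intros s c q HW. destruct (sigma_inv_spec al s c q Hal HW) as [Hy _].
    assert (E : force c (sigma_inv al s c) * hs s c q = s); [| lra].
    apply (uniqueness_limite (fun t => pot c (sigma_inv al t c)) s).
    - apply (derivable_pt_lim_comp (fun t => sigma_inv al t c) (pot c)); [apply D1, HW | apply pot_deriv; lra].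
    - destruct (near s c q HW) as [r [Hr H]].
      apply (derivable_pt_lim_ext_near (fun t => t ^ 2 / 2) _ s s r Hr).
      + intros t Ht. symmetry. apply (sigma_inv_pot al t c q Hal (H t Ht)).
      + apply is_derive_Reals. auto_derive; [trivial | field]. }
  assert (N1 : forall s c q, amp_dom al s c q -> s <> 0 -> sigma_inv al s c <> 1).
  { intros s c q HW Hs E. pose proof (sigma_inv_pot al s c q Hal HW) as H. rewrite E, pot_1 in H.
    assert (0 < s ^ 2) by (apply pow2_gt_0; exact Hs). lra. }
  assert (H2 : forall s c q, amp_dom al s c q -> s <> 0 ->
     hss s c q = (force c (sigma_inv al s c) ^ 2 - 2 * pot c (sigma_inv al s c) * slope c (sigma_inv al s c)) / force c (sigma_inv al s c) ^ 3).
  { intros s c q HW Hs. destruct (sigma_inv_spec al s c q Hal HW) as [Hy _].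
    pose proof (En s c q HW) as Ens.
    assert (Hfn : force c (sigma_inv al s c) <> 0) by (intros E; rewrite E in Ens; lra).
    assert (Hd : hss s c q * force c (sigma_inv al s c) + hs s c q * (slope c (sigma_inv al s c) * hs s c q) = 1).
    { apply (uniqueness_limite (fun t => hs t c q * force c (sigma_inv al t c)) s).
      - apply (derivable_pt_lim_mult (fun t => hs t c q) (fun t => force c (sigma_inv al t c))).
        + apply (Hp2 s c q HW).
        + apply (derivable_pt_lim_comp (fun t => sigma_inv al t c) (force c)); [apply D1, HW | apply force_deriv; lra].
      - destruct (near s c q HW) as [r [Hr H]].
        apply (derivable_pt_lim_ext_near (fun t => t) _ s 1 r Hr).
        + intros t Ht. symmetry. apply (En t c q (H t Ht)).
        + apply derivable_pt_lim_id. }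
    rewrite (sigma_inv_pot al s c q Hal HW).
    assert (Eh : hs s c q = s / force c (sigma_inv al s c)) by (rewrite <- Ens at 2; field; exact Hfn).
    rewrite Eh in Hd. apply (Rmult_eq_reg_r (force c (sigma_inv al s c))); [| exact Hfn].
    replace (hss s c q * force c (sigma_inv al s c)) with
      (1 - s / force c (sigma_inv al s c) * (slope c (sigma_inv al s c) * (s / force c (sigma_inv al s c)))) by lra.
    field. exact Hfn. }
  assert (H3 : forall s c q, amp_dom al s c q -> s <> 0 -> 0 < h3 s c q).
  { intros s c q HW Hs. destruct (sigma_inv_spec al s c q Hal HW) as [Hy _].
    pose proof (En s c q HW) as Ens.
    assert (Hfn : force c (sigma_inv al s c) <> 0) by (intros E; rewrite E in Ens; lra).
    assert (E : h3 s c q = chicone c (sigma_inv al s c) / force c (sigma_inv al s c) ^ 4 * hs s c q).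
    { apply (uniqueness_limite (fun t => hss t c q) s); [apply (Hp3 s c q HW) |].
      destruct (near s c q HW) as [r [Hr H]].
      assert (Hrs : 0 < Rmin r (Rabs s)) by (apply Rmin_pos; [exact Hr | apply Rabs_pos_lt, Hs]).
      apply (derivable_pt_lim_ext_near (fun t => (fun y => (force c y ^ 2 - 2 * pot c y * slope c y) / force c y ^ 3) (sigma_inv al t c))
                _ s _ _ Hrs).
      - intros t Ht. symmetry. pose proof (Rmin_l r (Rabs s)). pose proof (Rmin_r r (Rabs s)).
        apply H2; [apply H; lra |]. intros ->.
        rewrite Rminus_0_l, Rabs_Ropp in Ht. lra.
      - apply (derivable_pt_lim_comp (fun t => sigma_inv al t c)
                 (fun y => (force c y ^ 2 - 2 * pot c y * slope c y) / force c y ^ 3)); [apply D1, HW |].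
        apply chicone_deriv; [lra | exact Hfn]. }
    rewrite E. apply Rmult_lt_0_compat; [| apply Pos, HW].
    apply Rdiv_lt_0_compat.
    - destruct HW as [Hf HW']. pose proof (N1 s c q (conj Hf HW') Hs).
      apply chicone_pos; [apply (well_c c al) | lra | assumption | apply (force_sign c al) | apply (pot_pos c al)];
      try assumption; lra.
    - replace (force c (sigma_inv al s c) ^ 4) with ((force c (sigma_inv al s c) ^ 2) ^ 2) by ring.
      apply pow_lt, pow2_gt_0, Hfn. }
  intros s c q HW. split; [apply D1, HW |]. split; [apply (Hp2 s c q HW) |].
  split; [apply Pos, HW |]. split; [apply En, HW |]. intros Hs.
  assert (Hseg : forall k, 0 <= k <= 1 -> amp_dom al (k * s) c q).
  { intros k Hk. apply amp_dom_scale; [exact HW |]. rewrite Rabs_pos_eq; lra. }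
  (* Running along [k * s] for [k] from 0 to 1, with the extra factor [s], treats both signs of [s]
     at once. *)
  assert (Hc : forall x, 0 <= x <= 1 -> derivable_pt_lim (fun k => hss (k * s) c q * s) x (h3 (x * s) c q * s * s)).
  { intros x Hx. apply is_derive_Reals. apply (is_derive_ext (fun k => s * hss (k * s) c q)); [intros k; apply Rmult_comm |].
    replace (h3 (x * s) c q * s * s) with (s * (s * h3 (x * s) c q)) by ring.
    apply (is_derive_scal (fun k => hss (k * s) c q)).
    apply (is_derive_comp (fun t => hss t c q) (fun k => k * s)).
    - apply is_derive_Reals, (Hp3 (x * s) c q), Hseg, Hx.
    - auto_derive; [trivial | ring]. }
  pose proof (deriv_pos_incr (fun k => hss (k * s) c q * s) (fun x => h3 (x * s) c q * s * s) 0 1 Rlt_0_1 Hc) as Hi.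
  cbv beta in Hi. rewrite Rmult_0_l, Rmult_1_l in Hi. cut (hss 0 c q * s < hss s c q * s); [intros; lra |].
  apply Hi. intros x Hx. rewrite Rmult_assoc. apply Rmult_lt_0_compat.
  - apply H3; [apply Hseg; lra |]. apply Rmult_integral_contrapositive_currified; lra.
  - apply Rsqr_pos_lt, Hs.
Qed.

(** * The flow in polar coordinates *)

(* [X th rho c] is the time at which the orbit of amplitude [rho] reaches the angle [th]
   in the polar coordinates sigma = rho cos th, y' = - rho sin th. *)
Definition time_map (al : R) (hs : R -> R -> R) (X : R -> R -> R -> R) : Prop :=
  (forall s c, amp_dom al s c 0 -> derivable_pt_lim (fun t => sigma_inv al t c) s (hs s c) /\
     0 < hs s c /\ hs s c * force c (sigma_inv al s c) = s) /\
  (forall rho c, amp_dom al rho c 0 -> X 0 rho c = 0 /\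
     forall th, derivable_pt_lim (fun t => X t rho c) th (hs (rho * cos th) c)) /\
  smooth3 (fun th rho c => amp_dom al rho c 0) X.

Lemma amp_dom_cos al rho c th : amp_dom al rho c 0 -> amp_dom al (rho * cos th) c 0.
Proof.
  intros HW. rewrite Rmult_comm. apply amp_dom_scale; [exact HW |].
  apply Rabs_le. apply COS_bound.
Qed.

Lemma is_RInt_cos_period : is_RInt cos 0 (2 * PI) 0.
Proof.
  assert (E : minus (sin (2 * PI)) (sin 0) = 0).
  { unfold minus, plus, opp; simpl. rewrite sin_2PI, sin_0. ring. }
  assert (H : is_RInt cos 0 (2 * PI) (minus (sin (2 * PI)) (sin 0))); [| rewrite E in H; exact H].
  apply (is_RInt_derive (V := R_CompleteNormedModule) sin cos).
  - intros x _. apply is_derive_Reals, derivable_pt_lim_sin.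
  - intros x _. apply (@ex_derive_continuous R_AbsRing R_NormedModule). auto_derive. trivial.
Qed.

(** As [cos] has integral zero over a period, the constant [k0] may be subtracted from [k]. The
    integrand times [rho] is then nonnegative, and positive on the first quarter turn. *)
Lemma weighted_cos_integral_pos (k : R -> R) (k0 rho l : R) :
  (forall t, continuous k t) ->
  (forall t, rho * cos t <> 0 -> 0 < (k t - k0) * (rho * cos t)) -> rho <> 0 ->
  is_RInt (fun t => k t * cos t) 0 (2 * PI) l -> 0 < l * rho.
Proof.
  intros Hk Hp Hrho Hl. pose proof PI_RGT_0 as HPI.
  set (G := fun t => (k t - k0) * (rho * cos t)).
  assert (HG : is_RInt G 0 (2 * PI) (l * rho)).
  { assert (H := is_RInt_minus _ _ _ _ _ _ (is_RInt_scal _ _ _ rho _ Hl)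
             (is_RInt_scal _ _ _ (k0 * rho) _ is_RInt_cos_period)).
    replace (l * rho) with (minus (scal rho l) (scal (k0 * rho) 0)).
    - apply is_RInt_ext with (2 := H). intros t _.
      assert (E : rho * (k t * cos t) + - (k0 * rho * cos t) = G t) by (unfold G; ring). exact E.
    - unfold minus, plus, opp, scal; simpl. unfold mult; simpl. ring. }
  assert (Hc : forall t, continuous G t).
  { intros t. apply (@continuous_mult).
    - apply (@continuous_minus); [apply Hk | apply continuous_const].
    - apply (@ex_derive_continuous R_AbsRing R_NormedModule). auto_derive. trivial. }
  assert (Hge : forall t, 0 <= G t).
  { intros t. destruct (Req_dec (rho * cos t) 0) as [E | E].
    - unfold G. rewrite E. lra.
    - left. apply Hp, E. }
  assert (Hex : forall x y, ex_RInt G x y).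
  { intros x y. apply (@ex_RInt_continuous R_CompleteNormedModule). intros; apply Hc. }
  rewrite <- (is_RInt_unique _ _ _ _ HG).
  rewrite <- (RInt_Chasles G 0 (PI / 2) (2 * PI)) by apply Hex.
  apply Rplus_lt_le_0_compat.
  - apply RInt_gt_0; [lra | | intros; apply Hc]. intros t Ht. apply Hp.
    apply Rmult_integral_contrapositive_currified; [exact Hrho |].
    apply Rgt_not_eq, cos_gt_0; lra.
  - apply RInt_ge_0; [lra | apply Hex |]. intros; apply Hge.
Qed.

(** Differentiating the period in [rho] under the integral produces h_ss (rho cos t) cos t, a
    weighted cosine integral with [k0] the value of h_ss at the center. The form [0 < l * rho]
    covers negative amplitudes, for which the orbit starts at its minimum. *)
Lemma time_map_exists al : 0 < al < 1 -> exists hs X, time_map al hs X /\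
  forall rho c l, amp_dom al rho c 0 -> rho <> 0 ->
    derivable_pt_lim (fun r => X (2 * PI) r c) rho l -> 0 < l * rho.
Proof.
  intros Hal. destruct (sigma_inv_derivs al Hal) as [hs [hss [Ss [Sss H]]]].
  set (U := fun th rho c : R => amp_dom al rho c 0).
  assert (HU : open3 U) by apply amp_dom_open_rho_c.
  assert (Hrc : smooth3 U (fun t rho _ => rho * cos t)).
  { apply (smooth3_mult _ (fun _ rho _ => rho)); [apply smooth3_2 |].
    apply smooth3_comp_cos, smooth3_1. }
  set (K := fun t rho c => hs (rho * cos t) c 0).
  assert (HK : smooth3 U K).
  { apply (smooth3_comp (amp_dom al) hs U (fun t rho _ => rho * cos t) (fun _ _ c => c) (fun _ _ _ => 0)
             (amp_dom_open al) Ss Hrc (smooth3_3 U) (smooth3_const U 0)).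
    intros t rho c HW. apply amp_dom_cos, HW. }
  set (K2 := fun t rho c => hss (rho * cos t) c 0).
  assert (HK2 : smooth3 U K2).
  { apply (smooth3_comp (amp_dom al) hss U (fun t rho _ => rho * cos t) (fun _ _ c => c) (fun _ _ _ => 0)
             (amp_dom_open al) Sss Hrc (smooth3_3 U) (smooth3_const U 0)).
    intros t rho c HW. apply amp_dom_cos, HW. }
  assert (HK2c : smooth3 U (fun t rho c => K2 t rho c * cos t)).
  { apply (smooth3_mult _ K2); [exact HK2 |]. apply smooth3_comp_cos, smooth3_1. }
  assert (Hstar : star1 U) by (intros t p q s HW _; exact HW).
  exists (fun s c => hs s c 0), (fun th rho c => RInt (fun t => K t rho c) 0 th).
  split; [split; [| split] |].
  - intros s c HW. destruct (H s c 0 HW) as [H1 [_ [H3 [H4 _]]]]. auto.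
  - intros rho c HW. split; [apply (RInt_point (V := R_CompleteNormedModule)) |].
    intros th. apply (RInt_slice_deriv U K th rho c HU Hstar (smooth3_cont _ _ HK)). exact HW.
  - apply (smooth3_RInt U K HU Hstar HK).
  - intros rho c l HW Hrho Hl.
    assert (El : l = RInt (fun t => K2 t rho c * cos t) 0 (2 * PI)).
    { apply (uniqueness_limite _ _ _ _ Hl).
      apply (RInt_param_deriv (fun r t => K t r c) (fun r t => K2 t r c * cos t) (2 * PI) rho
               (fun r t => amp_dom al r c 0)).
      - intros u s _ ->. destruct (amp_dom_open al rho c 0 HW) as [r [Hr HrW]].
        exists r. split; [exact Hr |]. intros u' _ Hu _. apply HrW; auto using Rabs_minus_diag.
      - intros u s Hu. apply (derivable_pt_lim_comp (fun v => v * cos s) (fun v => hs v c 0)).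
        + apply is_derive_Reals. auto_derive; [trivial | ring].
        + apply (H (u * cos s) c 0), amp_dom_cos, Hu.
      - intros u s Hu. apply (cont3_continuous_1 U K s u c (smooth3_cont _ _ HK)), Hu.
      - intros u s Hu eps He. destruct (smooth3_cont _ _ HK2c s u c Hu eps He) as [d [Hd E]].
        exists d. split; [exact Hd |]. intros u' s' Hu' Hs'. apply E; auto using Rabs_minus_diag. }
    apply (weighted_cos_integral_pos (fun t => K2 t rho c) (hss 0 c 0) rho l).
    + intros t. apply (cont3_continuous_1 U K2 t rho c (smooth3_cont _ _ HK2)), HW.
    + intros t Ht. apply (H (rho * cos t) c 0); [apply amp_dom_cos, HW | exact Ht].
    + exact Hrho.
    + rewrite El. apply (@RInt_correct R_CompleteNormedModule).
      apply (ex_RInt_slice U (fun t rho c => K2 t rho c * cos t) rho c).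
      * apply smooth3_cont, HK2c.
      * intros s _. exact HW.
Qed.

(** * Inverting the time map: angle and orbit as functions of time *)

Lemma deriv_0_const (f : R -> R) : (forall x, derivable_pt_lim f x 0) -> forall x y, f x = f y.
Proof.
  intros H x y. destruct (MVT_between f (fun _ => 0) x y) as [z [_ E]]; [intros; apply H | lra].
Qed.

Definition angle (X : R -> R -> R -> R) (rho c x : R) : R :=
  epsilon (inhabits 0) (fun th => X th rho c = x).

Definition orbit (al : R) (X : R -> R -> R -> R) (rho c x : R) : R :=
  sigma_inv al (rho * cos (angle X rho c x)) c.

Lemma time_map_incr al hs X rho c x y : time_map al hs X -> amp_dom al rho c 0 -> x < y ->
  X x rho c < X y rho c.
Proof.
  intros [H1 [H2 _]] HW Hxy. destruct (H2 rho c HW) as [_ HD].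
  apply (deriv_pos_incr (fun t => X t rho c) (fun t => hs (rho * cos t) c) x y Hxy).
  - intros z _. apply HD.
  - intros z _. apply H1, amp_dom_cos, HW.
Qed.

Lemma time_map_inj al hs X rho c x y : time_map al hs X -> amp_dom al rho c 0 ->
  X x rho c = X y rho c -> x = y.
Proof.
  intros HX HW E. destruct (Rtotal_order x y) as [H | [H | H]]; [| exact H |];
  pose proof (time_map_incr al hs X rho c _ _ HX HW H); lra.
Qed.

(** The integrand is 2 PI periodic in the angle, so both sides have the same derivative; at angle 0
    they agree. *)
Lemma time_map_shift al hs X rho c th : time_map al hs X -> amp_dom al rho c 0 ->
  X (th + 2 * PI) rho c = X th rho c + X (2 * PI) rho c.
Proof.
  intros [H1 [H2 _]] HW. destruct (H2 rho c HW) as [H0 HD].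
  pose proof (deriv_0_const (fun t => X (t + 2 * PI) rho c - X t rho c)) as H.
  assert (E : X (th + 2 * PI) rho c - X th rho c = X (0 + 2 * PI) rho c - X 0 rho c).
  { apply H. intros t. replace 0 with (hs (rho * cos (t + 2 * PI)) c * 1 - hs (rho * cos t) c).
    - apply (derivable_pt_lim_minus (fun t => X (t + 2 * PI) rho c) (fun t => X t rho c)); [| apply HD].
      apply (derivable_pt_lim_comp (fun t => t + 2 * PI) (fun t => X t rho c)); [| apply HD].
      apply is_derive_Reals. auto_derive; [trivial | ring].
    - replace (cos (t + 2 * PI)) with (cos t) by (rewrite cos_plus, cos_2PI, sin_2PI; ring). ring. }
  rewrite Rplus_0_l in E. lra.
Qed.

Lemma time_map_odd al hs X rho c th : time_map al hs X -> amp_dom al rho c 0 ->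
  X (- th) rho c = - X th rho c.
Proof.
  intros [H1 [H2 _]] HW. destruct (H2 rho c HW) as [H0 HD].
  pose proof (deriv_0_const (fun t => X (- t) rho c + X t rho c)) as H.
  assert (E : X (- th) rho c + X th rho c = X (- 0) rho c + X 0 rho c).
  { apply H. intros t. replace 0 with (hs (rho * cos (- t)) c * (-1) + hs (rho * cos t) c).
    - apply (derivable_pt_lim_plus (fun t => X (- t) rho c) (fun t => X t rho c)); [| apply HD].
      apply (derivable_pt_lim_comp (fun t => - t) (fun t => X t rho c)); [| apply HD].
      apply is_derive_Reals. auto_derive; [trivial | ring].
    - rewrite cos_neg. ring. }
  rewrite Ropp_0 in E. lra.
Qed.

Lemma time_map_period_pos al hs X rho c : time_map al hs X -> amp_dom al rho c 0 -> 0 < X (2 * PI) rho c.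
Proof.
  intros HX HW. pose proof PI_RGT_0. rewrite <- (proj1 (proj1 (proj2 HX) rho c HW)).
  apply (time_map_incr al hs X rho c 0 (2 * PI) HX HW). lra.
Qed.

Lemma time_map_multiple al hs X rho c n : time_map al hs X -> amp_dom al rho c 0 ->
  X (INR n * (2 * PI)) rho c = INR n * X (2 * PI) rho c.
Proof.
  intros HX HW. induction n as [|n IH].
  - simpl. rewrite !Rmult_0_l. apply (proj1 (proj2 HX) rho c HW).
  - rewrite S_INR. replace ((INR n + 1) * (2 * PI)) with (INR n * (2 * PI) + 2 * PI) by ring.
    rewrite (time_map_shift al hs X rho c _ HX HW), IH. ring.
Qed.

Lemma angle_spec al hs X rho c x : time_map al hs X -> amp_dom al rho c 0 ->
  X (angle X rho c x) rho c = x.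
Proof.
  intros HX HW. apply (epsilon_spec (inhabits 0) (fun th => X th rho c = x)).
  pose proof (time_map_period_pos al hs X rho c HX HW) as HL. set (L := X (2 * PI) rho c) in *.
  (* After [n] turns in either direction the elapsed time exceeds [Rabs x] in absolute value, which
     brackets the angle. *)
  destruct (INR_unbounded (Rabs x / L)) as [n Hn].
  assert (Hx : Rabs x < INR n * L).
  { apply (Rmult_lt_compat_r L) in Hn; [| exact HL].
    replace (Rabs x / L * L) with (Rabs x) in Hn by (field; lra). exact Hn. }
  pose proof (time_map_multiple al hs X rho c n HX HW) as Em. fold L in Em.
  pose proof (time_map_odd al hs X rho c (INR n * (2 * PI)) HX HW) as Eo. rewrite Em in Eo.
  set (T := INR n * (2 * PI)) in *.
  assert (HT : 0 < T).
  { unfold T. pose proof PI_RGT_0. pose proof (Rabs_pos x). assert (0 < INR n) by nra.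
    apply Rmult_lt_0_compat; lra. }
  apply Rabs_def2 in Hx.
  destruct (IVT_interv (fun th => X th rho c - x) (- T) T) as [th [_ E]].
  - intros th _. apply derivable_continuous_pt. apply ex_derive_Reals_0.
    exists (hs (rho * cos th) c). apply is_derive_Reals.
    replace (hs (rho * cos th) c) with (hs (rho * cos th) c - 0) by ring.
    apply (derivable_pt_lim_minus (fun th => X th rho c) (fun _ => x)); [| apply derivable_pt_lim_const].
    apply (proj1 (proj2 HX) rho c HW).
  - lra.
  - lra.
  - lra.
  - exists th. lra.
Qed.

Lemma angle_unique al hs X rho c x th : time_map al hs X -> amp_dom al rho c 0 ->
  X th rho c = x -> angle X rho c x = th.
Proof.
  intros HX HW E. apply (time_map_inj al hs X rho c _ _ HX HW).
  rewrite (angle_spec al hs X rho c x HX HW). symmetry. exact E.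
Qed.

(** The amplitude is already a function of [c], so the angle is implicit in the two parameters [x]
    and [c] only. The derivative of the time map in the angle is h_s, which is positive. *)
Lemma angle_smooth al hs X (rho : R -> R) (I : R -> Prop) :
  time_map al hs X ->
  open3 (fun _ c _ => I c) -> smooth3 (fun _ c _ => I c) (fun _ c _ => rho c) ->
  (forall c, I c -> amp_dom al (rho c) c 0) ->
  smooth3 (fun x c _ => I c) (fun x c _ => angle X (rho c) c x).
Proof.
  intros HX HI Hrho HIW.
  apply (smooth3_implicit (fun x c => I c) (fun x c th => I c) (fun x c th => X th (rho c) c - x)
           (fun x c => angle X (rho c) c x)).
  - intros x c Hc. destruct (HI x c 0 Hc) as [r [Hr H]]. exists r. split; [exact Hr |].
    intros x' c' Hx Hc'. apply (H x' c' 0); auto using Rabs_minus_diag.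
  - exact HI.
  - intros; assumption.
  - apply (smooth3_minus _ (fun x c th => X th (rho c) c)); [| apply smooth3_1].
    apply (smooth3_comp (fun th rho c => amp_dom al rho c 0) X _ (fun _ _ th => th) (fun _ c _ => rho c) (fun _ c _ => c)).
    + apply amp_dom_open_rho_c.
    + apply (proj2 (proj2 HX)).
    + apply smooth3_3.
    + exact Hrho.
    + apply smooth3_2.
    + intros x c th Hc. apply HIW, Hc.
  - intros x c th l Hc Hl.
    assert (E : l = hs (rho c * cos th) c - 0).
    { apply (uniqueness_limite _ _ _ _ Hl).
      apply (derivable_pt_lim_minus (fun th => X th (rho c) c) (fun _ => x)); [| apply derivable_pt_lim_const].
      apply (proj1 (proj2 HX) (rho c) c (HIW c Hc)). }
    rewrite E, Rminus_0_r. apply (proj1 HX), amp_dom_cos, HIW, Hc.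
  - intros x c Hc. split; [exact Hc |]. rewrite (angle_spec al hs X (rho c) c x HX (HIW c Hc)). ring.
Qed.

Lemma angle_deriv al hs X rho c x : time_map al hs X -> amp_dom al rho c 0 ->
  derivable_pt_lim (angle X rho c) x (/ hs (rho * cos (angle X rho c x)) c).
Proof.
  intros HX HW. destruct (proj1 (proj2 HX) rho c HW) as [H0 HD].
  assert (HO : open3 (fun _ c _ => amp_dom al rho c 0)).
  { intros x' c' q' HW'. destruct (amp_dom_open al rho c' 0 HW') as [r [Hr HrW]].
    exists r. split; [exact Hr |]. intros _ c'' _ _ Hc _. apply HrW; auto using Rabs_minus_diag. }
  pose proof (angle_smooth al hs X (fun _ => rho) (fun c => amp_dom al rho c 0) HX HO
                (smooth3_const _ rho) (fun c HW => HW)) as HS.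
  destruct (smooth3_partials _ _ HO HS) as [a1 [a2 [a3 [Hp _]]]].
  destruct (Hp x c 0 HW) as [Ha _].
  assert (Hpos : 0 < hs (rho * cos (angle X rho c x)) c) by (apply (proj1 HX), amp_dom_cos, HW).
  assert (E : hs (rho * cos (angle X rho c x)) c * a1 x c 0 = 1).
  { apply (uniqueness_limite (fun x => X (angle X rho c x) rho c) x).
    - apply (derivable_pt_lim_comp (angle X rho c) (fun t => X t rho c)); [exact Ha | apply HD].
    - apply (derivable_pt_lim_ext_near (fun t => t) _ x 1 1); [lra | | apply derivable_pt_lim_id].
      intros t _. symmetry. apply (angle_spec al hs); assumption. }
  replace (/ hs (rho * cos (angle X rho c x)) c) with (a1 x c 0); [exact Ha |].
  apply (Rmult_eq_reg_l (hs (rho * cos (angle X rho c x)) c)); [| lra]. rewrite E. field. lra.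
Qed.

Lemma orbit_0 al hs X rho c : time_map al hs X -> amp_dom al rho c 0 ->
  orbit al X rho c 0 = sigma_inv al rho c.
Proof.
  intros HX HW. unfold orbit. rewrite (angle_unique al hs X rho c 0 0 HX HW).
  - rewrite cos_0, Rmult_1_r. reflexivity.
  - apply (proj1 (proj2 HX) rho c HW).
Qed.

Lemma orbit_gt al X rho c x : 0 < al < 1 -> amp_dom al rho c 0 -> al < orbit al X rho c x.
Proof. intros Hal HW. apply (sigma_inv_spec al _ c 0 Hal), amp_dom_cos, HW. Qed.

Lemma orbit_deriv al hs X rho c x : time_map al hs X -> amp_dom al rho c 0 ->
  derivable_pt_lim (orbit al X rho c) x (- rho * sin (angle X rho c x)).
Proof.
  intros HX HW. destruct (proj1 HX _ c (amp_dom_cos al rho c (angle X rho c x) HW)) as [H1 [H2 _]].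
  replace (- rho * sin (angle X rho c x)) with
    (hs (rho * cos (angle X rho c x)) c *
      ((rho * - sin (angle X rho c x)) * / hs (rho * cos (angle X rho c x)) c)) by (field; lra).
  apply (derivable_pt_lim_comp (fun x => rho * cos (angle X rho c x)) (fun s => sigma_inv al s c)); [| exact H1].
  apply (derivable_pt_lim_comp (angle X rho c) (fun t => rho * cos t)).
  - apply (angle_deriv al hs); assumption.
  - apply (derivable_pt_lim_scal cos), derivable_pt_lim_cos.
Qed.

(** By h_s force = rho cos th, dividing rho cos th by h_s returns [force] at the orbit: this is
    where the polar flow becomes the differential equation. *)
Lemma orbit_deriv2 al hs X rho c x : time_map al hs X -> amp_dom al rho c 0 ->
  derivable_pt_lim (fun x => - rho * sin (angle X rho c x)) x (- force c (orbit al X rho c x)).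
Proof.
  intros HX HW. destruct (proj1 HX _ c (amp_dom_cos al rho c (angle X rho c x) HW)) as [_ [H2 H3]].
  fold (orbit al X rho c x) in H3.
  replace (- force c (orbit al X rho c x)) with
    ((- rho * cos (angle X rho c x)) * / hs (rho * cos (angle X rho c x)) c).
  - apply (derivable_pt_lim_comp (angle X rho c) (fun t => - rho * sin t)).
    + apply (angle_deriv al hs); assumption.
    + apply (derivable_pt_lim_scal sin), derivable_pt_lim_sin.
  - rewrite Ropp_mult_distr_l_reverse. rewrite <- H3 at 1. field. lra.
Qed.

Lemma orbit_even al hs X rho c : time_map al hs X -> amp_dom al rho c 0 -> is_even (orbit al X rho c).
Proof.
  intros HX HW x. unfold orbit. rewrite (angle_unique al hs X rho c (- x) (- angle X rho c x) HX HW).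
  - rewrite cos_neg. reflexivity.
  - rewrite (time_map_odd al hs X rho c _ HX HW), (angle_spec al hs X rho c x HX HW). reflexivity.
Qed.

Lemma orbit_periodic al hs X rho c : time_map al hs X -> amp_dom al rho c 0 ->
  is_periodic (X (2 * PI) rho c) (orbit al X rho c).
Proof.
  intros HX HW x. unfold orbit.
  rewrite (angle_unique al hs X rho c (x + X (2 * PI) rho c) (angle X rho c x + 2 * PI) HX HW).
  - rewrite cos_plus, cos_2PI, sin_2PI, Rmult_1_r, Rmult_0_r, Rminus_0_r. reflexivity.
  - rewrite (time_map_shift al hs X rho c _ HX HW), (angle_spec al hs X rho c x HX HW). reflexivity.
Qed.

(** A return to the initial value needs [cos th = 1], impossible strictly between 0 and 2 PI. *)
Lemma orbit_min_period al hs X rho c T : 0 < al < 1 -> time_map al hs X -> amp_dom al rho c 0 ->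
  rho <> 0 -> 0 < T < X (2 * PI) rho c -> orbit al X rho c T <> orbit al X rho c 0.
Proof.
  intros Hal HX HW Hrho HT E. rewrite (orbit_0 al hs X rho c HX HW) in E.
  assert (Es : rho * cos (angle X rho c T) = rho).
  { pose proof (proj2 (sigma_inv_spec al _ c 0 Hal (amp_dom_cos al rho c (angle X rho c T) HW))) as E1.
    fold (orbit al X rho c T) in E1. rewrite <- E1, E. apply (sigma_inv_spec al rho c 0 Hal HW). }
  assert (Ec : cos (angle X rho c T) = 1) by (apply (Rmult_eq_reg_l rho); lra).
  set (th := angle X rho c T) in *.
  assert (Eth : X th rho c = T) by apply (angle_spec al hs X rho c T HX HW).
  assert (H0 : X 0 rho c = 0) by apply (proj1 (proj2 HX) rho c HW).
  assert (Hth : 0 < th < 2 * PI).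
  { split; apply Rnot_le_lt; intros [Hle | Hle].
    - pose proof (time_map_incr al hs X rho c _ _ HX HW Hle). lra.
    - rewrite Hle in Eth. lra.
    - pose proof (time_map_incr al hs X rho c _ _ HX HW Hle). lra.
    - rewrite <- Hle in Eth. lra. }
  replace th with (2 * (th / 2)) in Ec by field. rewrite cos_2a_sin in Ec.
  pose proof (sin_gt_0 (th / 2) ltac:(lra) ltac:(lra)). nra.
Qed.

(** * Periodic solutions of the normalized equation *)

(** Multiplied by exp (-C t), [D] does not increase to the right of [t0]; multiplied by exp (C t),
    it does not decrease to the left. *)
Lemma gronwall_zero (D D' : R -> R) (C t0 : R) :
  (forall t, derivable_pt_lim D t (D' t)) -> (forall t, 0 <= D t) ->
  (forall t, Rabs (D' t) <= C * D t) -> D t0 = 0 -> forall t, D t = 0.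
Proof.
  intros HD Hpos HC H0 t. apply Rle_antisym; [| apply Hpos].
  assert (G : forall k s, derivable_pt_lim (fun s => D s * exp (k * s)) s ((D' s + k * D s) * exp (k * s))).
  { intros k s. replace ((D' s + k * D s) * exp (k * s)) with (D' s * exp (k * s) + D s * (exp (k * s) * k)) by ring.
    apply (derivable_pt_lim_mult D (fun s => exp (k * s))); [apply HD |].
    apply (derivable_pt_lim_comp (fun s => k * s) exp); [| apply derivable_pt_lim_exp].
    apply is_derive_Reals. auto_derive; [trivial | ring]. }
  destruct (Rtotal_order t0 t) as [Hlt | [<- | Hgt]]; [| lra |].
  - destruct (MVT_cor2 _ _ t0 t Hlt (fun s _ => G (- C) s)) as [s [E _]].
    rewrite H0 in E. pose proof (exp_pos (- C * s)). pose proof (exp_pos (- C * t)).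
    pose proof (Rle_trans _ _ _ (Rle_abs _) (HC s)).
    assert ((D' s + - C * D s) * exp (- C * s) <= 0) by nra.
    assert (D t * exp (- C * t) <= 0) by nra. nra.
  - destruct (MVT_cor2 _ _ t t0 Hgt (fun s _ => G C s)) as [s [E _]].
    rewrite H0 in E. pose proof (exp_pos (C * s)). pose proof (exp_pos (C * t)).
    pose proof (HC s) as Hs. apply Rabs_le_between in Hs.
    assert (0 <= (D' s + C * D s) * exp (C * s)) by nra.
    assert (D t * exp (C * t) <= 0) by nra. nra.
Qed.

(** [slope c] is increasing, so its absolute value on the interval is bounded by the values at the
    two ends. *)
Lemma force_lipschitz c lo hi : 0 < lo -> exists K, 0 <= K /\ forall a b, lo <= a <= hi -> lo <= b <= hi ->
  Rabs (force c b - force c a) <= K * Rabs (b - a).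
Proof.
  intros Hlo. exists (Rabs (slope c lo) + Rabs (slope c hi)).
  pose proof (Rabs_pos (slope c lo)). pose proof (Rabs_pos (slope c hi)).
  split; [lra |]. intros a b Ha Hb.
  assert (Hb' : forall x, Rmin a b <= x <= Rmax a b -> lo <= x <= hi).
  { intros x Hx. unfold Rmin, Rmax in Hx. destruct (Rle_dec a b); lra. }
  destruct (MVT_between (force c) (slope c) a b) as [x [Hx E]].
  { intros x Hx. apply force_deriv. apply Hb' in Hx. lra. }
  apply Hb' in Hx. rewrite E, Rabs_mult. apply Rmult_le_compat_r; [apply Rabs_pos |].
  assert (slope c lo <= slope c x) by (unfold slope; pose proof (ln_le lo x Hlo ltac:(lra)); lra).
  assert (slope c x <= slope c hi) by (unfold slope; pose proof (ln_le x hi ltac:(lra) ltac:(lra)); lra).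
  pose proof (Rle_abs (slope c hi)). pose proof (Rle_abs (- slope c lo)) as Hn. rewrite Rabs_Ropp in Hn.
  apply Rabs_le. lra.
Qed.

Definition oscillates (c : R) (y y1 : R -> R) : Prop :=
  forall x, derivable_pt_lim y x (y1 x) /\ derivable_pt_lim y1 x (- force c (y x)).

(** Gronwall applied to the squared distance [D] in the phase plane. Confinement to a compact
    interval of positive values makes [force] Lipschitz there, and the mixed products are absorbed
    by 2 u v <= u^2 + v^2, whence the constant [1 + K]. *)
Lemma oscillates_unique c y y1 z z1 lo hi t0 : oscillates c y y1 -> oscillates c z z1 -> 0 < lo ->
  (forall x, lo <= y x <= hi) -> (forall x, lo <= z x <= hi) -> y t0 = z t0 -> y1 t0 = z1 t0 ->
  forall x, y x = z x.
Proof.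
  intros Hy Hz Hlo By Bz E0 E1 x. destruct (force_lipschitz c lo hi Hlo) as [K [HK Lip]].
  set (D := fun t => (y t - z t) * (y t - z t) + (y1 t - z1 t) * (y1 t - z1 t)).
  set (D' := fun t => ((y1 t - z1 t) * (y t - z t) + (y t - z t) * (y1 t - z1 t)) +
    ((- force c (y t) - - force c (z t)) * (y1 t - z1 t) + (y1 t - z1 t) * (- force c (y t) - - force c (z t)))).
  assert (HD : D x = 0).
  { apply (gronwall_zero D D' (1 + K) t0).
    - intros t. destruct (Hy t) as [Y1 Y2]. destruct (Hz t) as [Z1 Z2].
      pose proof (derivable_pt_lim_minus _ _ _ _ _ Y1 Z1) as M1.
      pose proof (derivable_pt_lim_minus _ _ _ _ _ Y2 Z2) as M2.
      exact (derivable_pt_lim_plus _ _ _ _ _ (derivable_pt_lim_mult _ _ _ _ _ M1 M1)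
               (derivable_pt_lim_mult _ _ _ _ _ M2 M2)).
    - intros t. unfold D. apply Rplus_le_le_0_compat; apply Rle_0_sqr.
    - intros t. unfold D', D. pose proof (Lip (z t) (y t) (Bz t) (By t)) as L.
      set (u := y t - z t) in *. set (v := y1 t - z1 t). set (k := force c (y t) - force c (z t)) in *.
      replace (v * u + u * v + ((- force c (y t) - - force c (z t)) * v + v * (- force c (y t) - - force c (z t))))
        with (2 * (u * v) + - (2 * (k * v))) by (unfold k; ring).
      eapply Rle_trans; [apply Rabs_triang |]. rewrite Rabs_Ropp, !Rabs_mult.
      rewrite (Rabs_pos_eq 2) by lra.
      pose proof (Rabs_pos u). pose proof (Rabs_pos v). pose proof (Rabs_pos k).
      assert (Eu : u * u = Rabs u * Rabs u) by (rewrite <- Rabs_mult, Rabs_pos_eq; [ring | nra]).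
      assert (Ev : v * v = Rabs v * Rabs v) by (rewrite <- Rabs_mult, Rabs_pos_eq; [ring | nra]).
      rewrite Eu, Ev.
      assert (Rabs k * Rabs v <= K * Rabs u * Rabs v) by (apply Rmult_le_compat_r; assumption).
      assert (2 * (Rabs u * Rabs v) <= Rabs u * Rabs u + Rabs v * Rabs v).
      { pose proof (Rle_0_sqr (Rabs u - Rabs v)) as Hs. unfold Rsqr in Hs. lra. }
      assert (K * (2 * (Rabs u * Rabs v)) <= K * (Rabs u * Rabs u + Rabs v * Rabs v))
        by (apply Rmult_le_compat_l; assumption).
      lra.
    - unfold D. rewrite E0, E1. ring. }
  unfold D in HD. pose proof (Rle_0_sqr (y x - z x)) as S1. pose proof (Rle_0_sqr (y1 x - z1 x)) as S2.
  apply Rminus_diag_uniq, Rsqr_0_uniq. unfold Rsqr in *. lra.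
Qed.

Lemma oscillates_energy c y y1 : oscillates c y y1 -> (forall x, 0 < y x) ->
  forall s t, / 2 * (y1 s * y1 s) + pot c (y s) = / 2 * (y1 t * y1 t) + pot c (y t).
Proof.
  intros H Hp. apply (deriv_0_const (fun t => / 2 * (y1 t * y1 t) + pot c (y t))).
  intros x. destruct (H x) as [H1 H2].
  replace 0 with (/ 2 * (- force c (y x) * y1 x + y1 x * - force c (y x)) + force c (y x) * y1 x) by field.
  apply (derivable_pt_lim_plus (fun t => / 2 * (y1 t * y1 t)) (fun t => pot c (y t))).
  - apply (derivable_pt_lim_scal (fun t => y1 t * y1 t)), (derivable_pt_lim_mult y1 y1); exact H2.
  - apply (derivable_pt_lim_comp y (pot c)); [exact H1 | apply pot_deriv, Hp].
Qed.

Lemma periodic_INR L f : is_periodic L f -> forall n x, f (x + INR n * L) = f x.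
Proof.
  intros H n. induction n as [|n IH]; intros x.
  - simpl. rewrite Rmult_0_l, Rplus_0_r. reflexivity.
  - rewrite S_INR. replace (x + (INR n + 1) * L) with ((x + INR n * L) + L) by ring. rewrite H. apply IH.
Qed.

Lemma periodic_reduce L f x : 0 < L -> is_periodic L f -> exists x', 0 <= x' <= L /\ f x' = f x.
Proof.
  intros HL H. destruct (INR_unbounded (Rabs x / L)) as [m Hm].
  assert (Hx : Rabs x < INR m * L).
  { apply (Rmult_lt_compat_r L) in Hm; [| exact HL].
    replace (Rabs x / L * L) with (Rabs x) in Hm by (field; lra). exact Hm. }
  apply Rabs_def2 in Hx.
  (* The shift by [m] periods makes the argument nonnegative, as a natural floor requires. *)
  destruct (nfloor_ex ((x + INR m * L) / L)) as [n [Hn1 Hn2]].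
  { apply Rdiv_le_0_compat; lra. }
  apply (Rmult_le_compat_r L) in Hn1; [| lra]. apply (Rmult_lt_compat_r L) in Hn2; [| lra].
  replace ((x + INR m * L) / L * L) with (x + INR m * L) in Hn1, Hn2 by (field; lra).
  exists (x + INR m * L - INR n * L). split; [lra |].
  rewrite <- (periodic_INR L f H n). replace (x + INR m * L - INR n * L + INR n * L) with (x + INR m * L) by ring.
  apply periodic_INR, H.
Qed.

Lemma periodic_bounds L f f1 : 0 < L -> is_periodic L f -> (forall x, derivable_pt_lim f x (f1 x)) ->
  exists m hi, (forall x, f m <= f x) /\ (forall x, f x <= hi).
Proof.
  intros HL HP HD.
  assert (Hc : forall x, 0 <= x <= L -> continuity_pt f x).
  { intros x _. apply derivable_continuous_pt, ex_derive_Reals_0. exists (f1 x). apply is_derive_Reals, HD. }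
  destruct (continuity_ab_min f 0 L ltac:(lra) Hc) as [m [Hm _]].
  destruct (continuity_ab_maj f 0 L ltac:(lra) Hc) as [M [HM _]].
  exists m, (f M). split; intros x; destruct (periodic_reduce L f x HL HP) as [x' [Hx' <-]]; auto.
Qed.

Lemma min_deriv_0 f m l : derivable_pt_lim f m l -> (forall x, f m <= f x) -> l = 0.
Proof.
  intros Hl Hm. pose (pr := exist (fun l => derivable_pt_abs f m l) l Hl : derivable_pt f m).
  apply (deriv_minimum f (m - 1) (m + 1) m pr); [lra | lra | intros; apply Hm].
Qed.

Lemma min_deriv2_ge0 f f1 m l : (forall x, derivable_pt_lim f x (f1 x)) -> derivable_pt_lim f1 m l ->
  (forall x, f m <= f x) -> 0 <= l.
Proof.
  intros H1 H2 Hm. apply Rnot_lt_le. intros Hl.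
  pose proof (min_deriv_0 f m _ (H1 m) Hm) as H0.
  destruct (derivable_pt_lim_linear_bound f1 m l H2 (- l / 2)) as [d [Hd B]]; [lra |].
  destruct (MVT_cor2 f f1 m (m + d / 2)) as [x [E Hx]]; [lra | intros; apply H1 |].
  assert (Hh : Rabs (x - m) < d) by (rewrite Rabs_pos_eq; lra).
  specialize (B (x - m) Hh). replace (m + (x - m)) with x in B by ring.
  rewrite H0, (Rabs_pos_eq (x - m)) in B by lra. apply Rabs_le_between in B.
  assert (f1 x < 0) by nra. pose proof (Hm (m + d / 2)). nra.
Qed.

Lemma force_pos c y : 0 < 2 + c -> 1 < y -> 0 < force c y.
Proof.
  intros Hc Hy. rewrite <- (force_1 c). apply (deriv_pos_incr (force c) (slope c) 1 y Hy).
  - intros x Hx. apply force_deriv. lra.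
  - intros x Hx. pose proof (slope_incr c 1 x ltac:(lra)). rewrite slope_1 in *. lra.
Qed.

Lemma pot_decr c al x y : 0 < al < 1 -> force c al < 0 -> al <= x -> x < y -> y <= 1 -> pot c y < pot c x.
Proof.
  intros Hal Hf Hx Hxy Hy. cut (- pot c x < - pot c y); [intros; lra |].
  apply (deriv_pos_incr (fun t => - pot c t) (fun t => - force c t) x y Hxy).
  - intros t Ht. apply (derivable_pt_lim_opp (pot c)), pot_deriv. lra.
  - intros t Ht. pose proof (force_sign c al t Hal Hf ltac:(lra) ltac:(lra)). nra.
Qed.

(** At a minimum the velocity is 0 and [force <= 0]; equality would make the solution constant by
    uniqueness. So [force] is negative there, hence also at some [al] strictly below. By energy,
    [pot] at [y 0] equals [pot] at the minimum: less than at [al], so the amplitude is admissible,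
    and positive, so the amplitude is not 0. *)
Lemma periodic_oscillation_in_well c L y y1 : 0 < 2 + c -> oscillates c y y1 -> 0 < L -> is_periodic L y ->
  (forall x, 0 < y x) -> (exists x x', y x <> y x') -> y1 0 = 0 ->
  exists al hi, 0 < al < 1 /\ (forall x, al <= y x <= hi) /\
    amp_dom al (sigma c (y 0)) c 0 /\ sigma c (y 0) <> 0 /\ sigma_inv al (sigma c (y 0)) c = y 0.
Proof.
  intros Hc Ho HL HP Hpos [xa [xb Hn]] H0.
  destruct (periodic_bounds L y y1 HL HP (fun x => proj1 (Ho x))) as [m [hi [Hm Hhi]]].
  pose proof (min_deriv_0 y m _ (proj1 (Ho m)) Hm) as Hm1.
  pose proof (min_deriv2_ge0 y y1 m _ (fun x => proj1 (Ho x)) (proj2 (Ho m)) Hm) as Hm2.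
  assert (Hf : force c (y m) < 0).
  { destruct (Req_dec (force c (y m)) 0) as [E | E]; [| lra]. exfalso. apply Hn.
    assert (Hconst : forall x, y x = (fun _ => y m) x).
    { apply (oscillates_unique c y y1 (fun _ => y m) (fun _ => 0) (y m) hi m);
        [exact Ho | | apply Hpos | auto | | reflexivity | exact Hm1].
      - intros x. split; [apply derivable_pt_lim_const |]. rewrite E, Ropp_0. apply derivable_pt_lim_const.
      - intros _. split; [apply Rle_refl | apply Hhi]. }
    rewrite (Hconst xa), (Hconst xb). reflexivity. }
  assert (Hy1 : y m < 1).
  { apply Rnot_le_lt. intros [H | H].
    - pose proof (force_pos c (y m) Hc H). lra.
    - rewrite <- H, force_1 in Hf. lra. }
  destruct (derivable_pt_lim_linear_bound (force c) (y m) _ (force_deriv c (y m) (Hpos m)) 1 Rlt_0_1)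
    as [d [Hd B]].
  pose proof (Hpos m) as Hpm. set (S := slope c (y m)) in *. pose proof (Rabs_pos S).
  assert (Hal : exists al, 0 < al < y m /\ force c al < 0).
  (* With a step of at most [k], the change of [force] is at most half of its absolute value at the
     minimum, so the sign is kept. *)
  { set (k := - force c (y m) / (2 * (Rabs S + 1))).
    assert (Hk : 0 < k) by (apply Rdiv_lt_0_compat; lra).
    assert (Ek : (Rabs S + 1) * k = - force c (y m) / 2) by (unfold k; field; lra).
    set (e := Rmin k (Rmin (d / 2) (y m / 2))).
    assert (He : 0 < e) by (repeat apply Rmin_pos; lra).
    assert (He1 : e <= k) by apply Rmin_l.
    pose proof (Rmin_r k (Rmin (d / 2) (y m / 2))). pose proof (Rmin_l (d / 2) (y m / 2)).
    pose proof (Rmin_r (d / 2) (y m / 2)). fold e in H1.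
    exists (y m - e). split; [lra |].
    specialize (B (- e)). rewrite Rabs_Ropp, (Rabs_pos_eq e) in B by lra. specialize (B ltac:(lra)).
    apply Rabs_le_between in B. replace (y m + - e) with (y m - e) in B by ring.
    pose proof (Rle_abs (- S)) as Ha. rewrite Rabs_Ropp in Ha.
    assert (- S * e <= Rabs S * e) by (apply Rmult_le_compat_r; lra).
    assert ((Rabs S + 1) * e <= (Rabs S + 1) * k) by (apply Rmult_le_compat_l; lra).
    lra. }
  destruct Hal as [al [Hal Hfal]]. assert (Hal1 : 0 < al < 1) by lra.
  exists al, hi. split; [exact Hal1 |]. split; [intros x; pose proof (Hm x); pose proof (Hhi x); lra |].
  pose proof (oscillates_energy c y y1 Ho Hpos 0 m) as HE. rewrite H0, Hm1 in HE.
  pose proof (Hm 0) as Hm0.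
  assert (Es : sigma c (y 0) ^ 2 = 2 * pot c (y 0)).
  { apply sigma_sqr; [apply Hpos |]. left. apply (rem2_c_pos c al); [assumption | assumption | lra]. }
  assert (HW : amp_dom al (sigma c (y 0)) c 0).
  { split; [exact Hfal |]. rewrite Es.
    pose proof (pot_decr c al al (y m) Hal1 Hfal ltac:(lra) ltac:(lra) ltac:(lra)). lra. }
  split; [exact HW |]. split.
  - intros E. rewrite E in Es. pose proof (pot_pos c al (y m) Hal1 Hfal ltac:(lra) ltac:(lra)). lra.
  - apply (sigma_inv_unique al _ c 0); [exact Hal1 | exact HW | lra | reflexivity].
Qed.

(** * The center of the well as a function of the parameters *)

Definition center (w A : R) : R := epsilon (inhabits 0) (fun r => exp (w / 2 - 1) < r /\ g w A r = 0).

Lemma g_pos w A r : 0 < r -> g w A r = w * r - r * (2 * ln r) + A.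
Proof. intros Hr. unfold g. rewrite ln_pow by exact Hr. simpl. ring. Qed.

(** On positive arguments [g w A] has its maximum at [exp (w / 2 - 1)], with value
    [2 * exp (w / 2 - 1) + A], and decreases to minus infinity beyond. The hypothesis says that this
    maximum is positive. *)
Lemma center_spec w A : 0 < 2 * exp (w / 2 - 1) + A -> exp (w / 2 - 1) < center w A /\ g w A (center w A) = 0.
Proof.
  intros H. apply (epsilon_spec (inhabits 0) (fun r => exp (w / 2 - 1) < r /\ g w A r = 0)).
  set (p := exp (w / 2 - 1)) in *. assert (Hp : 0 < p) by apply exp_pos.
  (* At [b = exp ((w + t) / 2)] the value of [g] is [A - t * b]; this [t] makes [t >= 1],
     [b > Rabs A] and [b > p]. *)
  set (t := 1 + 2 * Rabs A + Rabs w). pose proof (Rabs_pos A). pose proof (Rabs_pos w).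
  set (b := exp ((w + t) / 2)).
  assert (Hb : 0 < b) by apply exp_pos.
  assert (HbA : Rabs A < b).
  { pose proof (exp_ineq1_le ((w + t) / 2)) as He. fold b in He.
    pose proof (Rle_abs (- w)) as Hw. rewrite Rabs_Ropp in Hw. unfold t in He. lra. }
  assert (Hpb : p < b) by (apply exp_increasing; unfold t; pose proof (Rle_abs (-w)) as Hw; rewrite Rabs_Ropp in Hw; lra).
  assert (Gp : 0 < g w A p).
  { rewrite g_pos by exact Hp. unfold p at 3. rewrite ln_exp.
    replace (w * p - p * (2 * (w / 2 - 1)) + A) with (2 * p + A) by field. exact H. }
  assert (Gb : g w A b < 0).
  { rewrite g_pos by exact Hb. unfold b at 3. rewrite ln_exp.
    replace (w * b - b * (2 * ((w + t) / 2)) + A) with (A - t * b) by field.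
    pose proof (Rle_abs A). assert (1 <= t) by (unfold t; lra). nra. }
  destruct (IVT_interv (fun r => - g w A r) p b) as [r [Hr E]].
  - intros r Hr. apply derivable_continuous_pt, ex_derive_Reals_0.
    unfold g. auto_derive. nra.
  - exact Hpb.
  - lra.
  - lra.
  - exists r. split; [| lra]. destruct (Req_dec p r) as [<- | Hne]; lra.
Qed.

Lemma center_smooth : smooth3 (fun w A _ => 0 < 2 * exp (w / 2 - 1) + A) (fun w A _ => center w A).
Proof.
  assert (Hexp : forall U, smooth3 U (fun w _ _ => exp (w / 2 - 1))).
  { intros U. apply smooth3_comp_exp. apply (smooth3_minus _ (fun w _ _ => w / 2)); [| apply smooth3_const].
    apply (smooth3_mult _ (fun w _ _ => w)); [apply smooth3_1 | apply smooth3_const]. }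
  apply (smooth3_implicit (fun w A => 0 < 2 * exp (w / 2 - 1) + A) (fun w A r => 0 < r - exp (w / 2 - 1))
           (fun w A r => r * (2 * ln r) - w * r - A)).
  - intros w A H.
    destruct (open3_pos (fun w A _ => 2 * exp (w / 2 - 1) + A)) with (a := w) (b := A) (c := 0) as [e [He H']];
      [| exact H |].
    + apply smooth3_cont, (smooth3_plus _ (fun w _ _ => 2 * exp (w / 2 - 1))); [| apply smooth3_2].
      apply (smooth3_mult _ (fun _ _ _ => 2)); [apply smooth3_const | apply Hexp].
    + exists e. split; [exact He |]. intros w' A' Hw HA. apply (H' w' A' 0); auto using Rabs_minus_diag.
  - apply (open3_pos (fun w A r => r - exp (w / 2 - 1))), smooth3_cont.
    apply (smooth3_minus _ (fun _ _ r => r)); [apply smooth3_3 | apply Hexp].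
  - intros w A x y z Hx Hy Hz. lra.
  - apply (smooth3_minus _ (fun w _ r => r * (2 * ln r) - w * r)); [| apply smooth3_2].
    apply (smooth3_minus _ (fun _ _ r => r * (2 * ln r))).
    + apply (smooth3_mult _ (fun _ _ r => r)); [apply smooth3_3 |].
      apply (smooth3_mult _ (fun _ _ _ => 2)); [apply smooth3_const |].
      apply smooth3_comp_ln; [apply smooth3_3 |]. intros w A r Hr. pose proof (exp_pos (w / 2 - 1)). lra.
    + apply (smooth3_mult _ (fun w _ _ => w)); [apply smooth3_1 | apply smooth3_3].
  - intros w A r l Hr Hl. pose proof (exp_pos (w / 2 - 1)).
    assert (E : l = 2 * ln r + 2 - w).
    { apply (uniqueness_limite _ _ _ _ Hl). apply is_derive_Reals. auto_derive; [lra | field; lra]. }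
    rewrite E. pose proof (ln_increasing (exp (w / 2 - 1)) r ltac:(lra) ltac:(lra)) as Hln.
    rewrite ln_exp in Hln. lra.
  - intros w A H. destruct (center_spec w A H) as [H1 H2]. split; [lra |].
    pose proof (exp_pos (w / 2 - 1)). rewrite g_pos in H2 by lra. lra.
Qed.

(** [V] keeps the amplitude on the side of [rho0], so that 0, where the period has no strict
    monotonicity to offer, is avoided. The factor [rho0] in [Phi] makes it increasing for both signs
    of the amplitude. *)
Lemma amplitude_exists al hs X rho0 c0 : time_map al hs X ->
  (forall rho c l, amp_dom al rho c 0 -> rho <> 0 ->
    derivable_pt_lim (fun r => X (2 * PI) r c) rho l -> 0 < l * rho) ->
  amp_dom al rho0 c0 0 -> rho0 <> 0 ->
  exists (I : R -> Prop) (rho : R -> R),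
    open3 (fun _ c _ => I c) /\ I c0 /\ smooth3 (fun _ c _ => I c) (fun _ c _ => rho c) /\
    (forall c, I c -> amp_dom al (rho c) c 0 /\ X (2 * PI) (rho c) c = X (2 * PI) rho0 c0) /\
    rho c0 = rho0.
Proof.
  intros HX Hl HW0 Hrho0.
  set (V := fun _ c rho : R => amp_dom al rho c 0 /\ 0 < rho * rho0).
  set (Phi := fun _ c rho : R => (X (2 * PI) rho c - X (2 * PI) rho0 c0) * rho0).
  assert (HWo : open3 (fun _ c rho => amp_dom al rho c 0)).
  { intros q c rho HW. destruct (amp_dom_open al rho c 0 HW) as [r [Hr H]]. exists r. split; [exact Hr |].
    intros q' c' rho' _ H1 H2. apply H; auto using Rabs_minus_diag. }
  assert (HV : open3 V).
  { apply open3_and_pos; [exact HWo |]. apply smooth3_cont.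
    apply (smooth3_mult _ (fun _ _ rho => rho)); [apply smooth3_3 | apply smooth3_const]. }
  assert (HVi : forall a b x y z, V a b x -> V a b y -> x <= z <= y -> V a b z).
  { intros a c x y z [[Hf Hx] Px] [[_ Hy] Py] Hz. split; [split; [exact Hf |] |].
    - destruct (Rle_dec 0 z); nra.
    - destruct (Rlt_dec 0 rho0); [assert (0 < x) by nra | assert (y < 0) by nra]; nra. }
  assert (HPhi : smooth3 V Phi).
  { apply (smooth3_mult _ (fun _ c rho => X (2 * PI) rho c - X (2 * PI) rho0 c0)); [| apply smooth3_const].
    apply (smooth3_minus _ (fun _ c rho => X (2 * PI) rho c)); [| apply smooth3_const].
    apply (smooth3_comp (fun th rho c => amp_dom al rho c 0) X V (fun _ _ _ => 2 * PI) (fun _ _ rho => rho) (fun _ c _ => c)).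
    - apply amp_dom_open_rho_c.
    - apply (proj2 (proj2 HX)).
    - apply smooth3_const.
    - apply smooth3_3.
    - apply smooth3_2.
    - intros q c rho [HW _]. exact HW. }
  assert (Hpos : forall a b z l, V a b z -> derivable_pt_lim (fun t => Phi a b t) z l -> 0 < l).
  { intros a c rho l [HW Hr] Hd.
    assert (Hd' : derivable_pt_lim (fun r => X (2 * PI) r c) rho (/ rho0 * l + 0)).
    { apply (derivable_pt_lim_ext_near (fun r => / rho0 * Phi a c r + X (2 * PI) rho0 c0) _ _ _ 1); [lra | |].
      - intros t _. unfold Phi. field. exact Hrho0.
      - apply (derivable_pt_lim_plus (fun r => / rho0 * Phi a c r) (fun _ => X (2 * PI) rho0 c0));
          [apply derivable_pt_lim_scal, Hd | apply derivable_pt_lim_const]. }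
    assert (Hne : rho <> 0) by (intros ->; lra).
    pose proof (Hl rho c _ HW Hne Hd') as P. rewrite Rplus_0_r in P.
    assert (P2 : 0 < (/ rho0 * l * rho) * (rho * rho0)) by (apply Rmult_lt_0_compat; assumption).
    replace (/ rho0 * l * rho * (rho * rho0)) with (l * (rho * rho)) in P2 by (field; exact Hrho0).
    assert (0 < rho * rho) by nra. apply Rnot_le_lt. intros Hle. nra. }
  set (I := fun c => exists z, V 0 c z /\ Phi 0 c z = 0).
  set (rho := fun c => epsilon (inhabits 0) (fun z => V 0 c z /\ Phi 0 c z = 0)).
  assert (Hspec : forall c, I c -> V 0 c (rho c) /\ Phi 0 c (rho c) = 0).
  { intros c Hc. apply (epsilon_spec (inhabits 0) (fun z => V 0 c z /\ Phi 0 c z = 0)), Hc. }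
  pose proof (implicit_open V Phi HV HVi HPhi Hpos) as HIo.
  assert (HI0 : I c0).
  { exists rho0. split; [split; [exact HW0 | nra] | unfold Phi; ring]. }
  exists I, rho. split; [| split; [| split; [| split]]].
  - intros q c q' Hc. destruct (HIo 0 c Hc) as [r [Hr H]]. exists r. split; [exact Hr |].
    intros _ c' _ _ Hc' _. apply (H 0 c'); auto using Rabs_minus_diag.
  - exact HI0.
  - apply (smooth3_implicit (fun _ c => I c) V Phi (fun _ c => rho c)); try assumption.
    intros a c Hc. apply (Hspec c Hc).
  - intros c Hc. destruct (Hspec c Hc) as [[HW _] E]. split; [exact HW |].
    apply Rmult_integral in E. destruct E as [E | E]; [lra | contradiction].
  (* [rho] is chosen by [epsilon]; strict monotonicity forces the choice at [c0] to be [rho0]. *)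
  - destruct (Hspec c0 HI0) as [HVc E].
    assert (Hmono : forall x y, V 0 c0 x -> V 0 c0 y -> x < y -> Phi 0 c0 x < Phi 0 c0 y)
      by (intros x y; apply slice_incr; assumption).
    assert (V0 : V 0 c0 rho0) by (split; [exact HW0 | nra]).
    assert (E0 : Phi 0 c0 rho0 = 0) by (unfold Phi; ring).
    destruct (Rtotal_order (rho c0) rho0) as [H | [H | H]]; [| exact H |].
    + pose proof (Hmono _ _ HVc V0 H). lra.
    + pose proof (Hmono _ _ V0 HVc H). lra.
Qed.

(** * The family through a given solution *)

Lemma even_deriv_0 f l : is_even f -> derivable_pt_lim f 0 l -> l = 0.
Proof.
  intros He Hl. assert (E : l * -1 = l); [| lra].
  apply (uniqueness_limite f 0); [| exact Hl].
  apply (derivable_pt_lim_ext_near (fun t => f (- t)) _ 0 _ 1); [lra | intros t _; apply He |].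
  apply (derivable_pt_lim_comp (fun t => - t) f).
  - apply is_derive_Reals. auto_derive; [trivial | ring].
  - rewrite Ropp_0. exact Hl.
Qed.

Lemma orbit_upper al hs X rho c : 0 < al < 1 -> time_map al hs X -> amp_dom al rho c 0 ->
  exists hi, forall x, orbit al X rho c x <= hi.
Proof.
  intros Hal HX HW.
  destruct (periodic_bounds (X (2 * PI) rho c) (orbit al X rho c) _ (time_map_period_pos al hs X rho c HX HW)
     (orbit_periodic al hs X rho c HX HW) (fun x => orbit_deriv al hs X rho c x HX HW)) as [m [hi [_ H]]].
  exists hi. exact H.
Qed.

Lemma orbit_oscillates al hs X rho c : time_map al hs X -> amp_dom al rho c 0 ->
  oscillates c (orbit al X rho c) (fun x => - rho * sin (angle X rho c x)).
Proof.
  intros HX HW x. split; [apply (orbit_deriv al hs) | apply (orbit_deriv2 al hs)]; assumption.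
Qed.

(** Both start at time 0 from the same point with velocity 0, and both stay in a compact interval of
    positive values. *)
Lemma oscillation_is_orbit al hs X c y y1 hi : 0 < al < 1 -> time_map al hs X ->
  oscillates c y y1 -> (forall x, al <= y x <= hi) -> y1 0 = 0 ->
  amp_dom al (sigma c (y 0)) c 0 -> sigma_inv al (sigma c (y 0)) c = y 0 ->
  forall x, y x = orbit al X (sigma c (y 0)) c x.
Proof.
  intros Hal HX Ho Hb H1 HW E. set (rho := sigma c (y 0)) in *.
  destruct (orbit_upper al hs X rho c Hal HX HW) as [hi' Hhi].
  apply (oscillates_unique c y y1 (orbit al X rho c) (fun x => - rho * sin (angle X rho c x)) al (Rmax hi hi') 0).
  - exact Ho.
  - apply (orbit_oscillates al hs); assumption.
  - lra.
  - intros x. pose proof (Hb x). pose proof (Rmax_l hi hi'). lra.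
  - intros x. pose proof (Hhi x). pose proof (Rmax_r hi hi'). pose proof (orbit_gt al X rho c x Hal HW). lra.
  - rewrite (orbit_0 al hs X rho c HX HW), E. reflexivity.
  - rewrite H1, (angle_unique al hs X rho c 0 0 HX HW).
    + rewrite sin_0. ring.
    + apply (proj1 (proj2 HX) rho c HW).
Qed.

Lemma center_relation w A : 0 < 2 * exp (w / 2 - 1) + A ->
  0 < center w A /\ A / center w A = 2 * ln (center w A) - w /\ 0 < 2 + A / center w A.
Proof.
  intros H. destruct (center_spec w A H) as [H1 H2]. pose proof (exp_pos (w / 2 - 1)) as He.
  assert (Hr : 0 < center w A) by lra. split; [exact Hr |].
  rewrite g_pos in H2 by exact Hr.
  assert (E : A / center w A = 2 * ln (center w A) - w).
  { apply (Rmult_eq_reg_r (center w A)); [| lra]. unfold Rdiv. rewrite Rmult_assoc, Rinv_l by lra. lra. }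
  split; [exact E |]. rewrite E. pose proof (ln_increasing _ _ He H1) as Hln. rewrite ln_exp in Hln. lra.
Qed.

Lemma scaled_nonlinearity w A r y : 0 < r -> 0 < y -> A / r = 2 * ln r - w ->
  w * (r * y) - r * y * ln ((r * y) ^ 2) + A = - (r * force (A / r) y).
Proof.
  intros Hr Hy E. rewrite ln_pow by (apply Rmult_lt_0_compat; assumption).
  rewrite ln_mult by assumption. unfold force. rewrite E.
  replace A with (r * (2 * ln r - w)) by (rewrite <- E; field; lra). simpl. ring.
Qed.

(** The scaling by [center] changes neither time nor period, so the family is the center times the
    orbit whose amplitude is tuned to the period [L0]; [al] is fixed once, from [phi], and serves
    all nearby parameters. *)
Lemma positive_family w0 A0 phi L0 : 0 < 2 * exp (w0 / 2 - 1) + A0 -> (forall x, 0 < phi x) ->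
  is_solution w0 A0 phi -> is_even phi -> has_min_period L0 phi ->
  exists (O : R -> R -> Prop) (psi : R -> R -> R -> R),
      open2 O /\ O w0 A0 /\
      smooth3 (fun w A _ => O w A) psi /\
      (forall w A, O w A ->
         is_solution w A (psi w A) /\ is_even (psi w A) /\ is_periodic L0 (psi w A)) /\
      (forall x, psi w0 A0 x = phi x).
Proof.
  intros HA Hpos [d1 [d2 Hsol]] Heven [HL [Hper Hmin]].
  destruct (center_relation w0 A0 HA) as [Hr0 [Ec0 Hc0]].
  set (r0 := center w0 A0) in *. set (c0 := A0 / r0) in *.
  set (y := fun x => / r0 * phi x). set (y1 := fun x => / r0 * d1 x).
  assert (Hir : 0 < / r0) by (apply Rinv_0_lt_compat, Hr0).
  assert (Hry : forall x, r0 * y x = phi x) by (intros x; unfold y; field; lra).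
  assert (Hypos : forall x, 0 < y x) by (intros x; apply Rmult_lt_0_compat; auto).
  assert (Ho : oscillates c0 y y1).
  { intros x. destruct (Hsol x) as [S1 [S2 S3]]. split; [apply derivable_pt_lim_scal, S1 |].
    replace (- force c0 (y x)) with (/ r0 * d2 x); [apply derivable_pt_lim_scal, S2 |].
    pose proof (scaled_nonlinearity w0 A0 r0 (y x) Hr0 (Hypos x) Ec0) as E. rewrite Hry in E. fold c0 in E.
    apply (Rmult_eq_reg_l r0); [| lra]. replace (r0 * (/ r0 * d2 x)) with (d2 x) by (field; lra). lra. }
  assert (Hyper : is_periodic L0 y) by (intros x; unfold y; rewrite Hper; reflexivity).
  assert (Hy10 : y1 0 = 0).
  { unfold y1. rewrite (even_deriv_0 phi (d1 0) Heven (proj1 (Hsol 0))). ring. }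
  assert (Hnc : exists x x', y x <> y x').
  (* A shift by less than the minimal period shows that [phi] is not constant. *)
  { destruct (Hmin (L0 / 2) ltac:(lra)) as [x Hx]. exists (x + L0 / 2), x. intros E. apply Hx.
    rewrite <- !Hry, E. reflexivity. }
  destruct (periodic_oscillation_in_well c0 L0 y y1 Hc0 Ho HL Hyper Hypos Hnc Hy10)
    as [al [hi [Hal [Hb [HW0 [Hrho0 Eh]]]]]].
  destruct (time_map_exists al Hal) as [hs [X [HX Hl]]].
  set (rho0 := sigma c0 (y 0)) in *.
  assert (Horb : forall x, y x = orbit al X rho0 c0 x).
  { apply (oscillation_is_orbit al hs X c0 y y1 hi); assumption. }
  assert (HT : X (2 * PI) rho0 c0 = L0).
  (* Minimality is used on both sides: a shorter orbit period would contradict that of [L0], and a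
     longer one the fact that the orbit does not return to its initial value before a full turn. *)
  { pose proof (time_map_period_pos al hs X rho0 c0 HX HW0) as HTp.
    destruct (Rtotal_order (X (2 * PI) rho0 c0) L0) as [H | [H | H]]; [| exact H |]; exfalso.
    - destruct (Hmin _ (conj HTp H)) as [x Hx]. apply Hx.
      rewrite <- !Hry, !Horb, (orbit_periodic al hs X rho0 c0 HX HW0). reflexivity.
    - apply (orbit_min_period al hs X rho0 c0 L0 Hal HX HW0 Hrho0 (conj HL H)).
      rewrite <- !Horb, <- (Hyper 0), Rplus_0_l. reflexivity. }
  destruct (amplitude_exists al hs X rho0 c0 HX Hl HW0 Hrho0) as [I [rho [HIo [HI0 [Hrs [HIs Hr00]]]]]].
  set (U := fun w A _ : R => 0 < 2 * exp (w / 2 - 1) + A).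
  assert (HU : open3 U).
  { apply (open3_pos (fun w A _ => 2 * exp (w / 2 - 1) + A)), smooth3_cont.
    apply (smooth3_plus _ (fun w _ _ => 2 * exp (w / 2 - 1))); [| apply smooth3_2].
    apply (smooth3_mult _ (fun _ _ _ => 2)); [apply smooth3_const |].
    apply smooth3_comp_exp. apply (smooth3_minus _ (fun w _ _ => w / 2)); [| apply smooth3_const].
    apply (smooth3_mult _ (fun w _ _ => w)); [apply smooth3_1 | apply smooth3_const]. }
  set (cc := fun w A => A / center w A).
  assert (Hcc : smooth3 U (fun w A _ => cc w A)).
  { apply (smooth3_mult _ (fun _ A _ => A)); [apply smooth3_2 |].
    apply smooth3_comp_inv; [exact center_smooth |]. intros w A q H. apply (center_relation w A H). }
  (* The well must exist, and [c] must lie where the period equation is solvable; continuity of [cc]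
     makes this open. *)
  set (O := fun w A => U w A 0 /\ I (cc w A)).
  assert (HO : open3 (fun w A _ => O w A)).
  { intros w A q [H1 H2]. destruct (HU w A 0 H1) as [e1 [He1 HU1]].
    destruct (HIo 0 (cc w A) 0 H2) as [e2 [He2 HI2]].
    destruct (smooth3_cont _ _ Hcc w A 0 H1 e2 He2) as [e3 [He3 HC3]].
    exists (Rmin e1 e3). split; [apply Rmin_pos; assumption |].
    intros w' A' _ Hw HA' _. pose proof (Rmin_l e1 e3). pose proof (Rmin_r e1 e3).
    split; [apply (HU1 w' A' 0) | apply (HI2 0 (cc w' A') 0)]; auto using Rabs_minus_diag; try lra.
    apply (HC3 w' A' 0); auto using Rabs_minus_diag; lra. }
  assert (HccO : smooth3 (fun w A _ => O w A) (fun w A _ => cc w A)).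
  { apply smooth3_sub with (2 := Hcc). intros w A q H. apply H. }
  assert (Hrhoc : smooth3 (fun w A _ => O w A) (fun w A _ => rho (cc w A))).
  { apply (smooth3_comp _ (fun _ c _ => rho c) _ (fun _ _ _ => 0) (fun w A _ => cc w A) (fun _ _ _ => 0) HIo Hrs);
    auto using smooth3_const. intros w A q H. apply H. }
  assert (Hang : smooth3 (fun w A _ => O w A) (fun w A x => angle X (rho (cc w A)) (cc w A) x)).
  { apply (smooth3_comp _ (fun x c _ => angle X (rho c) c x) _ (fun _ _ x => x) (fun w A _ => cc w A) (fun _ _ _ => 0)
             HIo (angle_smooth al hs X rho I HX HIo Hrs (fun c Hc => proj1 (HIs c Hc))));
    auto using smooth3_const, smooth3_3. intros w A q H. apply H. }
  exists O, (fun w A x => center w A * orbit al X (rho (cc w A)) (cc w A) x).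
  split; [| split; [| split; [| split]]].
  - intros w A H. destruct (HO w A 0 H) as [e [He H']]. exists e. split; [exact He |].
    intros w' A' Hw HA'. apply (H' w' A' 0); auto using Rabs_minus_diag.
  - split; [exact HA | exact HI0].
  - apply (smooth3_mult _ (fun w A _ => center w A)).
    + apply smooth3_sub with (2 := center_smooth). intros w A q H. apply H.
    + apply (smooth3_comp (amp_dom al) (fun s c _ => sigma_inv al s c) _
               (fun w A x => rho (cc w A) * cos (angle X (rho (cc w A)) (cc w A) x))
               (fun w A _ => cc w A) (fun _ _ _ => 0) (amp_dom_open al) (sigma_inv_smooth al Hal)).
      * apply (smooth3_mult _ (fun w A _ => rho (cc w A))); [exact Hrhoc |]. apply smooth3_comp_cos, Hang.
      * exact HccO.
      * apply smooth3_const.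
      * intros w A x H. apply amp_dom_cos, HIs, H.
  - intros w A [H1 H2]. destruct (center_relation w A H1) as [Hr [Ec Hc]]. fold (cc w A) in Ec.
    destruct (HIs _ H2) as [HW HTc]. rewrite HT in HTc.
    set (c := cc w A) in *. set (r := center w A) in *.
    split; [| split].
    + exists (fun x => r * (- rho c * sin (angle X (rho c) c x))), (fun x => r * - force c (orbit al X (rho c) c x)).
      intros x. destruct (orbit_oscillates al hs X (rho c) c HX HW x) as [O1 O2].
      split; [apply derivable_pt_lim_scal, O1 |]. split; [apply (derivable_pt_lim_scal _ r), O2 |].
      pose proof (orbit_gt al X (rho c) c x Hal HW) as Hg.
      pose proof (scaled_nonlinearity w A r (orbit al X (rho c) c x) Hr ltac:(lra) Ec) as E.
      change (A / r) with c in E. lra.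
    + intros x. rewrite (orbit_even al hs X (rho c) c HX HW). reflexivity.
    + intros x. rewrite <- HTc, (orbit_periodic al hs X (rho c) c HX HW). reflexivity.
  - intros x. change (cc w0 A0) with c0. fold r0. rewrite Hr00, <- Horb. apply Hry.
Qed.

Theorem theorem4p6 :
  forall w0 A0 : R, P1 w0 A0 \/ P3 w0 A0 ->
  exists delta : R, 0 < delta /\
  forall (phi : R -> R) (L0 : R),
    admissible w0 A0 delta phi ->
    is_solution w0 A0 phi -> is_even phi -> has_min_period L0 phi ->
    exists (O : R -> R -> Prop) (psi : R -> R -> R -> R),
      open2 O /\ O w0 A0 /\
      smooth3 (fun w A _ => O w A) psi /\
      (forall w A, O w A ->
         is_solution w A (psi w A) /\ is_even (psi w A) /\ is_periodic L0 (psi w A)) /\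
      (forall x, psi w0 A0 x = phi x).
Proof.
  intros w0 A0 _. exists 1. split; [lra |]. intros phi L0 Hadm Hsol Heven Hper.
  pose proof (exp_pos (w0 / 2 - 1)) as He.
  (* The well on the side of the solution exists: on [P1] the bound on [Rabs A0] gives it for both
     signs, on [P3] the sign of [A0] agrees with that of the solution. *)
  assert (Hcase : (0 < 2 * exp (w0 / 2 - 1) + A0 /\ forall x, 0 < phi x) \/
                  (0 < 2 * exp (w0 / 2 - 1) + - A0 /\ forall x, phi x < 0)).
  { destruct Hadm as [[H1 [r0 [r1 [r2 [_ [_ [_ [_ [_ H]]]]]]]]] | [_ [r2 [_ [_ [_ [_ H]]]]]]].
    - apply Rabs_def2 in H1.
      destruct H as [[_ [[H _] | [H _]]] | [_ [[H _] | [H _]]]]; [left | right | right | left];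
      (split; [lra | exact H]).
    - destruct H as [[HA H] | [HA H]]; [right | left]; (split; [lra | exact H]). }
  destruct Hcase as [[HA Hpos] | [HA Hneg]].
  - exact (positive_family w0 A0 phi L0 HA Hpos Hsol Heven Hper).
  - assert (Hpos : forall x, 0 < - phi x) by (intros x; pose proof (Hneg x); lra).
    assert (Hneg_sol : forall w A f, is_solution w A f -> is_solution w (- A) (fun x => - f x)).
    { intros w A f [d1 [d2 H]]. exists (fun x => - d1 x), (fun x => - d2 x). intros x.
      destruct (H x) as [H1 [H2 H3]]. split; [apply derivable_pt_lim_opp, H1 |].
      split; [apply derivable_pt_lim_opp, H2 |].
      replace ((- f x) ^ 2) with (f x ^ 2) by ring. lra. }
    assert (Hper' : has_min_period L0 (fun x => - phi x)).
    { destruct Hper as [HL [Hp Hm]]. split; [exact HL |]. split.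
      - intros x. rewrite Hp. reflexivity.
      - intros T HT. destruct (Hm T HT) as [x Hx]. exists x. lra. }
    destruct (positive_family w0 (- A0) (fun x => - phi x) L0 HA Hpos (Hneg_sol _ _ _ Hsol))
      as [O [psi [HO [HO0 [Hs [Hfam E]]]]]].
    + intros x. rewrite Heven. reflexivity.
    + exact Hper'.
    + exists (fun w A => O w (- A)), (fun w A x => - psi w (- A) x).
      assert (HO3 : open3 (fun w A _ => O w A)).
      { intros w A q H. destruct (HO w A H) as [r [Hr H']]. exists r. split; [exact Hr |]. auto. }
      split; [| split; [| split; [| split]]].
      * intros w A H. destruct (HO w (- A) H) as [r [Hr H']]. exists r. split; [exact Hr |].
        intros w' A' Hw HA'. apply H'; [exact Hw |].
        replace (- A' - - A) with (- (A' - A)) by ring. rewrite Rabs_Ropp. exact HA'.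
      * exact HO0.
      * apply smooth3_opp.
        apply (smooth3_comp (fun w A _ => O w A) psi _ (fun w _ _ => w) (fun _ A _ => - A) (fun _ _ x => x) HO3 Hs);
        auto using smooth3_1, smooth3_3. apply smooth3_opp, smooth3_2.
      * intros w A H. destruct (Hfam w (- A) H) as [F1 [F2 F3]]. split; [| split].
        -- rewrite <- (Ropp_involutive A) at 1. apply Hneg_sol, F1.
        -- intros x. rewrite F2. reflexivity.
        -- intros x. rewrite F3. reflexivity.
      * intros x. rewrite E. ring.
Qed.
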